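(* With notation as in the context, the conformal factor $\rho^{-1}$, viewed as a function of $(u,v)$ on $\tilde\Omega^*=\tilde\Omega\setminus\{(0,0)\}$, is harmonic on the interior of $\tilde\Omega^*$, and hence, writing $z=u+iv$, \[ \rho^{-1}=-C\log|z|+h(z) \] for some constant $C\ge0$ and some smooth harmonic function $h$ on the interior of $\tilde\Omega$.
   Context: Let $\lambda$ be Lebesgue measure on $\mathbb{R}^2$. Let $\Omega=\mathrm{Hull}\{(-\tfrac12,-\tfrac12),(-\tfrac16,-\tfrac12),(\tfrac12,\tfrac12),(-\tfrac12,-\tfrac16)\}$ and $\Theta=\mathrm{Hull}\{(-\tfrac16,-\tfrac16),(\tfrac12,-\tfrac12),(\tfrac56,-\tfrac12),(0,0)\}\cup\mathrm{Hull}\{(-\tfrac16,-\tfrac16),(-\tfrac12,\tfrac12),(-\tfrac12,\tfrac56),(0,0)\}$. Let $\varphi$ be the Brenier potential: a convex function on $\Omega$ whose gradient pushes $\chi_\Omega\lambda$ forward to $\chi_\Theta\lambda$ (unique up to additive constant); it is smooth and strictly convex on $\Omega\setminus\{y=x\ge0\}$ with $\varphi_{xx}\varphi_{yy}-\varphi_{xy}^2=1$ there. Set $u=x-y$, $v=\varphi_x+\varphi_y$ (extended continuously to $\Omega$), $\rho=\varphi_{xx}+2\varphi_{xy}+\varphi_{yy}$ (which extends to a continuous positive function on $\Omega\setminus\{(0,0)\}$), $f=(u,v)$, a homeomorphism of $\Omega$ onto $\tilde\Omega:=f(\Omega)$ fixing the origin; $\rho$ is regarded as a function on $\tilde\Omega\setminus\{(0,0)\}$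 via $f^{-1}$. Harmonic means with respect to the Euclidean Laplacian in $(u,v)$. *)

(* Defs.v *)
From HB Require Import structures.
From mathcomp Require Import all_boot all_order all_algebra.
From mathcomp Require Import all_classical all_reals all_analysis.

Set Implicit Arguments.
Unset Strict Implicit.
Unset Printing Implicit Defensive.

Import Order.TTheory GRing.Theory Num.Theory.
Import numFieldNormedType.Exports.

Local Open Scope classical_set_scope.
Local Open Scope ring_scope.

Section Defs.
Variable R : realType.

Definition hull4 (a b c d : R * R) : set (R * R) :=
  [set p | exists t1 t2 t3 t4 : R,
      [/\ 0 <= t1, 0 <= t2, 0 <= t3 & 0 <= t4] /\
      t1 + t2 + t3 + t4 = 1 /\
      p.1 = t1 * a.1 + t2 * b.1 + t3 * c.1 + t4 * d.1 /\
      p.2 = t1 * a.2 + t2 * b.2 + t3 * c.2 + t4 * d.2].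

Definition Omega : set (R * R) :=
  hull4 (- (1/2), - (1/2)) (- (1/6), - (1/2)) (1/2, 1/2) (- (1/2), - (1/6)).

Definition Theta : set (R * R) :=
  hull4 (- (1/6), - (1/6)) (1/2, - (1/2)) (5/6, - (1/2)) (0, 0)
  `|` hull4 (- (1/6), - (1/6)) (- (1/2), 1/2) (- (1/2), 5/6) (0, 0).

Definition diag_ray : set (R * R) := [set p | p.2 = p.1 /\ 0 <= p.1].

Definition smooth_region : set (R * R) := interior Omega `\` diag_ray.

Definition dx (f : R * R -> R) : R * R -> R :=
  fun p => derive1 (fun t => f (t, p.2)) p.1.
Definition dy (f : R * R -> R) : R * R -> R :=
  fun p => derive1 (fun t => f (p.1, t)) p.2.

Definition pdiff (w : seq bool) (f : R * R -> R) : R * R -> R :=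
  foldr (fun b g => if b then dy g else dx g) f w.

Definition Ck_on (k : nat) (U : set (R * R)) (f : R * R -> R) : Prop :=
  forall (w : seq bool), (size w <= k)%N ->
    (forall p, U p -> {for p, continuous (pdiff w f)}) /\
    ((size w < k)%N -> forall p, U p ->
       derivable (fun t => pdiff w f (t, p.2)) p.1 1 /\
       derivable (fun t => pdiff w f (p.1, t)) p.2 1).

Definition smooth_on (U : set (R * R)) (f : R * R -> R) : Prop :=
  forall k, Ck_on k U f.

Definition harmonic_on (U : set (R * R)) (f : R * R -> R) : Prop :=
  Ck_on 2 U f /\ forall p, U p -> dx (dx f) p + dy (dy f) p = 0.

Definition convex_fun_on (A : set (R * R)) (f : R * R -> R) : Prop :=
  forall p q t, A p -> A q -> 0 <= t <= 1 ->
    f (t * p.1 + (1 - t) * q.1, t * p.2 + (1 - t) * q.2)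
      <= t * f p + (1 - t) * f q.

Definition grad (f : R * R -> R) : R * R -> R * R := fun p => (dx f p, dy f p).

Definition leb2 : set (measurableTypeR R * measurableTypeR R)%type -> \bar R :=
  (@lebesgue_measure R \x @lebesgue_measure R)%E.

(** grad phi pushes chi_Omega lambda forward to chi_Theta lambda.
    (grad phi is taken on the smooth region, which has full measure in Omega.) *)
Definition brenier_pushforward (phi : R * R -> R) : Prop :=
  forall B : set (measurableTypeR R * measurableTypeR R)%type,
    measurable B ->
    leb2 (smooth_region `&` grad phi @^-1` B) = leb2 (Theta `&` B).

End Defs.

(* Main.v *)
Require Import Defs.
From HB Require Import structures.
From mathcomp Require Import all_boot all_order all_algebra.
From mathcomp Require Import all_classical all_reals all_analysis.
From mathcomp Require Import ring lra.
Import Order.TTheory GRing.Theory Num.Theory.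
Import numFieldNormedType.Exports.
Local Open Scope classical_set_scope.
Local Open Scope ring_scope.
Set Implicit Arguments.
Unset Strict Implicit.
Unset Printing Implicit Defensive.

(* Write p = (phi_x - phi_y) / 2 and w = x + y. By the Monge-Ampere equation, in the coordinates
   u = x - y and v = phi_x + phi_y the functions p and w are conjugate harmonic, and p_u = 1 / rho,
   away from the image of the slit {y = x >= 0}. Convexity and mass balance force the one-sided
   limits of p at the slit to differ by 4 k v, with the same k = 0 or k = 1 along the whole slit:
   gradients strictly between the two limits are missed by the gradient map, so they cannot fill
   part of Theta. Subtracting a multiple of Re (z log z), with its cut along the slit, leaves a
   function that is harmonic off the slit, continuous across it together with its u-derivative,
   and bounded near 0; a maximum principle identifies it with a Poisson integral. Differentiating
   in u gives 1 / rho = - C log |z| + h with C = 2 k / pi. *)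

(** * Calculus in the plane *)

(** Two difficulties shape the argument: nothing is known in advance about phi_x - phi_y at the
    slit, and [1 / rho] might have any singularity at the origin. Both are met by working with the
    u-primitive p of [1 / rho]. It is half a difference of gradient components, so it is bounded
    because [Theta] is, which leaves no room for a pole; and it is monotone in u at fixed v because
    [phi] is convex, so it has one-sided limits at the slit. In terms of p and v, and for v > 0, the
    two lobes of [Theta] are separated by the gap |p| < 2 v; a nonzero jump has to span exactly this
    gap, whence the value 4 v. The function Re (z log z) fits because its jump across the cut is
    linear in v, while its u-derivative, log |z| up to a constant, does not see the cut. The sign of
    C is that of k. Harmonicity of p off the slit is the symmetry of the second derivatives of w;
    the Monge-Ampere equation is what turns p_u into [1 / rho]. *)

Section Plane.
Variable R : realType.
Implicit Types (f g a : R * R -> R) (p q : R * R).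

(* Not a type class, unlike [is_derive]: this keeps instance resolution from
   closing premises of derivation rules with uninformative ['D_1] terms. *)
Definition der1 (f : R -> R) (x l : R) : Prop := is_derive x (1 : R) f l.

Definition is_dx f p (l : R) := is_derive p.1 (1 : R) (fun t => f (t, p.2)) l.
Definition is_dy f p (l : R) := is_derive p.2 (1 : R) (fun t => f (p.1, t)) l.

Lemma nbhs2P p (A : set (R * R)) :
  nbhs p A <-> exists2 e : R, 0 < e &
    forall q, `|q.1 - p.1| < e -> `|q.2 - p.2| < e -> A q.
Proof.
split=> [/nbhs_ballP[e e0 eA]|[e e0 eA]].
  exists e => // q q1 q2; apply: eA; split => /=;
    by rewrite -ball_normE /= distrC.
apply/nbhs_ballP; exists e => // q [] /=.
rewrite -!ball_normE /= => q1 q2.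
by apply: eA; rewrite distrC.
Qed.

Lemma continuous2P f p :
  {for p, continuous f} <-> forall e : R, 0 < e -> exists2 d : R, 0 < d &
    forall q, `|q.1 - p.1| < d -> `|q.2 - p.2| < d -> `|f q - f p| < e.
Proof.
split=> [cf e e0|cf].
  have /cvgrPdist_lt /(_ e e0) /nbhs2P[d d0 dP] := cf.
  by exists d => // q q1 q2; rewrite distrC; exact: dP.
apply/cvgrPdist_lt => e e0; apply/nbhs2P.
have [d d0 dP] := cf e e0.
by exists d => // q q1 q2; rewrite distrC; exact: dP.
Qed.

Lemma nbhs1P (x : R) (A : set R) :
  nbhs x A <-> exists2 e : R, 0 < e & forall y, `|y - x| < e -> A y.
Proof.
split=> [/nbhs_ballP[e e0 eA]|[e e0 eA]].
  by exists e => // q q1; apply: eA; rewrite -ball_normE /= distrC.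
apply/nbhs_ballP; exists e => // q /=.
rewrite -!ball_normE /= => q1.
by apply: eA; rewrite distrC.
Qed.

Lemma continuous1P (f : R -> R) (x : R) :
  {for x, continuous f} <-> forall e : R, 0 < e -> exists2 d : R, 0 < d &
    forall y, `|y - x| < d -> `|f y - f x| < e.
Proof.
split=> [cf e e0|cf].
  have /cvgrPdist_lt /(_ e e0) /nbhs1P[d d0 dP] := cf.
  by exists d => // q q1; rewrite distrC; exact: dP.
apply/cvgrPdist_lt => e e0; apply/nbhs1P.
have [d d0 dP] := cf e e0.
by exists d => // q q1; rewrite distrC; exact: dP.
Qed.

Lemma is_derive_cont (f : R -> R) (x l : R) :
  is_derive x (1 : R) f l -> {for x, continuous f}.
Proof. by move=> [/derivable1_diffP/differentiable_continuous]. Qed.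

(** Treats a < b, a > b and a = b together, so that its uses need no case distinction on the order
    of the points. *)
Lemma mvt_dist (f df : R -> R) (a b : R) :
  (forall t, `|t - a| <= `|b - a| -> is_derive t (1 : R) f (df t)) ->
  exists2 c, `|c - a| <= `|b - a| & f b - f a = df c * (b - a).
Proof.
move=> fD.
have [ab|ba|->] := ltgtP a b; last first.
- by exists b; rewrite ?subrr ?normr0 ?mulr0.
- have H t : b <= t <= a -> `|t - a| <= `|b - a|.
    by move=> /andP[bt ta]; rewrite !ler0_norm ?subr_le0// ?(ltW ba)//; lra.
  have [||c] := @MVT R f df b a ba.
  + by move=> x; rewrite in_itv /= => /andP[bx xa]; apply/fD/H; rewrite !ltW.
  + apply: derivable_within_continuous => x; rewrite in_itv /= => xab.
    by have [] := fD x (H x xab).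
  + rewrite in_itv /= => /andP[bc ca] E; exists c; first by apply: H; rewrite !ltW.
    by rewrite -opprB E -mulrN opprB.
- have H t : a <= t <= b -> `|t - a| <= `|b - a|.
    by move=> /andP[bt ta]; rewrite !ger0_norm ?subr_ge0// ?(ltW ab)//; lra.
  have [||c] := @MVT R f df a b ab.
  + by move=> x; rewrite in_itv /= => /andP[bx xa]; apply/fD/H; rewrite !ltW.
  + apply: derivable_within_continuous => x; rewrite in_itv /= => xab.
    by have [] := fD x (H x xab).
  + by rewrite in_itv /= => /andP[bc ca] E; exists c => //; apply: H; rewrite !ltW.
Qed.

Lemma is_deriveP (f : R -> R) (x l : R) :
  is_derive x (1 : R) f l <-> forall e : R, 0 < e -> exists2 d : R, 0 < d &
    forall y, y != x -> `|y - x| < d -> `|(f y - f x) / (y - x) - l| < e.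
Proof.
have E h : (h^-1 *: ((f \o shift x) (h *: 1%R) - f x)) = (f (h + x) - f x) / h.
  by rewrite /= /shift /= scaler1 /GRing.scale /= mulrC.
split=> [[dv dl] e e0|H].
  move: dv; rewrite /derivable; under eq_fun do rewrite E.
  move=> /cvg_ex[l' cl'].
  have <- : l' = l.
    rewrite -dl /derive; under eq_fun do rewrite E.
    by rewrite (cvg_lim _ cl').
  have /cvgrPdist_lt /(_ e e0) := cl'.
  rewrite near_withinE => /nbhs1P[d d0 dP].
  exists d => // y yx yd.
  have := dP (y - x); rewrite subr0 => /(_ yd).
  by rewrite subr_eq0 => /(_ yx); rewrite distrC subrK.
have cl : h^-1 *: ((f \o shift x) (h *: 1%R) - f x) @[h --> 0^'] --> l.
  under eq_fun do rewrite E.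
  apply/cvgrPdist_lt => e e0; have [d d0 dP] := H e e0.
  rewrite near_withinE; apply/nbhs1P; exists d => // h; rewrite subr0 => hd h0.
  rewrite distrC; have := dP (h + x); rewrite addrK; apply => //.
  by rewrite -subr_eq0 addrK.
by apply: DeriveDef; [apply/cvg_ex; exists l|exact: (cvg_lim _ cl)].
Qed.

Lemma is_derive_near (f g : R -> R) (x l : R) :
  (\forall y \near x, f y = g y) -> is_derive x (1 : R) f l ->
  is_derive x (1 : R) g l.
Proof.
move=> /nbhs1P[d d0 fg] /is_deriveP fD; apply/is_deriveP => e e0.
have [d' d'0 dP] := fD e e0.
exists (Num.min d d'); first by rewrite lt_min d0.
move=> y yx; rewrite lt_min => /andP[yd yd'].
by rewrite -!fg ?subrr ?normr0//; exact: dP.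
Qed.

Lemma is_derive_carath (f : R -> R) (x : R) (c : R -> R) :
  {for x, continuous c} ->
  (\forall y \near x, f y - f x = c y * (y - x)) ->
  is_derive x (1 : R) f (c x).
Proof.
move=> /continuous1P cc /nbhs1P[d d0 dP]; apply/is_deriveP => e e0.
have [d' d'0 d'P] := cc e e0.
exists (Num.min d d'); first by rewrite lt_min d0.
move=> y yx; rewrite lt_min => /andP[yd yd'].
by rewrite dP// mulfK ?subr_eq0//; exact: d'P.
Qed.

End Plane.

Section Plane2.
Variable R : realType.
Implicit Types (f g a : R * R -> R) (p q : R * R).

(** Differentiability of a C^1 function in Caratheodory's form, with exact increments. The slopes
    [al] and [be] belong to the two legs of an L-shaped path from [p] to [q]; the mean value theorem
    makes them values of [ax] and [ay] at points no farther from [p] than [q], hence continuous at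
    [p]. *)
Lemma caratheodory2 a (ax ay : R * R -> R) p :
  (\forall q \near p, is_dx a q (ax q)) -> (\forall q \near p, is_dy a q (ay q)) ->
  {for p, continuous ax} -> {for p, continuous ay} ->
  exists al be : R * R -> R, [/\ {for p, continuous al}, {for p, continuous be},
    al p = ax p, be p = ay p &
    \forall q \near p, a q - a p = al q * (q.1 - p.1) + be q * (q.2 - p.2)].
Proof.
move=> /nbhs2P[d d0 dP] /nbhs2P[d' d'0 d'P] cx cy.
pose al q := if q.1 == p.1 then ax q else (a q - a (p.1, q.2)) / (q.1 - p.1).
pose be q := if q.2 == p.2 then ay (p.1, q.2) else
  (a (p.1, q.2) - a p) / (q.2 - p.2).
have alP q : `|q.1 - p.1| < d -> `|q.2 - p.2| < d ->
    exists2 xi, `|xi - p.1| <= `|q.1 - p.1| & al q = ax (xi, q.2).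
  move=> q1 q2; rewrite /al; case: eqVneq => [E|ne].
    by exists p.1; rewrite ?subrr ?normr0// -E -surjective_pairing.
  have [t tq|c c1 E] := @mvt_dist R (fun t => a (t, q.2)) (fun t => ax (t, q.2)) p.1 q.1.
    by apply: (dP (t, q.2)) => //=; exact: le_lt_trans q1.
  exists c => //.
  by case: q q1 q2 ne c1 E => /= q1 q2 _ _ ne c1 ->; rewrite mulfK// subr_eq0.
have beP q : `|q.2 - p.2| < d' ->
    exists2 xi, `|xi - p.2| <= `|q.2 - p.2| & be q = ay (p.1, xi).
  move=> q2; rewrite /be; case: eqVneq => [E|ne].
    by exists p.2; rewrite ?subrr ?normr0// E.
  have [t tq|c c1 E] := @mvt_dist R (fun t => a (p.1, t)) (fun t => ay (p.1, t)) p.2 q.2.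
    by apply: (d'P (p.1, t)) => //=; rewrite ?subrr ?normr0//; exact: le_lt_trans q2.
  exists c => //.
  by case: p {dP d'P cx cy alP al be} q2 ne c1 E => /= p1 p2 _ ne c1 ->; rewrite mulfK// subr_eq0.
have alp : al p = ax p by rewrite /al eqxx.
have bep : be p = ay p by rewrite /be eqxx -surjective_pairing.
exists al, be; split => //.
- apply/continuous2P => e e0.
  move/continuous2P : cx => /(_ e e0)[d1 d10 d1P].
  exists (Num.min d d1); first by rewrite lt_min d0.
  move=> q; rewrite !lt_min => /andP[q1 q1'] /andP[q2 q2'].
  have [xi xi1 ->] := alP q q1 q2.
  by rewrite alp; apply: d1P => //=; exact: le_lt_trans q1'.
- apply/continuous2P => e e0.
  move/continuous2P : cy => /(_ e e0)[d1 d10 d1P].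
  exists (Num.min d' d1); first by rewrite lt_min d'0.
  move=> q; rewrite !lt_min => /andP[q1 q1'] /andP[q2 q2'].
  have [xi xi1 ->] := beP q q2.
  rewrite bep; apply: d1P => //=; last exact: le_lt_trans q2'.
  by rewrite subrr normr0.
- apply/nbhs2P; exists 1 => // -[q1 q2] _ _.
  rewrite {alP beP alp bep}/al {al}/be {be} /=; case: p {dP d'P cx cy} => p1 p2 /=.
  case: (eqVneq q1 p1) => [->|E1]; case: (eqVneq q2 p2) => [->|E2].
  + by rewrite !subrr !mulr0 addr0.
  + by rewrite subrr mulr0 add0r divfK ?subr_eq0.
  + by rewrite subrr mulr0 addr0 divfK ?subr_eq0.
  + by rewrite !divfK ?subr_eq0// addrA subrK.
Qed.

(** The second difference of [a] over a square of side [h] is [h ^ 2] times a value of [ayx] and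
    also [h ^ 2] times a value of [axy], by two mean value theorems taken in either order.
    Continuity carries the equality to [p]. *)
Lemma clairaut a (ax ay axy ayx : R * R -> R) p :
  (\forall q \near p, is_dx a q (ax q)) -> (\forall q \near p, is_dy a q (ay q)) ->
  (\forall q \near p, is_dy ax q (ayx q)) -> (\forall q \near p, is_dx ay q (axy q)) ->
  {for p, continuous axy} -> {for p, continuous ayx} -> axy p = ayx p.
Proof.
move=> H1 H2 H3 H4 c1 c2.
have /nbhs2P[d d0 dP] : \forall q \near p,
    [/\ is_dx a q (ax q), is_dy a q (ay q), is_dy ax q (ayx q) & is_dx ay q (axy q)].
  near=> q; split; by near: q.
apply/eqP; rewrite -subr_eq0 -normr_le0; apply/ler_addgt0Pl => e e0.
rewrite addr0.
have e20 : 0 < e / 2 by lra.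
move/continuous2P : c1 => /(_ _ e20)[d1 d10 d1P].
move/continuous2P : c2 => /(_ _ e20)[d2 d20 d2P].
pose m := Num.min d (Num.min d1 d2).
have m0 : 0 < m by rewrite /m !lt_min d0 d10.
pose h := m / 2.
have h0 : 0 < h by rewrite /h; lra.
have hm : h < m by rewrite /h; lra.
have := hm; rewrite /m !lt_min => /and3P[hd hd1 hd2].
have nh (x : R) : `|x + h - x| = h by rewrite addrAC subrr add0r gtr0_norm.
have nhd (x : R) : `|x + h - x| < d by rewrite nh.
have n0d (x : R) : `|x - x| < d by rewrite subrr normr0.
have [t th|c cx E1] := @mvt_dist R (fun t => a (t, p.2 + h) - a (t, p.2))
    (fun t => ax (t, p.2 + h) - ax (t, p.2)) p.1 (p.1 + h).
  rewrite nh in th.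
  have [D1 _ _ _] := dP (t, p.2 + h) (le_lt_trans th hd) (nhd p.2).
  have [D2 _ _ _] := dP (t, p.2) (le_lt_trans th hd) (n0d p.2).
  exact: is_deriveB.
rewrite nh in cx.
have [t th|c' c'x E2] := @mvt_dist R (fun t => ax (c, t))
    (fun t => ayx (c, t)) p.2 (p.2 + h).
  rewrite nh in th.
  by have [] := dP (c, t) (le_lt_trans cx hd) (le_lt_trans th hd).
rewrite nh in c'x.
have [t th|s sy E3] := @mvt_dist R (fun t => a (p.1 + h, t) - a (p.1, t))
    (fun t => ay (p.1 + h, t) - ay (p.1, t)) p.2 (p.2 + h).
  rewrite nh in th.
  have [_ D1 _ _] := dP (p.1 + h, t) (nhd p.1) (le_lt_trans th hd).
  have [_ D2 _ _] := dP (p.1, t) (n0d p.1) (le_lt_trans th hd).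
  exact: is_deriveB.
rewrite nh in sy.
have [t th|s' s'x E4] := @mvt_dist R (fun t => ay (t, s))
    (fun t => axy (t, s)) p.1 (p.1 + h).
  rewrite nh in th.
  by have [] := dP (t, s) (le_lt_trans th hd) (le_lt_trans sy hd).
rewrite nh in s'x.
have EE : axy (s', s) = ayx (c, c').
  have h2 : h != 0 by rewrite gt_eqF.
  apply: (mulIf h2); apply: (mulIf h2).
  rewrite /= in E1 E2 E3 E4.
  rewrite (_ : axy (s', s) * h = ay (p.1 + h, s) - ay (p.1, s)); last first.
    by rewrite E4; congr (_ * _); ring.
  rewrite (_ : ayx (c, c') * h = ax (c, p.2 + h) - ax (c, p.2)); last first.
    by rewrite E2; congr (_ * _); ring.
  have -> : (ay (p.1 + h, s) - ay (p.1, s)) * h =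
    (ay (p.1 + h, s) - ay (p.1, s)) * (p.2 + h - p.2) by congr (_ * _); ring.
  have -> : (ax (c, p.2 + h) - ax (c, p.2)) * h =
    (ax (c, p.2 + h) - ax (c, p.2)) * (p.1 + h - p.1) by congr (_ * _); ring.
  by rewrite -E1 -E3; ring.
have := d1P (s', s) (le_lt_trans s'x hd1) (le_lt_trans sy hd1).
have := d2P (c, c') (le_lt_trans cx hd2) (le_lt_trans c'x hd2).
rewrite EE distrC => A B.
have -> : axy p - ayx p = (axy p - ayx (c, c')) + (ayx (c, c') - ayx p) by ring.
apply: (le_trans (ler_normD _ _)).
rewrite -(distrC (ayx p)) (distrC (axy p)); lra.
Unshelve. all: end_near. Qed.

Lemma is_derive_unique (f : R -> R) (x l l' : R) :
  is_derive x (1 : R) f l -> is_derive x (1 : R) f l' -> l = l'.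
Proof. by move=> [_ <-] [_ <-]. Qed.

(** At an interior maximum [f'] vanishes; if [l] were positive, [f'] would be positive just to the
    right of [x] and [f] would increase there. *)
Lemma second_derivative_test (f f' : R -> R) (x l : R) :
  (\forall y \near x, der1 f y (f' y)) ->
  der1 f' x l -> (\forall y \near x, f y <= f x) -> l <= 0.
Proof.
move=> /nbhs1P[d d0 dP] f'D /nbhs1P[d1 d10 d1P].
rewrite leNgt; apply/negP => l0.
have f'x0 : f' x = 0.
  pose m := Num.min d d1; have m0 : 0 < m by rewrite lt_min d0.
  have xm y : y \in `]x - m, x + m[ -> `|y - x| < m.
    by rewrite in_itv /= => /andP[y1 y2]; rewrite ltr_norml; apply/andP; split; lra.
  have xx : x \in `]x - m, x + m[ by rewrite in_itv /=; apply/andP; split; lra.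
  have fx : is_derive x (1 : R) f (f' x) by apply: dP; rewrite subrr normr0.
  apply: (is_derive_unique fx); apply: (@derive1_at_max _ f (x - m) (x + m) x).
  - lra.
  - by move=> t /xm; rewrite lt_min => /andP[/dP[]].
  - by [].
  - by move=> t /xm; rewrite lt_min => /andP[_ /d1P].
move/is_deriveP : f'D => /(_ l l0)[d2 d20 d2P].
pose m := Num.min d (Num.min d1 d2) / 2.
have m0 : 0 < m by rewrite /m divr_gt0// !lt_min d0 d10.
have : m < Num.min d (Num.min d1 d2).
  by rewrite /m ltr_pdivrMr// ltr_pMr ?ltr1n// !lt_min d0 d10.
rewrite !lt_min => /and3P[md md1 md2].
have xm : `|x + m - x| = m by rewrite addrAC subrr add0r gtr0_norm.
have xxm : x < x + m by lra.
have [||c] := @MVT _ f f' x (x + m) xxm.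
- move=> y; rewrite in_itv /= => /andP[y1 y2]; apply: dP.
  by rewrite gtr0_norm ?subr_gt0//; lra.
- apply: derivable_within_continuous => y; rewrite in_itv /= => /andP[y1 y2].
  have : `|y - x| < d by rewrite ger0_norm ?subr_ge0//; lra.
  by move=> /dP[].
rewrite in_itv /= => /andP[c1 c2] E.
have := d1P (x + m); rewrite xm => /(_ md1).
have cx : 0 < c - x by rewrite subr_gt0.
have := d2P c; rewrite gt_eqF// gtr0_norm// => /(_ isT).
have cd2 : c - x < d2 by lra.
move=> /(_ cd2); rewrite f'x0 subr0 ltr_norml => /andP[A _].
have : 0 < f' c / (c - x) by lra.
rewrite pmulr_lgt0 ?invr_gt0// => fc.
have : 0 < f (x + m) - f x by rewrite E; apply: mulr_gt0 => //; lra.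
lra.
Qed.

(** Bounded partials make [a] Lipschitz near [p]. This supplies joint continuity where derivatives
    along the axes are at hand, as for integrals with a parameter. *)
Lemma bounded_partials_continuous a (ax ay : R * R -> R) p (M : R) :
  (\forall q \near p, [/\ is_dx a q (ax q), is_dy a q (ay q),
     `|ax q| <= M & `|ay q| <= M]) -> {for p, continuous a}.
Proof.
move=> /nbhs2P[d d0 dP]; apply/continuous2P => e e0.
have M0 : 0 <= M.
  by have [|| _ _ +_] := dP p; rewrite ?subrr ?normr0//; exact: le_trans.
exists (Num.min d (e / (2 * M + 1))).
  by rewrite lt_min d0/= divr_gt0//; lra.
move=> -[q1 q2]; rewrite /= !lt_min => /andP[h1 h1'] /andP[h2 h2'].
have [t th|c cx E1] := @mvt_dist R (fun t => a (t, q2)) (fun t => ax (t, q2)) p.1 q1.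
  by have [] := dP (t, q2) (le_lt_trans th h1) h2.
have [t th|c' cx' E2] := @mvt_dist R (fun t => a (p.1, t)) (fun t => ay (p.1, t)) p.2 q2.
  have n0 : `|(p.1, t).1 - p.1| < d by rewrite subrr normr0.
  by have [] := dP (p.1, t) n0 (le_lt_trans th h2).
have -> : a (q1, q2) - a p = (a (q1, q2) - a (p.1, q2)) + (a (p.1, q2) - a (p.1, p.2)).
  by rewrite addrA subrK; case: (p).
rewrite E1 E2; apply: (le_lt_trans (ler_normD _ _)); rewrite !normrM.
have [_ _ A _] := dP (c, q2) (le_lt_trans cx h1) h2.
have n0 : `|(p.1, c').1 - p.1| < d by rewrite subrr normr0.
have [_ _ _ B] := dP (p.1, c') n0 (le_lt_trans cx' h2).
rewrite ltr_pdivlMr in h1'; last lra.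
rewrite ltr_pdivlMr in h2'; last lra.
have := ler_wpM2r (normr_ge0 (q1 - p.1)) A.
have := ler_wpM2r (normr_ge0 (q2 - p.2)) B.
have := normr_ge0 (q1 - p.1); have := normr_ge0 (q2 - p.2).
move: h1' h2'; nra.
Qed.

(** The difference quotients agree for small increments, so their limits agree even where [dx] only
    has its default value. *)
Lemma dx_near f g p : (\forall q \near p, f q = g q) -> dx f p = dx g p.
Proof.
move=> /nbhs2P[d d0 fg]; rewrite /dx !derive1E /derive.
suff -> : (fun h => h^-1 *: (((fun t => f (t, p.2)) \o shift p.1) (h *: 1) - f (p.1, p.2))) @ 0^'
  = (fun h => h^-1 *: (((fun t => g (t, p.2)) \o shift p.1) (h *: 1) - g (p.1, p.2))) @ 0^' by [].
have E : \forall h \near 0^', h^-1 *: (((fun t => f (t, p.2)) \o shift p.1) (h *: 1) - f (p.1, p.2))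
  = h^-1 *: (((fun t => g (t, p.2)) \o shift p.1) (h *: 1) - g (p.1, p.2)).
  rewrite near_withinE; apply/nbhs1P; exists d => // h; rewrite subr0 => hd _ /=.
  by rewrite /shift /= scaler1 !fg//= ?subrr ?normr0// addrK.
by rewrite eqEsubset; split; apply: near_eq_cvg => //; apply: filterS E => h ->.
Qed.

Lemma dy_near f g p : (\forall q \near p, f q = g q) -> dy f p = dy g p.
Proof.
move=> /nbhs2P[d d0 fg]; rewrite /dy !derive1E /derive.
suff -> : (fun h => h^-1 *: (((fun t => f (p.1, t)) \o shift p.2) (h *: 1) - f (p.1, p.2))) @ 0^'
  = (fun h => h^-1 *: (((fun t => g (p.1, t)) \o shift p.2) (h *: 1) - g (p.1, p.2))) @ 0^' by [].
have E : \forall h \near 0^', h^-1 *: (((fun t => f (p.1, t)) \o shift p.2) (h *: 1) - f (p.1, p.2))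
  = h^-1 *: (((fun t => g (p.1, t)) \o shift p.2) (h *: 1) - g (p.1, p.2)).
  rewrite near_withinE; apply/nbhs1P; exists d => // h; rewrite subr0 => hd _ /=.
  by rewrite /shift /= scaler1 !fg//= ?subrr ?normr0// addrK.
by rewrite eqEsubset; split; apply: near_eq_cvg => //; apply: filterS E => h ->.
Qed.

Lemma pdiff_near w f g p : (\forall q \near p, f q = g q) ->
  \forall q \near p, pdiff w f q = pdiff w g q.
Proof.
elim: w => [//|b w IH] /IH{IH} /near_join; apply: filterS => q fg.
by case: b => /=; [apply: dy_near|apply: dx_near].
Qed.

Lemma is_dx_dx f p l : is_dx f p l -> dx f p = l.
Proof. by move=> [_ <-]; rewrite /dx derive1E. Qed.

Lemma is_dy_dy f p l : is_dy f p l -> dy f p = l.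
Proof. by move=> [_ <-]; rewrite /dy derive1E. Qed.

Lemma derivable_is_dx f p : derivable (fun t => f (t, p.2)) p.1 1 -> is_dx f p (dx f p).
Proof. by move=> D; apply: DeriveDef => //; rewrite /dx derive1E. Qed.

Lemma derivable_is_dy f p : derivable (fun t => f (p.1, t)) p.2 1 -> is_dy f p (dy f p).
Proof. by move=> D; apply: DeriveDef => //; rewrite /dy derive1E. Qed.

Lemma near_is_dx f g p l : (\forall q \near p, f q = g q) -> is_dx f p l -> is_dx g p l.
Proof.
move=> /nbhs2P[d d0 fg]; apply: is_derive_near.
apply/nbhs1P; exists d => // y yd; apply: fg => //=.
by rewrite subrr normr0.
Qed.

Lemma near_is_dy f g p l : (\forall q \near p, f q = g q) -> is_dy f p l -> is_dy g p l.
Proof.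
move=> /nbhs2P[d d0 fg]; apply: is_derive_near.
apply/nbhs1P; exists d => // y yd; apply: fg => //=.
by rewrite subrr normr0.
Qed.

Lemma near_continuous2 f g p : (\forall q \near p, f q = g q) ->
  {for p, continuous f} -> {for p, continuous g}.
Proof.
move=> fg cf; rewrite /prop_for /continuous_at -(nbhs_singleton fg).
by apply: cvg_trans cf; apply: near_eq_cvg; apply: filterS fg.
Qed.

Lemma near_smooth_on g (U : set (R * R)) :
  (forall p, U p -> exists h (V : set (R * R)),
     [/\ smooth_on V h, V p & \forall q \near p, g q = h q]) -> smooth_on U g.
Proof.
move=> H k w wk.
have H' p : U p -> exists h (V : set (R * R)),
     [/\ smooth_on V h, V p & \forall q \near p, pdiff w h q = pdiff w g q].
  move=> /H[h [V [sh Vp E]]]; exists h, V; split => //; apply: pdiff_near.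
  by apply: filterS E => q ->.
split=> [p /H'[h [V [sh Vp E]]]|wk' p /H'[h [V [sh Vp E]]]].
  by apply: near_continuous2 E _; have [+ _] := sh k w wk; exact.
have [_ /(_ wk' p Vp)[/derivable_is_dx D1 /derivable_is_dy D2]] := sh k w wk.
by split; [have [] := near_is_dx E D1|have [] := near_is_dy E D2].
Qed.

Lemma smooth_is_dx f (U : set (R * R)) w p : smooth_on U f -> U p ->
  is_dx (pdiff w f) p (pdiff (false :: w) f p).
Proof.
move=> sf Up; apply: derivable_is_dx.
by have [_ /(_ (ltnSn _) p Up)[]] := sf (size w).+1 w (leqnSn _).
Qed.

Lemma smooth_is_dy f (U : set (R * R)) w p : smooth_on U f -> U p ->
  is_dy (pdiff w f) p (pdiff (true :: w) f p).
Proof.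
move=> sf Up; apply: derivable_is_dy.
by have [_ /(_ (ltnSn _) p Up)[]] := sf (size w).+1 w (leqnSn _).
Qed.

Lemma smooth_continuous f (U : set (R * R)) w p : smooth_on U f -> U p ->
  {for p, continuous (pdiff w f)}.
Proof. by move=> sf Up; have [+ _] := sf (size w) w (leqnn _); exact. Qed.

End Plane2.

(** * Derivation rules for functions of one variable *)

Section DeriveRules.
Variable R : realType.
Implicit Types (f g : R -> R) (x l m c : R).

Lemma der_eq f x l m : der1 f x l -> l = m -> is_derive x (1 : R) f m.
Proof. by move=> + <-. Qed.

Lemma derC c x : der1 (fun=> c) x 0.
Proof. exact: is_derive_cst. Qed.

Lemma derI x : der1 (fun t => t) x 1.
Proof. exact: is_derive_id. Qed.

Lemma der_cos x : der1 (fun t => cos t) x (- sin x).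
Proof. exact: is_derive_cos. Qed.

Lemma der_sin x : der1 (fun t => sin t) x (cos x).
Proof. exact: is_derive_sin. Qed.

Lemma derD f g x l m : der1 f x l -> der1 g x m -> der1 (fun t => f t + g t) x (l + m).
Proof. by move=> fl gm; apply: is_deriveD. Qed.

Lemma derN f x l : der1 f x l -> der1 (fun t => - f t) x (- l).
Proof. by move=> fl; apply: is_deriveN. Qed.

Lemma derM f g x l m : der1 f x l -> der1 g x m ->
  der1 (fun t => f t * g t) x (l * g x + f x * m).
Proof.
move=> fl gm; apply: (der_eq (is_deriveM fl gm)).
by rewrite /GRing.scale /= addrC (mulrC (g x)).
Qed.

Lemma derV f x l : f x != 0 -> der1 f x l ->
  der1 (fun t => (f t)^-1) x (- l / f x ^+ 2).
Proof.
move=> fx fl; apply: (der_eq (is_deriveV fx fl)).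
by rewrite /GRing.scale /=; ring.
Qed.

Lemma derX2 f x l : der1 f x l -> der1 (fun t => f t ^+ 2) x (2 * f x * l).
Proof.
move=> fl; rewrite (_ : (fun t => f t ^+ 2) = fun t => f t * f t).
  by apply: (der_eq (derM fl fl)); ring.
by apply/funext => t; rewrite expr2.
Qed.

Lemma der_comp f g x l m : der1 f (g x) l -> der1 g x m ->
  der1 (fun t => f (g t)) x (l * m).
Proof. by move=> fl gm; exact: (is_derive1_comp fl gm). Qed.

End DeriveRules.

(** Produces the derivative as a raw term, which [der_eq] then identifies with the wanted one by
    [ring] or [field]. Hypotheses come first, so that abstract functions are differentiated by
    assumption; [-%R] and [*%R] catch eta-contracted bodies, and [derC] is the last resort. *)
Ltac der := first [eassumption | lazymatch goal with
  | |- der1 (fun t => (_ + _)%R) _ _ => apply derD; der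
  | |- der1 (fun t => (- _)%R) _ _ => apply derN; der
  | |- der1 (fun t => (_ ^+ 2)%R) _ _ => apply derX2; der
  | |- der1 (fun t => (_ * _)%R) _ _ => apply derM; der
  | |- der1 (fun t => (_ ^-1)%R) _ _ => apply derV; [try eassumption|der]
  | |- der1 (fun t => cos t) _ _ => apply der_cos
  | |- der1 (fun t => sin t) _ _ => apply der_sin
  | |- der1 (@cos _) _ _ => apply der_cos
  | |- der1 (@sin _) _ _ => apply der_sin
  | |- der1 (fun t => t) _ _ => apply derI
  | |- der1 -%R _ _ => apply derN; apply derI
  | |- der1 ( *%R _) _ _ => apply derM; [apply derC|apply derI]
  | |- der1 _ _ _ => apply derC
  end].

(** * The Poisson integral *)

Section CircleIntegral.
Variable R : realType.
Implicit Types (f g : R -> R).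

Definition circint f : R := \int[@lebesgue_measure R]_(t in `[0, pi *+ 2]) f t.

Lemma pi2_gt0 : 0 < pi *+ 2 :> R. Proof. by rewrite mulrn_wgt0// pi_gt0. Qed.

Lemma circint_integrable f : continuous f ->
  (@lebesgue_measure R).-integrable `[0, pi *+ 2] (EFin \o f).
Proof.
move=> cf; apply: continuous_compact_integrable; first exact: segment_compact.
exact: continuous_subspaceT.
Qed.

Lemma circintD f g : continuous f -> continuous g ->
  circint (fun t => f t + g t) = circint f + circint g.
Proof.
by move=> cf cg; rewrite /circint RintegralD//; exact: circint_integrable.
Qed.

Lemma circintZ c f : continuous f -> circint (fun t => c * f t) = c * circint f.
Proof.
by move=> cf; rewrite /circint RintegralZl//; exact: circint_integrable.
Qed.

Lemma circint_le f g : continuous f -> continuous g -> 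
    (forall t : R, 0 <= t <= pi *+ 2 -> f t <= g t) -> circint f <= circint g.
Proof.
move=> cf cg fg; apply: le_Rintegral => //; try exact: circint_integrable.
Qed.

Lemma circint_norm f : continuous f -> `|circint f| <= circint (fun t => `|f t|).
Proof. by move=> cf; apply: le_normr_Rintegral => //; exact: circint_integrable. Qed.

Lemma circint_cst c : circint (fun=> c) = c * (pi *+ 2).
Proof.
rewrite /circint Rintegral_cst//= lebesgue_measure_itv/= lte_fin pi2_gt0/=.
by rewrite oppr0 addr0.
Qed.

Lemma circint_FTC f (F : R -> R) : continuous f ->
  (forall t, is_derive t (1 : R) F (f t)) -> circint f = F (pi *+ 2) - F 0.
Proof.
move=> cf FD; rewrite /circint /Rintegral (@continuous_FTC2 _ f F)//=.
- exact: pi2_gt0.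
- exact: continuous_subspaceT.
- split; first by move=> x _; have [] := FD x.
  + by apply: cvg_at_right_filter; exact: (is_derive_cont (FD _)).
  + by apply: cvg_at_left_filter; exact: (is_derive_cont (FD _)).
- by move=> x _; rewrite derive1E; have [] := FD x.
Qed.

(** Differentiation under the integral sign, dominated by the constant [M]. *)
Lemma circint_derive (K K' : R -> R -> R) (a M : R) :
  (\forall s \near a, continuous (K s)) ->
  (\forall s \near a, forall t : R, 0 <= t <= pi *+ 2 ->
     is_derive s (1 : R) (K^~ t) (K' s t) /\ `|K' s t| <= M) ->
  is_derive a (1 : R) (fun s => circint (K s)) (circint (K' a)).
Proof.
move=> /nbhs1P[d d0 cK] /nbhs1P[e e0 K'P].
pose m := Num.min d e; have m0 : 0 < m by rewrite lt_min d0.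
have Ia (s : R) : `]a - m, a + m[%classic s -> `|s - a| < m.
  by rewrite /= in_itv /= => /andP[y1 y2]; rewrite ltr_norml; apply/andP; split; lra.
have aI : `]a - m, a + m[%classic a by rewrite /= in_itv /=; apply/andP; split; lra.
have M0 : 0 <= M.
  have I0 : 0 <= (0 : R) <= pi *+ 2 by rewrite lexx ltW// pi2_gt0.
  have aa : `|a - a| < e by rewrite subrr normr0.
  by have [_] := K'P a aa 0 I0; exact: le_trans.
have D s t : `]a - m, a + m[%classic s -> `[0, pi *+ 2]%classic t ->
    is_derive s (1 : R) (K^~ t) (K' s t) /\ `|K' s t| <= M.
  move=> /Ia; rewrite lt_min => /andP[_ sm]; rewrite /= in_itv/= => tI.
  exact: K'P.
have E s t : `]a - m, a + m[%classic s -> `[0, pi *+ 2]%classic t -> partial1of2 K s t = K' s t.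
  by move=> sI tI; have [[_ <-] _] := D s t sI tI; rewrite partial1of2E.
have HI s : `]a - m, a + m[%classic s ->
    (@lebesgue_measure R).-integrable `[0, pi *+ 2] (EFin \o K s).
  by move=> /Ia; rewrite lt_min => /andP[/cK sK _]; exact: circint_integrable.
have Hd s t : `]a - m, a + m[%classic s -> `[0, pi *+ 2]%classic t -> derivable (K ^~ t) s 1.
  by move=> sI tI; have [[]] := D s t sI tI.
have HM s t : `]a - m, a + m[%classic s -> `[0, pi *+ 2]%classic t -> `|partial1of2 K s t| <= M.
  by move=> sI tI; rewrite E//; have [] := D s t sI tI.
have iM : (@lebesgue_measure R).-integrable `[0, pi *+ 2] (EFin \o (cst M : R -> R)).
  by apply: circint_integrable; exact: cst_continuous.
apply: DeriveDef.
  by apply: (derivable_under_integral _ aI HI Hd _ iM HM).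
rewrite -derive1E (differentiation_under_integral _ aI HI Hd _ iM HM)//.
by apply: eq_Rintegral => t; rewrite inE; exact: E.
Qed.

End CircleIntegral.

(** * Inverse powers of a complex number in real coordinates *)

Section InversePowers.
Variable R : realType.
Implicit Types (X Y : R).

(* Real and imaginary parts of [(X + i Y)^-n]. *)
Fixpoint invpow (n : nat) X Y : R * R :=
  if n is m.+1 then
    let a := X / (X ^+ 2 + Y ^+ 2) in let b := - Y / (X ^+ 2 + Y ^+ 2) in
    let u := invpow m X Y in (u.1 * a - u.2 * b, u.1 * b + u.2 * a)
  else (1, 0).

Lemma invpow_norm n X Y :
  (invpow n X Y).1 ^+ 2 + (invpow n X Y).2 ^+ 2 = ((X ^+ 2 + Y ^+ 2)^-1) ^+ n.
Proof.
elim: n => [|n IH]; first by rewrite /= expr0; ring.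
rewrite [RHS]exprSr -IH /=.
have [D0|D0] := eqVneq (X ^+ 2 + Y ^+ 2) 0; first by rewrite D0 invr0; ring.
by field.
Qed.

(** The modulus is at most [d] to the power [- n / 2]; using |x| <= 1 + x^2 instead keeps square
    roots out of the bound. *)
Lemma invpow_le n X Y (d : R) : 0 < d -> d <= X ^+ 2 + Y ^+ 2 ->
  `|(invpow n X Y).1| <= 1 + d^-1 ^+ n /\ `|(invpow n X Y).2| <= 1 + d^-1 ^+ n.
Proof.
move=> d0 dD.
have H : ((X ^+ 2 + Y ^+ 2)^-1) ^+ n <= d^-1 ^+ n.
  have D0 := lt_le_trans d0 dD.
  by rewrite lerXn2r// ?nnegrE ?invr_ge0 ?(ltW d0) ?(ltW D0)// lef_pV2// posrE.
rewrite -invpow_norm in H; move: H; set a := (invpow n X Y).1; set b := (invpow n X Y).2.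
move: (d^-1 ^+ n) => e H.
have Na (x : R) : `|x| <= 1 + x ^+ 2.
  by rewrite -real_normK ?num_real//; have := normr_ge0 x; nra.
by split; [apply: (le_trans (Na a))|apply: (le_trans (Na b))]; nra.
Qed.

(** The rule (Z^-n)' = -n Z^-(n+1) Z', split into real and imaginary parts. *)
Lemma invpow_derive n (X Y : R -> R) (s X' Y' : R) : X s ^+ 2 + Y s ^+ 2 != 0 ->
  is_derive s (1 : R) X X' -> is_derive s (1 : R) Y Y' ->
  let u := invpow n.+1 (X s) (Y s) in
  is_derive s (1 : R) (fun s => (invpow n (X s) (Y s)).1) (- n%:R * (u.1 * X' - u.2 * Y')) /\
  is_derive s (1 : R) (fun s => (invpow n (X s) (Y s)).2) (- n%:R * (u.1 * Y' + u.2 * X')).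
Proof.
move=> D0 dX dY; elim: n => [|n [IH1 IH2]] /=.
  by rewrite mulr0n oppr0 !mul0r; split; exact: is_derive_cst.
split; (eapply der_eq; [by der|]); move: D0; rewrite /=;
  move: (invpow n (X s) (Y s)) => [u1 u2] /= D0; rewrite -natr1; field; exact: D0.
Qed.

End InversePowers.

(** * Smoothness by closure under differentiation *)

Section SmoothClass.
Variable R : realType.
Implicit Types (f g : R * R -> R) (U : set (R * R)).

(** By induction on the word, each iterated partial derivative agrees on [U] with a member of [C].
    Smoothness is thus checked once on a family closed under both derivations, such as integrals of
    inverse powers. *)
Lemma smooth_class U (C : (R * R -> R) -> Prop) : open U ->
  (forall f, C f -> forall p, U p -> {for p, continuous f}) ->
  (forall f, C f -> exists fx fy, [/\ C fx, C fy &
     forall p, U p -> is_dx f p (fx p) /\ is_dy f p (fy p)]) ->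
  forall f, C f -> smooth_on U f.
Proof.
move=> oU Cc CD f Cf k w _.
have [g Cg fg] : exists2 g, C g & forall p, U p -> pdiff w f p = g p.
  elim: w => [|b w [g Cg IH]]; first by exists f.
  have [gx [gy [Cx Cy gD]]] := CD g Cg.
  exists (if b then gy else gx); first by case: b.
  move=> p Up; have nU : \forall q \near p, pdiff w f q = g q.
    by apply: filterS (open_nbhs_nbhs (conj oU Up)) => q; exact: IH.
  have [/is_dx_dx dx1 /is_dy_dy dy1] := gD p Up.
  by case: b => /=; [rewrite -dy1; exact: dy_near|rewrite -dx1; exact: dx_near].
have nU p : U p -> \forall q \near p, g q = pdiff w f q.
  move=> Up; apply: filterS (open_nbhs_nbhs (conj oU Up)) => q Uq.
  by rewrite fg.
split=> [p Up|_ p Up].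
  exact: near_continuous2 (nU p Up) (Cc g Cg p Up).
have [gx [gy [_ _ /(_ p Up)[gD1 gD2]]]] := CD g Cg.
by split; [have [] := near_is_dx (nU p Up) gD1|have [] := near_is_dy (nU p Up) gD2].
Qed.

Lemma smooth_clairaut U f p : open U -> smooth_on U f -> U p ->
  dx (dy f) p = dy (dx f) p.
Proof.
move=> oU sf Up.
have nU : nbhs p U by exact: open_nbhs_nbhs.
apply: (@clairaut _ f (dx f) (dy f) (dx (dy f)) (dy (dx f))).
- by apply: filterS nU => q; exact: (@smooth_is_dx _ f U [::]).
- by apply: filterS nU => q; exact: (@smooth_is_dy _ f U [::]).
- by apply: filterS nU => q; exact: (@smooth_is_dy _ f U [:: false]).
- by apply: filterS nU => q; exact: (@smooth_is_dx _ f U [:: true]).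
- exact: (@smooth_continuous _ f U [:: false; true]).
- exact: (@smooth_continuous _ f U [:: true; false]).
Qed.

Lemma smooth_dx U f : smooth_on U f -> smooth_on U (dx f).
Proof.
move=> sf k w wk.
have := sf k.+1 (rcons w false); rewrite size_rcons ltnS => /(_ wk).
by rewrite /pdiff -cats1 foldr_cat.
Qed.

Lemma smooth_dy U f : smooth_on U f -> smooth_on U (dy f).
Proof.
move=> sf k w wk.
have := sf k.+1 (rcons w true); rewrite size_rcons ltnS => /(_ wk).
by rewrite /pdiff -cats1 foldr_cat.
Qed.

(** The Laplacian commutes with [dx]. It is needed because [1 / rho] is reached as the u-derivative
    of a Poisson integral, up to explicit terms. *)
Lemma smooth_harmonic_dx U f : open U -> smooth_on U f ->
  (forall p, U p -> dx (dx f) p + dy (dy f) p = 0) ->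
  forall p, U p -> dx (dx (dx f)) p + dy (dy (dx f)) p = 0.
Proof.
move=> oU sf hf p Up.
have nU : nbhs p U by exact: open_nbhs_nbhs.
have -> : dy (dy (dx f)) p = dy (dx (dy f)) p.
  by apply: dy_near; apply: filterS nU => q Uq; rewrite (smooth_clairaut oU sf).
rewrite -(smooth_clairaut oU (smooth_dy sf))//.
have D : is_dx (fun q => dx (dx f) q + dy (dy f) q) p
    (dx (dx (dx f)) p + dx (dy (dy f)) p).
  by apply: derD; [exact: (@smooth_is_dx _ f U [:: false; false])|
    exact: (@smooth_is_dx _ f U [:: true; true])].
rewrite -(is_dx_dx D) (@dx_near _ _ (fun=> 0)); last first.
  by apply: filterS nU => q; exact: hf.
by rewrite /dx derive1_cst.
Qed.

End SmoothClass.

(** * The Poisson integral on a disc *)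

Section PoissonKernel.
Variable R : realType.
Variables (c : R * R) (r : R).
Hypothesis r0 : 0 < r.

Definition disc : set (R * R) :=
  [set z | (z.1 - c.1) ^+ 2 + (z.2 - c.2) ^+ 2 < r ^+ 2].

(** [X + i Y] is [z] minus the point of the circle at angle [t]. *)
Let X (z : R * R) t := z.1 - c.1 - r * cos t.
Let Y (z : R * R) t := z.2 - c.2 - r * sin t.

Lemma continuous_sqdist (e : R * R) p :
  {for p, continuous (fun z => (z.1 - e.1) ^+ 2 + (z.2 - e.2) ^+ 2)}.
Proof.
rewrite (_ : (fun z => _) = fun z => (z.1 - e.1) * (z.1 - e.1) + (z.2 - e.2) * (z.2 - e.2)); last first.
  by apply/funext => z; rewrite !expr2.
have c1 : {for p, continuous (fun z : R * R => z.1 - e.1)}.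
  by apply: continuousB; [exact: cvg_fst|exact: cst_continuous].
have c2 : {for p, continuous (fun z : R * R => z.2 - e.2)}.
  by apply: continuousB; [exact: cvg_snd|exact: cst_continuous].
by apply: continuousD; apply: continuousM.
Qed.

Lemma open_disc : open disc.
Proof.
rewrite (_ : disc = (fun z => (z.1 - c.1) ^+ 2 + (z.2 - c.2) ^+ 2) @^-1` [set x | x < r ^+ 2])//.
apply: open_comp; last exact: open_lt.
by move=> p _; exact: continuous_sqdist.
Qed.

(** The reverse triangle inequality: a point within [s] of the centre is at distance at least
    [r - s] from the circle. Here [m] is the component of [z - c] in the direction [t], bounded by
    Lagrange's identity. *)
Lemma kernel_denom_lb z s t : 0 <= s -> s < r ->
  (z.1 - c.1) ^+ 2 + (z.2 - c.2) ^+ 2 <= s ^+ 2 ->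
  (r - s) ^+ 2 <= X z t ^+ 2 + Y z t ^+ 2.
Proof.
rewrite /X /Y; set a := z.1 - c.1; set b := z.2 - c.2 => s0 sr H.
pose m := a * cos t + b * sin t.
have cs := cos2Dsin2 t.
have ms : m <= s.
  rewrite leNgt; apply/negP => sm.
  have : s ^+ 2 < m ^+ 2 by rewrite ltr_pXn2r// nnegrE// (le_trans s0)// ltW.
  have -> : m ^+ 2 = (a ^+ 2 + b ^+ 2) * (cos t ^+ 2 + sin t ^+ 2) - (a * sin t - b * cos t) ^+ 2.
    by rewrite /m; ring.
  rewrite cs; have := sqr_ge0 (a * sin t - b * cos t); lra.
have q0 : 0 <= a ^+ 2 + b ^+ 2 by rewrite addr_ge0// sqr_ge0.
have mq : m ^+ 2 <= a ^+ 2 + b ^+ 2.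
  have -> : m ^+ 2 = (a ^+ 2 + b ^+ 2) * (cos t ^+ 2 + sin t ^+ 2) - (a * sin t - b * cos t) ^+ 2.
    by rewrite /m; ring.
  rewrite cs; have := sqr_ge0 (a * sin t - b * cos t); lra.
have -> : (a - r * cos t) ^+ 2 + (b - r * sin t) ^+ 2 =
   (a ^+ 2 + b ^+ 2) - 2 * r * m + r ^+ 2 * (cos t ^+ 2 + sin t ^+ 2) by rewrite /m; ring.
rewrite cs mulr1.
have rho := sqr_sqrtr q0; have rho0 := sqrtr_ge0 (a ^+ 2 + b ^+ 2).
move: rho rho0; set rho := Num.sqrt _ => rE rho0.
have rs : rho <= s.
  by rewrite -(@ler_pXn2r _ 2)// ?nnegrE// rE.
have mr : m <= rho.
  have [m0|m0] := leP m 0; first exact: le_trans rho0.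
  by rewrite -(@ler_pXn2r _ 2)// ?nnegrE ?(ltW m0)// rE.
rewrite -rE; nra.
Qed.

Lemma kernel_denom_near z : disc z -> exists2 d : R, 0 < d &
  \forall q \near z, disc q /\ forall t, d <= X q t ^+ 2 + Y q t ^+ 2.
Proof.
move=> zc.
have q0 : 0 <= (z.1 - c.1) ^+ 2 + (z.2 - c.2) ^+ 2 by rewrite addr_ge0// sqr_ge0.
have rho := sqr_sqrtr q0; have rho0 := sqrtr_ge0 ((z.1 - c.1) ^+ 2 + (z.2 - c.2) ^+ 2).
move: rho rho0; set rho := Num.sqrt _ => rE rho0.
have rr : rho < r.
  by rewrite -(@ltr_pXn2r _ 2)// ?nnegrE ?(ltW r0)// rE.
pose s := (rho + r) / 2.
have sr : s < r by rewrite /s; lra.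
exists ((r - s) ^+ 2); first by rewrite exprn_gt0// subr_gt0.
have nz : \forall q \near z, (q.1 - c.1) ^+ 2 + (q.2 - c.2) ^+ 2 < s ^+ 2.
  apply: (@continuous_sqdist c z [set x | x < s ^+ 2]).
  apply: open_nbhs_nbhs; split; first exact: open_lt.
  by rewrite /= -rE; rewrite ltr_pXn2r// ?nnegrE; rewrite /s; lra.
apply: filterS nz => q qs; split; last first.
  move=> t; apply: kernel_denom_lb => //; last exact: ltW.
  rewrite /s; lra.
by apply: (lt_trans qs); rewrite ltr_pXn2r// ?nnegrE; rewrite ?/s; lra.
Qed.

(** The integral of the real part of (al - i be) (X + i Y)^-n. The family is closed under
    differentiation: d/dx multiplies the density al - i be by -n, d/dy multiplies it by -n i, and
    both raise the exponent by one. *)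
Definition cint n (al be : R -> R) (z : R * R) : R :=
  circint (fun t => al t * (invpow n (X z t) (Y z t)).1 + be t * (invpow n (X z t) (Y z t)).2).

Let dX z t : is_derive t (1 : R) (X z) (r * sin t).
Proof. by eapply der_eq; [rewrite /X; der|rewrite /=; ring]. Qed.

Let dY z t : is_derive t (1 : R) (Y z) (- r * cos t).
Proof. by eapply der_eq; [rewrite /Y; der|rewrite /=; ring]. Qed.

Lemma disc_denom z t : disc z -> X z t ^+ 2 + Y z t ^+ 2 != 0.
Proof.
move=> /kernel_denom_near[d d0 /nbhs_singleton[_ /(_ t) H]].
by rewrite gt_eqF// (lt_le_trans d0).
Qed.

Lemma invpow_continuous n z : disc z ->
  continuous (fun t => (invpow n (X z t) (Y z t)).1) /\
  continuous (fun t => (invpow n (X z t) (Y z t)).2).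
Proof.
move=> zd; split=> t; have [D1 D2] := invpow_derive n (disc_denom t zd) (dX z t) (dY z t).
- exact: is_derive_cont D1.
- exact: is_derive_cont D2.
Qed.

Lemma cint_integrand_continuous n (al be : R -> R) z : continuous al -> continuous be -> disc z ->
  continuous (fun t => al t * (invpow n (X z t) (Y z t)).1 + be t * (invpow n (X z t) (Y z t)).2).
Proof.
move=> ca cb /(invpow_continuous n)[c1 c2] t.
by apply: cvgD; apply: cvgM; [exact: ca|exact: c1|exact: cb|exact: c2].
Qed.

Lemma bounded_on_circle (al : R -> R) : continuous al -> exists2 M : R, 0 <= M &
  forall t : R, 0 <= t <= pi *+ 2 -> `|al t| <= M.
Proof.
move=> ca.
have ne : (`[0, pi *+ 2]%classic : set R) !=set0.
  by exists 0; rewrite /= in_itv/= lexx/= ltW// pi2_gt0.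
have cn : {within `[0, pi *+ 2], continuous (fun t => `|al t|)}.
  by apply: continuous_subspaceT => t; apply: cvg_norm; exact: ca.
have [t0 _ H] := compact_EVT_max ne (@segment_compact _ _ _) cn.
by exists `|al t0| => // t tI; apply: H; rewrite inE/= in_itv.
Qed.

Lemma cint_derive n (al be : R -> R) z : continuous al -> continuous be -> disc z ->
  is_dx (cint n al be) z (cint n.+1 (fun t => - n%:R * al t) (fun t => - n%:R * be t) z) /\
  is_dy (cint n al be) z (cint n.+1 (fun t => - n%:R * be t) (fun t => n%:R * al t) z).
Proof.
move=> ca cb zd.
have [M M0 MP] := bounded_on_circle ca.
have [N N0 NP] := bounded_on_circle cb.
have [d d0 /nbhs2P[e e0 eP]] := kernel_denom_near zd.
pose B := n%:R * (M + N) * (1 + d^-1 ^+ n.+1).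
split.
- apply: (@circint_derive R (fun s t => al t * (invpow n (X (s, z.2) t) (Y (s, z.2) t)).1
    + be t * (invpow n (X (s, z.2) t) (Y (s, z.2) t)).2)
   (fun s t => - n%:R * al t * (invpow n.+1 (X (s, z.2) t) (Y (s, z.2) t)).1
    + - n%:R * be t * (invpow n.+1 (X (s, z.2) t) (Y (s, z.2) t)).2) z.1 B).
    apply/nbhs1P; exists e => // s se.
    have n0 : `|(s, z.2).2 - z.2| < e by rewrite subrr normr0.
    have [sd _] := eP (s, z.2) se n0.
    exact: cint_integrand_continuous.
  apply/nbhs1P; exists e => // s se t tI.
  have n0 : `|(s, z.2).2 - z.2| < e by rewrite subrr normr0.
  have [sd dle] := eP (s, z.2) se n0; split.
    have D1 : is_derive s (1 : R) (fun s => X (s, z.2) t) 1.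
      by eapply der_eq; [rewrite /X/=; der|rewrite /=; ring].
    have D2 : is_derive s (1 : R) (fun s => Y (s, z.2) t) 0.
      by eapply der_eq; [rewrite /Y/=; der|rewrite /=; ring].
    have [D3 D4] := @invpow_derive R n (fun s => X (s, z.2) t) (fun s => Y (s, z.2) t)
      s 1 0 (disc_denom t sd) D1 D2.
    by eapply der_eq; [der|rewrite /=; ring].
  have [b1 b2] := invpow_le n.+1 d0 (dle t).
  have := MP t tI; have := NP t tI => aN aM.
  apply: (le_trans (ler_normD _ _)); rewrite !normrM normrN normr_nat /B.
  rewrite -!mulrA -mulrDr ler_wpM2l// mulrDl lerD// ler_pM//.
- apply: (@circint_derive R (fun s t => al t * (invpow n (X (z.1, s) t) (Y (z.1, s) t)).1
    + be t * (invpow n (X (z.1, s) t) (Y (z.1, s) t)).2)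
   (fun s t => - n%:R * be t * (invpow n.+1 (X (z.1, s) t) (Y (z.1, s) t)).1
    + n%:R * al t * (invpow n.+1 (X (z.1, s) t) (Y (z.1, s) t)).2) z.2 B).
    apply/nbhs1P; exists e => // s se.
    have n0 : `|(z.1, s).1 - z.1| < e by rewrite subrr normr0.
    have [sd _] := eP (z.1, s) n0 se.
    exact: cint_integrand_continuous.
  apply/nbhs1P; exists e => // s se t tI.
  have n0 : `|(z.1, s).1 - z.1| < e by rewrite subrr normr0.
  have [sd dle] := eP (z.1, s) n0 se; split.
    have D1 : is_derive s (1 : R) (fun s => X (z.1, s) t) 0.
      by eapply der_eq; [rewrite /X/=; der|rewrite /=; ring].
    have D2 : is_derive s (1 : R) (fun s => Y (z.1, s) t) 1.
      by eapply der_eq; [rewrite /Y/=; der|rewrite /=; ring].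
    have [D3 D4] := @invpow_derive R n (fun s => X (z.1, s) t) (fun s => Y (z.1, s) t)
      s 0 1 (disc_denom t sd) D1 D2.
    by eapply der_eq; [der|rewrite /=; ring].
  have [b1 b2] := invpow_le n.+1 d0 (dle t).
  have := MP t tI; have := NP t tI => aN aM.
  apply: (le_trans (ler_normD _ _)); rewrite !normrM normrN normr_nat /B.
  rewrite -!mulrA -mulrDr ler_wpM2l// mulrDl addrC lerD// ler_pM//.
Qed.

(** The partial derivatives are again of the form [cint], with bounds uniform near [z], so
    [bounded_partials_continuous] applies. *)
Lemma cint_continuous n (al be : R -> R) z : continuous al -> continuous be -> disc z ->
  {for z, continuous (cint n al be)}.
Proof.
move=> ca cb zd.
have [M M0 MP] := bounded_on_circle ca.
have [N N0 NP] := bounded_on_circle cb.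
have [d d0 dP] := kernel_denom_near zd.
pose B := n%:R * (M + N) * (1 + d^-1 ^+ n.+1) * pi *+ 2.
pose nal t := - n%:R * al t; pose nbe t := - n%:R * be t; pose pal t := n%:R * al t.
have cna : continuous nal by move=> t; apply: cvgM; [exact: cvg_cst|exact: ca].
have cpa : continuous pal by move=> t; apply: cvgM; [exact: cvg_cst|exact: ca].
have cnb : continuous nbe by move=> t; apply: cvgM; [exact: cvg_cst|exact: cb].
have bound (f g : R -> R) q : continuous f -> continuous g -> disc q ->
    (forall t, d <= X q t ^+ 2 + Y q t ^+ 2) ->
    (forall t : R, 0 <= t <= pi *+ 2 -> `|f t| + `|g t| <= n%:R * (M + N)) ->
    `|cint n.+1 f g q| <= B.
  move=> cf cg qd dle fg.
  have cI := @cint_integrand_continuous n.+1 f g q cf cg qd.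
  apply: (le_trans (circint_norm cI)).
  have -> : B = circint (fun=> n%:R * (M + N) * (1 + d^-1 ^+ n.+1)).
    by rewrite circint_cst /B -mulrnAr.
  apply: circint_le.
  - by move=> t; apply: cvg_norm; exact: cI.
  - exact: cst_continuous.
  move=> t tI; have [b1 b2] := invpow_le n.+1 d0 (dle t).
  apply: (le_trans (ler_normD _ _)); rewrite !normrM.
  apply: (@le_trans _ _ ((`|f t| + `|g t|) * (1 + d^-1 ^+ n.+1))).
    by rewrite mulrDl lerD// ler_wpM2l.
  rewrite ler_wpM2r ?fg// addr_ge0// exprn_ge0// invr_ge0 ltW//.
have MN t : 0 <= t <= pi *+ 2 -> `|nal t| + `|nbe t| <= n%:R * (M + N) /\
    `|nbe t| + `|pal t| <= n%:R * (M + N).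
  move=> tI; have := MP t tI; have := NP t tI => aN aM.
  rewrite /nal /nbe /pal !normrM normrN normr_nat -!mulrDr.
  by split; rewrite ler_wpM2l//; [|rewrite addrC]; apply: lerD.
apply: (@bounded_partials_continuous _ _ (cint n.+1 nal nbe) (cint n.+1 nbe pal) _ B).
apply: filterS dP => q [qd dle].
have [D1 D2] := @cint_derive n al be q ca cb qd.
split=> //; apply: bound => // t /MN[] //.
Qed.


Variable F : R * R -> R.

Let circ t : R * R := (c.1 + r * cos t, c.2 + r * sin t).

Hypothesis cF : forall t, {for circ t, continuous F}.

Let circP (f : R * R -> R) : (forall t, {for circ t, continuous f}) ->
  continuous (fun t => f (circ t)).
Proof.
move=> cf t; apply: (@continuous_comp _ _ _ circ f); last exact: cf.
have c1 : {for t, continuous (fun t => c.1 + r * cos t)}.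
  by apply: cvgD; [exact: cvg_cst|apply: cvgM; [exact: cvg_cst|exact: continuous_cos]].
have c2 : {for t, continuous (fun t => c.2 + r * sin t)}.
  by apply: cvgD; [exact: cvg_cst|apply: cvgM; [exact: cvg_cst|exact: continuous_sin]].
exact: (cvg_pair c1 c2).
Qed.

Let twopi := pi *+ 2 : R.
Let twopi0 : twopi != 0. Proof. by rewrite gt_eqF// pi2_gt0. Qed.

(** With q the point of the circle at angle t, the Poisson kernel (r^2 - |z - c|^2) / |z - q|^2
    equals -1 - 2 Re ((q - c) / (z - q)). In this form the integral is a constant plus a [cint],
    which can be differentiated at will; [poissonE] returns to the nonnegative kernel [K] for
    estimates. *)
Definition poisson (G : R * R -> R) (z : R * R) : R :=
  twopi^-1 * (circint (fun t => - G (circ t)) +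
    cint 1 (fun t => - 2 * r * cos t * G (circ t)) (fun t => 2 * r * sin t * G (circ t)) z).

Let K z t : R := (r ^+ 2 - (z.1 - c.1) ^+ 2 - (z.2 - c.2) ^+ 2) / (X z t ^+ 2 + Y z t ^+ 2).

Let KE z t : disc z -> K z t =
  - 1 - 2 * r * cos t * (invpow 1 (X z t) (Y z t)).1 + 2 * r * sin t * (invpow 1 (X z t) (Y z t)).2.
Proof.
move=> /(disc_denom t) D0; rewrite /K /=.
have cs := cos2Dsin2 t.
have -> : r ^+ 2 - (z.1 - c.1) ^+ 2 - (z.2 - c.2) ^+ 2 =
   - (X z t ^+ 2 + Y z t ^+ 2) - 2 * r * (X z t * cos t + Y z t * sin t)
   + r ^+ 2 * (1 - (cos t ^+ 2 + sin t ^+ 2)) by rewrite /X /Y; ring.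
by rewrite cs subrr mulr0 addr0; field.
Qed.

Let Kc z : disc z -> continuous (K z).
Proof.
move=> zd t; apply: cvgM; first exact: cvg_cst.
apply: (@is_derive_cont _ (fun t => (X z t ^+ 2 + Y z t ^+ 2)^-1)).
have dXt := dX z t; have dYt := dY z t.
by eapply der_eq; [apply derV; [exact: disc_denom|der]|reflexivity].
Qed.

Let K_ge0 z t : disc z -> 0 <= K z t.
Proof.
rewrite /disc /= => zd; apply: divr_ge0; last by rewrite addr_ge0 ?sqr_ge0.
by rewrite -addrA -opprD subr_ge0 ltW.
Qed.

Lemma poissonE G z : disc z -> (forall t, {for circ t, continuous G}) ->
  poisson G z = twopi^-1 * circint (fun t => K z t * G (circ t)).
Proof.
move=> zd /circP cG; congr (_ * _); rewrite /cint -circintD.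
- congr circint; apply/funext => t; rewrite KE//; ring.
- by move=> t; apply: cvgN; exact: cG.
- apply: cint_integrand_continuous => // t; apply: cvgM; try exact: cG;
    by apply: cvgM; [exact: cvg_cst|exact: continuous_cos || exact: continuous_sin].
Qed.

(* Both partial derivatives of the integrand are total derivatives in the angle. *)
Lemma poisson_kernel_int z : disc z -> circint (K z) = twopi.
Proof.
pose al t : R := - 2 * r * cos t; pose be t : R := 2 * r * sin t.
have cal : continuous al by move=> t; apply: cvgM; [exact: cvg_cst|exact: continuous_cos].
have cbe : continuous be by move=> t; apply: cvgM; [exact: cvg_cst|exact: continuous_sin].
have KW q : disc q -> circint (K q) = - twopi + cint 1 al be q.
  move=> qd; have -> : - twopi = circint (fun=> - 1) by rewrite circint_cst mulN1r.
  rewrite /cint -circintD.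
  - by congr circint; apply/funext => t; rewrite KE// /al /be; ring.
  - exact: cst_continuous.
  - exact: cint_integrand_continuous.
have int0 (f g : R -> R) : continuous f -> (forall t, der1 g t (f t)) ->
    g (pi *+ 2) = g 0 -> circint f = 0.
  by move=> cf fg g0; rewrite (circint_FTC cf fg) g0 subrr.
have per q : X q (pi *+ 2) = X q 0 /\ Y q (pi *+ 2) = Y q 0.
  by rewrite /X /Y cos2pi sin2pi cos0 sin0.
have W' q : disc q -> is_dx (cint 1 al be) q 0 /\ is_dy (cint 1 al be) q 0.
  move=> qd; have [D1 D2] := @cint_derive 1 al be q cal cbe qd.
  have [P1 P2] := per q.
  have cN1 (f : R -> R) (k : R) : continuous f -> continuous (fun t => k * f t).
    by move=> cf t; apply: cvgM; [exact: cvg_cst|exact: cf].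
  split; [apply: (der_eq D1)|apply: (der_eq D2)].
  - apply: (int0 _ (fun t => 2 * (invpow 1 (X q t) (Y q t)).2)).
    + by apply: cint_integrand_continuous => //; exact: cN1.
    + move=> t; have [_ D] := invpow_derive 1 (disc_denom t qd) (dX q t) (dY q t).
      eapply der_eq; first by apply derM; [exact: derC|exact: D].
      by rewrite /al /be /=; ring.
    + by rewrite P1 P2.
  - apply: (int0 _ (fun t => 2 * (invpow 1 (X q t) (Y q t)).1)).
    + by apply: cint_integrand_continuous => //; exact: cN1.
    + move=> t; have [D _] := invpow_derive 1 (disc_denom t qd) (dX q t) (dY q t).
      eapply der_eq; first by apply derM; [exact: derC|exact: D].
      by rewrite /al /be /=; ring.
    + by rewrite P1 P2.
move=> zd.
have cd : disc c by rewrite /disc /= !subrr expr0n addr0 exprn_gt0.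
have sqle (a b : R) : `|a| <= `|b| -> a ^+ 2 <= b ^+ 2.
  by move=> ab; rewrite -(real_normK (num_real a)) -(real_normK (num_real b)) lerXn2r ?nnegrE.
have zcd : disc (z.1, c.2).
  rewrite /disc /= subrr expr0n addr0; apply: le_lt_trans zd.
  by rewrite lerDl sqr_ge0.
(* The integral is compared with its value at the centre, where the kernel is constantly 1, along a
   horizontal and then a vertical segment inside the disc. *)
have [t tz|x _ E1] := @mvt_dist R (fun t => cint 1 al be (t, c.2)) (fun=> 0) c.1 z.1.
  have td : disc (t, c.2).
    apply: le_lt_trans zcd => /=; rewrite lerD2r; exact: sqle.
  by have [] := W' _ td.
have [t tz|y _ E2] := @mvt_dist R (fun t => cint 1 al be (z.1, t)) (fun=> 0) c.2 z.2.
  have td : disc (z.1, t).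
    apply: le_lt_trans zd => /=; rewrite lerD2l; exact: sqle.
  by have [] := W' _ td.
have Kc1 : circint (K c) = twopi.
  have -> : K c = fun=> 1.
    apply/funext => t; rewrite /K /X /Y !subrr !expr0n !subr0 !sub0r !sqrrN !exprMn.
    rewrite -mulrDr cos2Dsin2 mulr1 divff// expf_neq0// gt_eqF//.
  by rewrite circint_cst mul1r.
rewrite -Kc1 !KW//; congr (_ + _).
move: E1 E2; rewrite !mul0r => /eqP; rewrite subr_eq0 => /eqP E1 /eqP.
rewrite subr_eq0 => /eqP; rewrite -surjective_pairing => ->.
by rewrite E1 -surjective_pairing.
Qed.

(** The kernel is nonnegative and integrates to 2 pi, so the Poisson integral is a weighted mean of
    boundary values. *)
Lemma poisson_bounded : exists M : R, forall z, disc z -> `|poisson F z| <= M.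
Proof.
have [M M0 MP] := bounded_on_circle (circP cF).
exists M => z zd.
have tp0 : 0 < twopi^-1 by rewrite invr_gt0 pi2_gt0.
have cK : continuous (fun t => K z t * F (circ t)).
  by move=> t; apply: cvgM; [exact: Kc|exact: circP].
rewrite poissonE// normrM gtr0_norm// mulrC ler_pdivrMr ?pi2_gt0//.
apply: (le_trans (circint_norm cK)).
rewrite -(poisson_kernel_int zd) -circintZ; last exact: Kc.
apply: circint_le.
- by move=> t; apply: cvg_norm; exact: cK.
- by move=> t; apply: cvgM; [exact: cvg_cst|exact: Kc].
move=> t /MP Ft; have K0 := K_ge0 t zd.
by rewrite normrM (ger0_norm K0) mulrC ler_wpM2r.
Qed.

(** Instead of splitting the circle into a near and a far arc, the oscillation of [F] is bounded by
    e / 4 plus a multiple of the squared distance to [z0]. The kernel integrates a squared distance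
    well, since [K] times |z - q|^2 is r^2 - |z - c|^2, which tends to 0 at the circle. *)
Lemma poisson_boundary z0 (e : R) : {for z0, continuous F} ->
  (z0.1 - c.1) ^+ 2 + (z0.2 - c.2) ^+ 2 = r ^+ 2 -> 0 < e ->
  \forall z \near z0, disc z -> `|poisson F z - F z0| < e.
Proof.
move=> cz0 z0c e0.
have [M M0 MP] := bounded_on_circle (circP cF).
have e20 : 0 < e / 4 by lra.
move/continuous2P : cz0 => /(_ _ e20)[d d0 dP].
(* Chosen so that [N * d ^+ 2] is the trivial bound for |F - F z0| on the circle, which settles the
   points at distance at least [d]. *)
pose N := (M + `|F z0|) / d ^+ 2.
have N0 : 0 <= N by rewrite divr_ge0// ?addr_ge0// sqr_ge0.
pose sq (q p : R * R) := (q.1 - p.1) ^+ 2 + (q.2 - p.2) ^+ 2.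
have FN t : 0 <= t <= pi *+ 2 -> `|F (circ t) - F z0| <= e / 4 + N * sq (circ t) z0.
  move=> tI; have sq0 : 0 <= sq (circ t) z0 by rewrite addr_ge0// sqr_ge0.
  have Nsq : 0 <= N * sq (circ t) z0 by rewrite mulr_ge0.
  have far : d ^+ 2 <= sq (circ t) z0 -> `|F (circ t) - F z0| <= e / 4 + N * sq (circ t) z0.
    move=> dsq; apply: (@le_trans _ _ (M + `|F z0|)).
      by apply: (le_trans (ler_normB _ _)); rewrite lerD2r MP.
    rewrite -[leLHS]add0r lerD ?(ltW e20)// /N mulrAC ler_pdivlMr ?exprn_gt0//.
    by rewrite ler_wpM2l// addr_ge0.
  have sqd (a : R) : d <= `|a| -> d ^+ 2 <= a ^+ 2.
    by move=> da; rewrite -(real_normK (num_real a)) lerXn2r ?nnegrE// ltW.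
  have [d1|d1] := ltP `|(circ t).1 - z0.1| d; last first.
    by apply: far; rewrite -[leLHS]addr0 lerD ?sqr_ge0//; exact: sqd.
  have [d2|d2] := ltP `|(circ t).2 - z0.2| d; last first.
    by apply: far; rewrite -[leLHS]add0r lerD ?sqr_ge0//; exact: sqd.
  by apply: (le_trans (ltW (dP _ d1 d2))); rewrite lerDl.
pose h z := sq z z0 + (r ^+ 2 - sq z c).
have ch : {for z0, continuous h}.
  apply: cvgD; first exact: continuous_sqdist.
  by apply: cvgB; [exact: cvg_cst|exact: continuous_sqdist].
have hz0 : h z0 = 0 by rewrite /h {1}/sq !subrr expr0n /= addr0 add0r /sq z0c subrr.
have e'0 : 0 < e / 4 / (2 * N + 1) by rewrite divr_gt0//; lra.
move/continuous2P : ch => /(_ _ e'0)[d' d'0 d'P].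
apply/nbhs2P; exists d' => // z z1 z2 zd.
have := d'P z z1 z2; rewrite hz0 subr0 => hz.
have hN : 2 * N * h z < e / 4.
  rewrite ltr_pdivlMr in hz; last lra.
  have := ler_norm (h z); have : 0 <= h z.
    by apply: addr_ge0; [rewrite addr_ge0 ?sqr_ge0|rewrite subr_ge0 ltW].
  nra.
have tp0 : 0 < twopi^-1 by rewrite invr_gt0 pi2_gt0.
have cG : continuous (fun t => F (circ t) - F z0).
  by move=> t; apply: cvgB; [exact: circP|exact: cvg_cst].
have cKG : continuous (fun t => K z t * (F (circ t) - F z0)).
  by move=> t; apply: cvgM; [exact: Kc|exact: cG].
have -> : poisson F z - F z0 = twopi^-1 * circint (fun t => K z t * (F (circ t) - F z0)).
  rewrite poissonE//.
  have -> : (fun t => K z t * (F (circ t) - F z0)) =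
      (fun t => K z t * F (circ t) + (- F z0) * K z t) by apply/funext => t; ring.
  rewrite circintD ?(@circintZ _ (- F z0) (K z)) ?poisson_kernel_int//.
  - by rewrite mulrDr [X in _ = _ + X]mulrCA mulVf// mulr1.
  - exact: Kc.
  - by move=> t; apply: cvgM; [exact: Kc|exact: circP].
  - by move=> t; apply: cvgM; [exact: cvg_cst|exact: Kc].
rewrite normrM gtr0_norm// mulrC ltr_pdivrMr ?pi2_gt0//.
apply: (le_lt_trans (circint_norm cKG)).
(* From |q - z0|^2 <= 2 |z - q|^2 + 2 |z - z0|^2. The right-hand side is arranged so that the last
   term has integral 0, as [K] has mean 1. *)
have Ksq t : K z t * sq (circ t) z0 <= 2 * h z + 2 * sq z z0 * (K z t - 1).
  have D0 := disc_denom t zd.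
  have E : K z t * (X z t ^+ 2 + Y z t ^+ 2) = r ^+ 2 - sq z c.
    by rewrite /K divfK// /sq; ring.
  have K0 := K_ge0 t zd.
  have T : sq (circ t) z0 <= 2 * (X z t ^+ 2 + Y z t ^+ 2) + 2 * sq z z0.
    rewrite -subr_ge0.
    have -> : 2 * (X z t ^+ 2 + Y z t ^+ 2) + 2 * sq z z0 - sq (circ t) z0 =
      (X z t + (z.1 - z0.1)) ^+ 2 + (Y z t + (z.2 - z0.2)) ^+ 2.
      rewrite /sq /circ /X /Y /=; ring.
    by rewrite addr_ge0// sqr_ge0.
  apply: (le_trans (ler_wpM2l K0 T)).
  rewrite mulrDr mulrCA E /h le_eqVlt; apply/orP; left; apply/eqP; ring.
apply: (@le_lt_trans _ _ (circint (fun t => (e / 4 + 2 * N * sq z z0) * K z t + 2 * N * (h z - sq z z0)))).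
  apply: circint_le.
  - by move=> t; apply: cvg_norm; exact: cKG.
  - move=> t; apply: cvgD; last exact: cvg_cst.
    by apply: cvgM; [exact: cvg_cst|exact: Kc].
  move=> t /FN Ft; have K0 := K_ge0 t zd.
  rewrite normrM (ger0_norm K0).
  apply: (le_trans (ler_wpM2l K0 Ft)).
  rewrite mulrDr (mulrC _ (e / 4)) (mulrCA (K z t)) .
  have := ler_wpM2l N0 (Ksq t).
  lra.
rewrite circintD; last 2 first.
- by move=> t; apply: cvgM; [exact: cvg_cst|exact: Kc].
- exact: cst_continuous.
rewrite (@circintZ _ _ (K z)) ?poisson_kernel_int// ?circint_cst; last exact: Kc.
rewrite -/twopi -mulrDl ltr_pM2r ?pi2_gt0//.
lra.
Qed.

(** Affine images of the integrals [cint] form a class to which [smooth_class] applies. *)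
Lemma poisson_smooth_harmonic : smooth_on disc (poisson F) /\
  forall z, disc z -> dx (dx (poisson F)) z + dy (dy (poisson F)) z = 0.
Proof.
pose C (f : R * R -> R) := exists k m : R, exists n (al be : R -> R),
  [/\ continuous al, continuous be & f = fun z => k * (m + cint n al be z)].
have cM (k : R) (f : R -> R) : continuous f -> continuous (fun t => k * f t).
  by move=> cf t; apply: cvgM; [exact: cvg_cst|exact: cf].
have cFc := circP cF.
have ca : continuous (fun t => - 2 * r * cos t * F (circ t)).
  by move=> t; apply: cvgM; [apply: cM; exact: continuous_cos|exact: cFc].
have cb : continuous (fun t => 2 * r * sin t * F (circ t)).
  by move=> t; apply: cvgM; [apply: cM; exact: continuous_sin|exact: cFc].
have CD k m n (al be : R -> R) : continuous al -> continuous be ->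
    forall z, disc z ->
    is_dx (fun z => k * (m + cint n al be z)) z
      (k * (0 + cint n.+1 (fun t => - n%:R * al t) (fun t => - n%:R * be t) z)) /\
    is_dy (fun z => k * (m + cint n al be z)) z
      (k * (0 + cint n.+1 (fun t => - n%:R * be t) (fun t => n%:R * al t) z)).
  move=> cal cbe z zd; have [D1 D2] := @cint_derive n al be z cal cbe zd.
  by split; (eapply der_eq; [apply derM; [exact: derC|apply derD; [exact: derC|exact: D1 || exact: D2]]|]);
    rewrite /=; ring.
have sm : smooth_on disc (poisson F).
  apply: (@smooth_class _ _ C open_disc).
  - move=> f [k [m [n [al [be [cal cbe ->]]]]]] p pd.
    apply: cvgM; first exact: cvg_cst.
    by apply: cvgD; [exact: cvg_cst|exact: cint_continuous].
  - move=> f [k [m [n [al [be [cal cbe ->]]]]]].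
    exists (fun z => k * (0 + cint n.+1 (fun t => - n%:R * al t) (fun t => - n%:R * be t) z)).
    exists (fun z => k * (0 + cint n.+1 (fun t => - n%:R * be t) (fun t => n%:R * al t) z)).
    split; last exact: CD.
    + by exists k, 0, n.+1, (fun t => - n%:R * al t), (fun t => - n%:R * be t); split => //; exact: cM.
    + by exists k, 0, n.+1, (fun t => - n%:R * be t), (fun t => n%:R * al t); split => //; exact: cM.
  - by exists twopi^-1, (circint (fun t => - F (circ t))), 1,
      (fun t => - 2 * r * cos t * F (circ t)), (fun t => 2 * r * sin t * F (circ t)).
split => // z zd.
have nz := open_nbhs_nbhs (conj open_disc zd).
set k := twopi^-1; set m := circint (fun t => - F (circ t)).
set al := fun t => - 2 * r * cos t * F (circ t); set be := fun t => 2 * r * sin t * F (circ t).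
have E1 : dx (dx (poisson F)) z =
  k * (0 + cint 3 (fun t => - 2%:R * (- 1%:R * al t)) (fun t => - 2%:R * (- 1%:R * be t)) z).
  rewrite (@dx_near _ _ (fun z => k * (0 + cint 2 (fun t => - 1%:R * al t) (fun t => - 1%:R * be t) z))).
    by apply: is_dx_dx; apply: (CD _ _ _ _ _ _ _ z zd).1; exact: cM.
  by apply: filterS nz => q qd; apply: is_dx_dx; apply: (CD _ _ _ _ _ _ _ q qd).1.
have E2 : dy (dy (poisson F)) z =
  k * (0 + cint 3 (fun t => - 2%:R * (1%:R * al t)) (fun t => 2%:R * (- 1%:R * be t)) z).
  rewrite (@dy_near _ _ (fun z => k * (0 + cint 2 (fun t => - 1%:R * be t) (fun t => 1%:R * al t) z))).
    by apply: is_dy_dy; apply: (CD _ _ _ _ _ _ _ z zd).2; exact: cM.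
  by apply: filterS nz => q qd; apply: is_dy_dy; apply: (CD _ _ _ _ _ _ _ q qd).2.
(* Two derivations in x multiply the density by 2, two in y by 2 i^2 = -2, so the integrands
   cancel. *)
rewrite E1 E2 !add0r -mulrDr /cint -circintD; last 2 first.
- by apply: cint_integrand_continuous => //; apply: (cM); apply: cM.
- by apply: cint_integrand_continuous => //; apply: (cM); apply: cM.
rewrite (_ : (fun t => _) = fun=> 0) ?circint_cst ?mul0r ?mulr0//.
by apply/funext => t; ring.
Qed.

End PoissonKernel.

(** * A maximum principle *)

Section MaximumPrinciple.
Variable R : realType.

Lemma compact_max_dist (A : set (R * R)) (f : R * R -> R) z1 :
  compact A -> A z1 ->
  (forall z, A z -> forall e : R, 0 < e -> exists2 d : R, 0 < d &
    forall q, A q -> `|q.1 - z.1| < d -> `|q.2 - z.2| < d -> `|f q - f z| < e) ->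
  exists2 m, A m & forall q, A q -> f q <= f m.
Proof.
move=> cA A1 cf.
have cAf : {within A, continuous f}.
  apply/subspace_continuousP => z Az; apply/cvgrPdist_lt => e e0.
  have [d d0 dP] := cf z Az e e0.
  rewrite near_withinE; apply/nbhs2P; exists d => // q q1 q2 Aq.
  by rewrite distrC; exact: dP.
have [|m] := compact_EVT_max _ cA cAf; first by exists z1.
by rewrite inE => Am H; exists m => // q Aq; apply: H; rewrite inE.
Qed.

Lemma compact_annulus (c : R * R) (r d : R) : 0 <= r ->
  compact [set q : R * R | (q.1 - c.1) ^+ 2 + (q.2 - c.2) ^+ 2 <= r ^+ 2 /\
    d <= (q.1 - 0) ^+ 2 + (q.2 - 0) ^+ 2].
Proof.
move=> r0.
have abs (a b : R) : 0 <= b -> a ^+ 2 + b <= r ^+ 2 -> - r <= a <= r.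
  move=> b0 H; rewrite -ler_norml -(@ler_pXn2r _ 2)// ?nnegrE//.
  by rewrite real_normK ?num_real//; lra.
apply: (@subclosed_compact _ _ (`[c.1 - r, c.1 + r]%classic `*` `[c.2 - r, c.2 + r]%classic)).
- apply: closedI.
  + apply: (@preimage_closed _ _ (fun q : R * R => (q.1 - c.1) ^+ 2 + (q.2 - c.2) ^+ 2)
      [set x | x <= r ^+ 2]); last exact: closed_le.
    by move=> q _; exact: continuous_sqdist.
  + apply: (@preimage_closed _ _ (fun q : R * R => (q.1 - 0) ^+ 2 + (q.2 - 0) ^+ 2)
      [set x | d <= x]); last exact: closed_ge.
    by move=> q _; exact: (@continuous_sqdist _ (0, 0)).
- by apply: compact_setX; exact: segment_compact.
- move=> q /= [H _]; rewrite !in_itv/=.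
  have /andP[] := abs _ _ (sqr_ge0 (q.2 - c.2)) H.
  rewrite addrC in H; have /andP[] := abs _ _ (sqr_ge0 (q.1 - c.1)) H.
  by move=> *; split; apply/andP; split; lra.
Qed.

Lemma continuous_sqnorm (p : R * R) :
  {for p, continuous (fun z : R * R => z.1 ^+ 2 + z.2 ^+ 2)}.
Proof.
rewrite (_ : (fun z => _) = fun z : R * R => (z.1 - 0) ^+ 2 + (z.2 - 0) ^+ 2).
  exact: (@continuous_sqdist R (0, 0)).
by apply/funext => z /=; rewrite !subr0.
Qed.

Lemma continuous_ln_sqnorm (p : R * R) : 0 < p.1 ^+ 2 + p.2 ^+ 2 ->
  {for p, continuous (fun z : R * R => ln (z.1 ^+ 2 + z.2 ^+ 2))}.
Proof.
by move=> p0; exact: (continuous_comp (@continuous_sqnorm p) (continuous_ln p0)).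
Qed.

Lemma der_ln (f : R -> R) (x l : R) : 0 < f x -> der1 f x l ->
  der1 (fun t => ln (f t)) x (l / f x).
Proof. by move=> fx fl; rewrite mulrC; apply: der_comp => //; exact: is_derive1_ln. Qed.

Lemma der_norm (x : R) : x != 0 -> der1 (fun t => `|t|) x (Num.sg x).
Proof.
move=> x0; have [xp|xn|xe] := ltgtP x 0; last by rewrite xe eqxx in x0.
- rewrite ltr0_sg//; apply: (@is_derive_near _ (fun t => - t)).
    apply/nbhs1P; exists (- x); first lra.
    by move=> y; rewrite ltr_norml => /andP[_ H]; rewrite ler0_norm//; lra.
- rewrite gtr0_sg//; apply: (@is_derive_near _ (fun t => t)).
    apply/nbhs1P; exists x; first lra.
    by move=> y; rewrite ltr_norml => /andP[H _]; rewrite ger0_norm//; lra.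
Qed.

(** If [f + eps |t|] had its maximum at 0, the mean slope of [f] would be at most [- eps] just right
    of 0 and at least [eps] just left of it. Both are values of [df], which contradicts its
    continuity at 0. *)
Lemma no_max_at_kink (f df : R -> R) (h eps : R) : 0 < h -> 0 < eps ->
  (forall t, `|t| <= h -> {for t, continuous f}) ->
  (forall t, t != 0 -> `|t| <= h -> der1 f t (df t)) ->
  {for 0, continuous df} ->
  (forall t, `|t| <= h -> f t + eps * `|t| <= f 0) -> False.
Proof.
move=> h0 eps0 cf fD /continuous1P/(_ _ eps0)[d d0 dP] fmax.
pose k := Num.min h (d / 2).
have k0 : 0 < k by rewrite lt_min h0 divr_gt0.
have [kh kd] : k <= h /\ k < d.
  split; first by rewrite ge_min lexx.
  by rewrite gt_min; apply/orP; right; rewrite ltr_pdivrMr// ltr_pMr ?ltr1n.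
have nk x : - k <= x <= k -> `|x| <= k by rewrite ler_norml.
have near0 x : - k <= x <= k -> df 0 - eps < df x < df 0 + eps.
  move=> /nk xk; have := dP x; rewrite subr0 => /(_ (le_lt_trans xk kd)).
  by rewrite ltr_distl.
have nkh x : - k <= x <= k -> `|x| <= h by move/nk/le_trans; exact.
have kk : - k < k by lra.
have C (a b : R) : - k <= a -> b <= k -> {within `[a, b], continuous f}.
  move=> ak bk; apply/subspace_continuousP => t; rewrite /= in_itv/= => /andP[a1 b1].
  by apply: cvg_within_filter; apply/cf/nkh/andP; split; lra.
have [||x1] := @MVT R f df 0 k k0.
- move=> t; rewrite in_itv/= => /andP[t1 t2]; apply: fD; first by rewrite gt_eqF.
  by apply/nkh/andP; split; lra.
- by apply: C; lra.
rewrite in_itv/= => /andP[a1 b1] E1.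
have k0' : - k < 0 by lra.
have [||x2] := @MVT R f df (- k) 0 k0'.
- move=> t; rewrite in_itv/= => /andP[t1 t2]; apply: fD; first by rewrite lt_eqF.
  by apply/nkh/andP; split; lra.
- by apply: C; lra.
rewrite in_itv/= => /andP[a2 b2] E2.
have /andP[n1 _] : df 0 - eps < df x1 < df 0 + eps by apply: near0; apply/andP; split; lra.
have /andP[_ n2] : df 0 - eps < df x2 < df 0 + eps by apply: near0; apply/andP; split; lra.
have F1 : f k + eps * `|k| <= f 0 by apply/fmax/nkh/andP; split; lra.
have F2 : f (- k) + eps * `|- k| <= f 0 by apply/fmax/nkh/andP; split; lra.
rewrite normrN gtr0_norm// in F2; rewrite gtr0_norm// in F1.
have G1 : (df x1 + eps) * k <= 0 by rewrite mulrDl; lra.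
have G2 : 0 <= (df x2 - eps) * k by rewrite mulrBl; lra.
rewrite pmulr_lle0// in G1; rewrite pmulr_lge0// in G2.
lra.
Qed.

(* Perturbing by [eps * (|u| + |z|^2 + ln |z|^2)] forbids interior maxima: the kink [|u|] on
   the line [u = 0], the strictly subharmonic term [|z|^2] off the line, and [ln] at the origin. *)
Lemma punctured_max_principle (c : R * R) (r M : R) (E Eu Ev Euu Evv : R * R -> R) :
  0 < r ->
  (forall z, (z.1 - c.1) ^+ 2 + (z.2 - c.2) ^+ 2 <= r ^+ 2 -> z <> (0, 0) -> E z <= M) ->
  (forall z, (z.1 - c.1) ^+ 2 + (z.2 - c.2) ^+ 2 = r ^+ 2 -> z <> (0, 0) -> E z <= 0) ->
  (forall z, (z.1 - c.1) ^+ 2 + (z.2 - c.2) ^+ 2 <= r ^+ 2 -> z <> (0, 0) ->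
    forall e : R, 0 < e -> exists2 d : R, 0 < d &
    forall q, (q.1 - c.1) ^+ 2 + (q.2 - c.2) ^+ 2 <= r ^+ 2 ->
      `|q.1 - z.1| < d -> `|q.2 - z.2| < d -> `|E q - E z| < e) ->
  (forall z, disc c r z -> z.1 != 0 ->
    [/\ is_dx E z (Eu z), is_dy E z (Ev z), is_dx Eu z (Euu z), is_dy Ev z (Evv z)
      & Euu z + Evv z = 0]) ->
  (forall z, disc c r z -> z.1 = 0 -> z.2 != 0 -> {for z, continuous Eu}) ->
  forall z, disc c r z -> z <> (0, 0) -> E z <= 0.
Proof.
move=> r0 EM Ec cE Eh Eu0 z1 z1d z10; rewrite leNgt; apply/negP => Ez1.
pose s (z : R * R) := z.1 ^+ 2 + z.2 ^+ 2.
have s0 z : z <> (0, 0) -> 0 < s z.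
  move=> z0; rewrite lt_neqAle addr_ge0 ?sqr_ge0// andbT eq_sym.
  rewrite paddr_eq0 ?sqr_ge0// !sqrf_eq0; apply/negP => /andP[/eqP a /eqP b].
  by apply: z0; rewrite [z]surjective_pairing a b.
pose T z := `|z.1| + s z + ln (s z).
have T_le z : z <> (0, 0) -> T z <= 1 + 3 * s z.
  move=> /s0 sz; have := ln_sublinear sz.
  have : `|z.1| <= 1 + s z.
    rewrite /s -(real_normK (num_real z.1)).
    by have := normr_ge0 z.1; have := sqr_ge0 z.2; nra.
  by rewrite /T; lra.
(* Bounds |z|^2 on the closed disc, by |z|^2 <= 2 |c|^2 + 2 |z - c|^2; hence [Tm] bounds [T]
   there. *)
pose S := 2 * (c.1 ^+ 2 + c.2 ^+ 2) + 2 * r ^+ 2.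
have sS z : (z.1 - c.1) ^+ 2 + (z.2 - c.2) ^+ 2 <= r ^+ 2 -> s z <= S.
  move=> zc; rewrite -subr_ge0.
  have -> : S - s z = (2 * c.1 - z.1) ^+ 2 + (2 * c.2 - z.2) ^+ 2 +
     2 * (r ^+ 2 - ((z.1 - c.1) ^+ 2 + (z.2 - c.2) ^+ 2)) by rewrite /S /s; ring.
  by rewrite !addr_ge0 ?sqr_ge0// mulr_ge0// subr_ge0.
have S0 : 0 <= S by rewrite addr_ge0// mulr_ge0// ?addr_ge0// sqr_ge0.
pose Tm := 1 + 3 * S.
have TTm z : (z.1 - c.1) ^+ 2 + (z.2 - c.2) ^+ 2 <= r ^+ 2 -> z <> (0, 0) -> T z <= Tm.
  by move=> /sS h /T_le; rewrite /Tm; lra.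
have gap : 0 < Tm - T z1 + 1 by have := TTm z1 (ltW z1d) z10; lra.
(* Small enough that [E + eps * T] exceeds [eps * Tm] at [z1], while on the circle, where [E <= 0],
   it cannot. *)
pose eps := E z1 / (2 * (Tm - T z1 + 1)).
have eps0 : 0 < eps by rewrite divr_gt0// mulr_gt0.
pose F z := E z + eps * T z.
have Fz1 : eps * Tm < F z1.
  have : eps * (2 * (Tm - T z1 + 1)) = E z1 by rewrite divfK// gt_eqF// mulr_gt0.
  by rewrite /F; have := mulr_gt0 eps0 gap; nra.
(* For |z|^2 <= del the logarithm is at most -(|M| / eps + 3); the 3 absorbs |u| and |z|^2, both at
   most 1, so [eps * T] outweighs the bound [M] on [E]. *)
pose del := expR (- (`|M| / eps + 3)).
have del0 : 0 < del by exact: expR_gt0.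
have del1 : del < 1.
  by rewrite expR_lt1 oppr_lt0 ltr_pwDr// divr_ge0// ltW.
have near0 z : (z.1 - c.1) ^+ 2 + (z.2 - c.2) ^+ 2 <= r ^+ 2 -> z <> (0, 0) ->
    s z <= del -> F z <= eps * Tm.
  move=> zc z0 sz.
  have lns : ln (s z) <= - (`|M| / eps + 3).
    by rewrite -[leRHS]expRK ler_ln ?posrE//; exact: s0.
  have z1_le : `|z.1| <= 1.
    rewrite -(@ler_pXn2r _ 2)// ?nnegrE// real_normK ?num_real// expr1n.
    by have := sqr_ge0 z.2; move: sz; rewrite /s; lra.
  have T1 : T z <= - (`|M| / eps).
    by rewrite /T; lra.
  have e1 : eps * T z <= - `|M|.
    by have := ler_wpM2l (ltW eps0) T1; rewrite mulrN mulrCA divff ?mulr1// gt_eqF.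
  have : 0 <= eps * Tm by rewrite mulr_ge0// ?ltW// /Tm; lra.
  have := EM z zc z0; have := ler_norm M; rewrite /F; lra.
pose A := [set q : R * R | (q.1 - c.1) ^+ 2 + (q.2 - c.2) ^+ 2 <= r ^+ 2 /\
    del <= (q.1 - 0) ^+ 2 + (q.2 - 0) ^+ 2].
have AP q : A q <-> (q.1 - c.1) ^+ 2 + (q.2 - c.2) ^+ 2 <= r ^+ 2 /\ del <= s q.
  by rewrite /A /= !subr0.
have Ane q : del <= s q -> q <> (0, 0).
  by move=> + q0; rewrite /s q0 /= expr0n /= addr0 => ?; lra.
have cT z : z <> (0, 0) -> {for z, continuous T}.
  move=> z0; apply: cvgD; last by apply: continuous_ln_sqnorm; exact: s0.
  apply: cvgD; first by apply: cvg_norm; exact: cvg_fst.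
  exact: continuous_sqnorm.
have A1 : A z1.
  apply/AP; split; first exact: ltW.
  rewrite leNgt; apply/negP => h; have := near0 z1 (ltW z1d) z10 (ltW h); lra.
have [m mA mmax] : exists2 m, A m & forall q, A q -> F q <= F m.
  apply: (compact_max_dist _ A1); first by apply: compact_annulus; exact: ltW.
  move=> z /AP[zc zd] e e0; have z0 := Ane z zd.
  have e20 : 0 < e / 2 by lra.
  have [d d0 dP] := cE z zc z0 _ e20.
  have [d' d'0 d'P] : exists2 d' : R, 0 < d' & forall q, `|q.1 - z.1| < d' -> `|q.2 - z.2| < d' ->
      `|eps * T q - eps * T z| < e / 2.
    have /continuous2P : {for z, continuous (fun z => eps * T z)}.
      by apply: cvgM; [exact: cvg_cst|exact: cT].
    exact.
  exists (Num.min d d'); first by rewrite lt_min d0.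
  move=> q /AP[qc _]; rewrite !lt_min => /andP[q1 q1'] /andP[q2 q2'].
  have -> : F q - F z = (E q - E z) + (eps * T q - eps * T z) by rewrite /F; ring.
  rewrite [ltRHS](splitr e); apply: (le_lt_trans (ler_normD _ _)).
  by apply: ltrD; [exact: dP|exact: d'P].
have Fm : eps * Tm < F m by exact: lt_le_trans Fz1 (mmax _ A1).
have [mc md] := (AP m).1 mA; have m0 := Ane m md.
have md' : del < s m.
  by rewrite ltNge; apply/negP => h; have := near0 m mc m0 h; lra.
have mc' : disc c r m.
  rewrite /disc /= lt_neqAle mc andbT; apply/eqP => h.
  have := Ec m h m0; have := ler_wpM2l (ltW eps0) (TTm m mc m0).
  move: Fm; rewrite /F; lra.
have sm := s0 m m0.
have nA : \forall q \near m, [/\ A q, disc c r q & 0 < s q].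
  have n1 : nbhs m (disc c r) by exact: open_nbhs_nbhs (conj (@open_disc R c r) mc').
  have n2 : \forall q \near m, del < s q.
    apply: (@continuous_sqnorm m [set x | del < x]).
    by apply: open_nbhs_nbhs; split; [exact: open_gt|].
  near=> q; have q1 : disc c r q by near: q.
  have q2 : del < s q by near: q.
  by split => //; [apply/AP; split; exact: ltW|exact: lt_trans q2].
have /nbhs2P[d d0 dP] := nA.
have dx1 t : `|t - m.1| < d -> [/\ A (t, m.2), disc c r (t, m.2) & 0 < s (t, m.2)].
  by move=> td; apply: dP => //=; rewrite subrr normr0.
have dy1 t : `|t - m.2| < d -> [/\ A (m.1, t), disc c r (m.1, t) & 0 < s (m.1, t)].
  by move=> td; apply: dP => //=; rewrite subrr normr0.
have [m10|m10] := eqVneq m.1 0.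
  have m20 : m.2 != 0.
    by apply/eqP => m20; apply: m0; rewrite [m]surjective_pairing m10 m20.
  pose h := d / 2.
  have h0 : 0 < h by rewrite divr_gt0.
  have hd : h < d by rewrite /h ltr_pdivrMr// ltr_pMr ?ltr1n.
  have dk t : `|t| <= h -> `|t - m.1| < d by rewrite m10 subr0; move/le_lt_trans; exact.
  have Em : m = (0, m.2) by rewrite [m in LHS]surjective_pairing m10.
  apply: (@no_max_at_kink (fun t => E (t, m.2)) (fun t => Eu (t, m.2)) h eps) => //.
  - move=> t th; apply/continuous1P => e e0.
    have [_ td st] := dx1 t (dk t th).
    have t0 : (t, m.2) <> (0, 0) by move=> [_ /eqP]; rewrite (negbTE m20).
    have [d2 d20 d2P] := cE (t, m.2) (ltW td) t0 e e0.
    have /nbhs2P[d3 d30 d3P] : nbhs (t, m.2) (disc c r).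
      exact: open_nbhs_nbhs (conj (@open_disc R c r) td).
    exists (Num.min d2 d3); first by rewrite lt_min d20.
    move=> y; rewrite lt_min => /andP[y2 y3].
    apply: d2P => //=; rewrite ?subrr ?normr0//.
    by apply/ltW; apply: (d3P (y, m.2)) => //=; rewrite subrr normr0.
  - by move=> t t0 th; have [_ td _] := dx1 t (dk t th); have [] := Eh _ td t0.
  - have /continuous2P cEu := Eu0 m mc' m10 m20; apply/continuous1P => e e0.
    have [d1 d10 d1P] := cEu e e0; exists d1 => // y yd.
    have := d1P (y, m.2); rewrite m10 [in Eu m]Em /= subrr normr0; exact.
  - move=> t th.
    have [At _ st] := dx1 t (dk t th).
    have := mmax _ At; rewrite /F /T /= m10 normr0 -Em.
    (* Along this horizontal line |z|^2 and its logarithm are least at u = 0, so [E + eps * |u|]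
       alone already has its maximum there. *)
    have sms : s m <= s (t, m.2) by rewrite /s /= m10 expr0n add0r lerDr sqr_ge0.
    have lns : ln (s m) <= ln (s (t, m.2)) by rewrite ler_ln ?posrE.
    have := ler_wpM2l (ltW eps0) sms; have := ler_wpM2l (ltW eps0) lns.
    rewrite !mulrDr; clear; lra.
have [_ _ Exx Eyy lap] := Eh m mc' m10; rewrite /is_dx in Exx; rewrite /is_dy in Eyy.
have nm10 : \forall q \near m, q.1 != 0.
  apply/nbhs2P; exists `|m.1|; first by rewrite normr_gt0.
  by move=> q q1 _; apply/eqP => q10; rewrite q10 sub0r normrN ltxx in q1.
have /nbhs2P[d' d'0 d'P] := nm10.
have lx : Euu m + eps * (2 + 2 / s m - 4 * m.1 ^+ 2 / (s m) ^+ 2) <= 0.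
  apply: (@second_derivative_test R (fun t => F (t, m.2))
    (fun t => Eu (t, m.2) + eps * (Num.sg t + 2 * t + 2 * t / s (t, m.2))) m.1).
  - apply/nbhs1P; exists (Num.min d d'); first by rewrite lt_min d0.
    move=> t; rewrite lt_min => /andP[td td'].
    have [_ tc st] := dx1 t td.
    have t0 : t != 0 by apply: (d'P (t, m.2)) => //=; rewrite subrr normr0.
    have [D _ _ _ _] := Eh _ tc t0.
    eapply der_eq.
      apply derD; [exact: D|apply derM; [exact: derC|apply derD; [apply derD|]]].
      + exact: der_norm.
      + by rewrite /s /=; der.
      + by apply der_ln => //; rewrite /s /=; der.
    by rewrite /=; field; rewrite gt_eqF.
  - have sgD : der1 (fun t : R => Num.sg t) m.1 0.
      apply: (@is_derive_near _ (fun=> Num.sg m.1)).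
      apply/nbhs1P; exists `|m.1|; first by rewrite normr_gt0.
      move=> y; rewrite ltr_norml => /andP[y1 y2].
      have [mp|mn|me] := ltgtP m.1 0; last by rewrite me eqxx in m10.
      + by rewrite ltr0_norm// ltrBlDr addNr in y2; rewrite !ltr0_sg.
      + by rewrite gtr0_norm// ltrBrDr addNr in y1; rewrite !gtr0_sg.
    have sm' : (m.1 ^+ 2 + m.2 ^+ 2) != 0 by rewrite gt_eqF.
    eapply der_eq; first by rewrite /s /=; der.
    by rewrite /= /s; field.
  - apply/nbhs1P; exists d => // t /dx1[At _ _].
    by have := mmax _ At; case: (m).
have ly : Evv m + eps * (2 + 2 / s m - 4 * m.2 ^+ 2 / (s m) ^+ 2) <= 0.
  apply: (@second_derivative_test R (fun t => F (m.1, t))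
    (fun t => Ev (m.1, t) + eps * (2 * t + 2 * t / s (m.1, t))) m.2).
  - apply/nbhs1P; exists d => // t td.
    have [_ tc st] := dy1 t td.
    have [_ D _ _ _] := Eh (m.1, t) tc m10.
    eapply der_eq.
      apply derD; [exact: D|apply derM; [exact: derC|apply derD; [apply derD|]]].
      + by rewrite /=; exact: derC.
      + by rewrite /s /=; der.
      + by apply der_ln => //; rewrite /s /=; der.
    by rewrite /=; field; rewrite gt_eqF.
  - have sm' : (m.1 ^+ 2 + m.2 ^+ 2) != 0 by rewrite gt_eqF.
    eapply der_eq; first by rewrite /s /=; der.
    by rewrite /= /s; field.
  - apply/nbhs1P; exists d => // t /dy1[At _ _].
    by have := mmax _ At; case: (m).
(* The Laplacian of |z|^2 + ln |z|^2: the logarithm contributes 0 and the square 4. *)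
have E4 : 2 + 2 / s m - 4 * m.1 ^+ 2 / (s m) ^+ 2 + (2 + 2 / s m - 4 * m.2 ^+ 2 / (s m) ^+ 2) = 4.
  by rewrite /s; field; rewrite gt_eqF.
have := lerD lx ly; rewrite addrACA lap add0r addr0 -mulrDr E4 leNgt mulr_gt0//.
Unshelve. all: end_near. Qed.

End MaximumPrinciple.

(** * The jump across the slit *)

Section OneSidedLimit.
Variable R : realType.

(** The limit as u decreases to 0, for [m] nondecreasing in u > 0; as an infimum it exists without a
    convergence argument. *)
Definition right_limit (U : set (R * R)) (m : R * R -> R) (v : R) : R :=
  inf [set m (u, v) | u in [set u | 0 < u /\ U (u, v)]].

(** Near the ray [gam] is bounded by some [M], so on each horizontal line [m] lies within [M * u] of
    its limit. This rate is uniform in v, and continuity of the limit is inherited from that of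
    [m (u, _)]. *)
Lemma right_limitP (U : set (R * R)) (m gam : R * R -> R) (v0 K : R) :
  open U -> U (0, v0) ->
  (forall q, U q -> 0 < q.1 -> is_dx m q (gam q)) ->
  (forall q, U q -> 0 < q.1 -> {for q, continuous m}) ->
  (forall q, U q -> 0 < q.1 -> - K <= m q) ->
  (forall u u' v, U (u, v) -> U (u', v) -> 0 < u -> u <= u' -> m (u, v) <= m (u', v)) ->
  {for (0, v0), continuous gam} ->
  {for v0, continuous (right_limit U m)} /\
  exists d M : R, [/\ 0 < d, 0 < M & forall u v, 0 < u -> u < d -> `|v - v0| < d ->
    [/\ U (u, v), right_limit U m v <= m (u, v) & m (u, v) <= right_limit U m v + M * u]].
Proof.
move=> oU U0 mD cm mK mono cg.
have [d d0 dU] : exists2 d : R, 0 < d & forall q, `|q.1| < d -> `|q.2 - v0| < d ->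
    U q /\ gam q <= gam (0, v0) + 1.
  have /nbhs2P[d1 d10 d1P] : nbhs (0, v0) U by exact: open_nbhs_nbhs.
  have /continuous2P/(_ _ (@ltr01 R))[d2 d20 d2P] := cg.
  exists (Num.min d1 d2); first by rewrite lt_min d10.
  move=> q; rewrite !lt_min => /andP[a1 a2] /andP[b1 b2]; split.
    by apply: d1P; rewrite /= ?subr0.
  have := d2P q; rewrite /= subr0 => /(_ a2 b2).
  by rewrite ltr_norml => /andP[_]; lra.
pose M := Num.max 1 (gam (0, v0) + 1).
have M0 : 0 < M by rewrite lt_max ltr01.
have key u v : 0 < u -> u < d -> `|v - v0| < d ->
    [/\ U (u, v), right_limit U m v <= m (u, v) & m (u, v) <= right_limit U m v + M * u].
  move=> u0 ud vd.
  have [Uu _] : U (u, v) /\ gam (u, v) <= gam (0, v0) + 1 by apply: dU => //=; rewrite gtr0_norm.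
  have hlb : has_lbound [set m (u, v) | u in [set u | 0 < u /\ U (u, v)]].
    by exists (- K) => _ [u' [u'0 Uu'] <-]; exact: mK.
  split => //.
    by apply: ge_inf => //; exists u.
  rewrite -lerBlDr; apply: lb_le_inf; first by exists (m (u, v)), u.
  move=> _ [u' [u'0 Uu'] <-].
  have [uu'|u'u] := leP u u'.
    apply: le_trans (mono _ _ _ Uu Uu' u0 uu').
    by rewrite gerBl mulr_ge0// ltW.
  have dom s : u' <= s -> s <= u -> U (s, v) /\ gam (s, v) <= M.
    move=> s1 s2; have [|//|Us gs] := dU (s, v).
      by rewrite /= gtr0_norm; lra.
    by split => //; rewrite le_max gs orbT.
  have [||c] := @MVT R (fun t => m (t, v)) (fun t => gam (t, v)) u' u u'u.
  - move=> t; rewrite in_itv/= => /andP[t1 t2].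
    have [Ut _] := dom t (ltW t1) (ltW t2).
    by apply: (mD (t, v)) => //=; lra.
  - apply: derivable_within_continuous => t; rewrite in_itv/= => /andP[t1 t2].
    have [Ut _] := dom t t1 t2.
    by have [] : is_dx m (t, v) (gam (t, v)) by apply: mD => //=; lra.
  rewrite in_itv/= => /andP[c1 c2] E.
  have [_ gc] := dom c (ltW c1) (ltW c2).
  have h : gam (c, v) * (u - u') <= M * u.
    apply: (@le_trans _ _ (M * (u - u'))); first by rewrite ler_wpM2r// subr_ge0 ltW.
    by rewrite ler_pM2l//; lra.
  by rewrite /= in E; lra.
split; last by exists d, M.
apply/continuous1P => e e0.
(* At this one abscissa [m] is within e / 4 of the limit, both at v0 and at every nearby v. *)
pose u := Num.min (d / 2) (e / (4 * M)).
have u0 : 0 < u by rewrite lt_min !divr_gt0// mulr_gt0.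
have ud : u < d by rewrite gt_min ltr_pdivrMr// ltr_pMr// ltr1n.
have ue : M * u <= e / 4.
  have : u <= e / (4 * M) by rewrite ge_min lexx orbT.
  by rewrite invfM mulrA ler_pdivlMr// mulrC.
have v0d : `|v0 - v0| < d by rewrite subrr normr0.
have [Uu l0 r0] := key u v0 u0 ud v0d.
have /continuous2P/(_ (e / 4))[|d1 d10 d1P] := cm _ Uu u0; first by rewrite divr_gt0.
exists (Num.min d d1); first by rewrite lt_min d0.
move=> v; rewrite lt_min => /andP[vd vd1].
have [_ l1 r1] := key u v u0 ud vd.
have := d1P (u, v); rewrite /= subrr normr0 => /(_ d10 vd1).
by rewrite !ltr_norml => /andP[a b]; apply/andP; split; lra.
Qed.

End OneSidedLimit.

(** * The two possible jumps *)

Section SlitJump.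
Variable R : realType.
Variables (U : set (R * R)) (m gam : R * R -> R).
Let off (q : R * R) := U q /\ ~ (q.1 = 0 /\ 0 <= q.2).
Hypothesis oU : open U.
Hypothesis Uitv : forall v1 v2 v, U (0, v1) -> U (0, v2) -> v1 <= v -> v <= v2 -> U (0, v).
Hypothesis mD : forall q, off q -> is_dx m q (gam q).
Hypothesis cm : forall q, off q -> {for q, continuous m}.
Hypothesis cgam : forall q, U q -> q <> (0, 0) -> {for q, continuous gam}.
(** Two of the inequalities of [ThetaE], for a gradient whose components have sum [q.2] and
    difference [2 * m q]. For positive [q.2] they leave the gap |m| < 2 v between the lobes. *)
Hypothesis mTheta : forall q, off q -> 2 * q.2 <= `|m q| /\ 2 * `|m q| - 1 <= q.2.
Hypothesis mK : forall q, off q -> `|m q| <= 1.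
Hypothesis mono : forall q q', off q -> off q' -> q.2 = q'.2 ->
  0 <= (m q - m q') * (q.1 - q'.1).
(** Mass balance: every gradient interior to [Theta] with v > 0 is approximated by gradients taken
    off the ray. *)
Hypothesis dense : forall P v e : R, 0 < e -> 0 < v -> 2 * v < `|P| -> 2 * `|P| - 1 < v ->
  exists q, [/\ off q, `|m q - P| < e & `|q.2 - v| < e].

Let rl := right_limit U m.
(** The limit from the left, reduced to [right_limit] by the reflection (u, m) -> (-u, -m), which
    preserves monotonicity. *)
Let ll v := - right_limit [set q | U (- q.1, q.2)] (fun q => - m (- q.1, q.2)) v.

Let off_neq q : U q -> q.1 != 0 -> off q.
Proof. by move=> Uq q1; split => // -[/eqP]; rewrite (negbTE q1). Qed.

Let rlP v0 : 0 < v0 -> U (0, v0) -> {for v0, continuous rl} /\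
  exists d M : R, [/\ 0 < d, 0 < M & forall u v, 0 < u -> u < d -> `|v - v0| < d ->
    [/\ U (u, v), rl v <= m (u, v) & m (u, v) <= rl v + M * u]].
Proof.
move=> v0_gt0 U0; apply: (@right_limitP _ U m gam v0 1) => //.
- by move=> q Uq q0; apply: mD; apply: off_neq; rewrite ?gt_eqF.
- by move=> q Uq q0; apply: cm; apply: off_neq; rewrite ?gt_eqF.
- move=> q Uq q0; have := mK (off_neq Uq (lt0r_neq0 q0)).
  by rewrite ler_norml => /andP[].
- move=> u u' v Uu Uu' u0; rewrite le_eqVlt => /orP[/eqP->//|uu'].
  have u'0 := lt_trans u0 uu'.
  have := mono (off_neq Uu' (lt0r_neq0 u'0)) (off_neq Uu (lt0r_neq0 u0)) erefl.
  by rewrite pmulr_lge0 ?subr_gt0// subr_ge0.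
- by apply: cgam => //; case; lra.
Qed.

Let refl_continuous (f : R * R -> R) (q : R * R) : {for (- q.1, q.2), continuous f} ->
  {for q, continuous (fun z => f (- z.1, z.2))}.
Proof.
move=> /continuous2P cf; apply/continuous2P => e e0; have [d d0 dP] := cf e e0.
by exists d => // z z1 z2; apply: dP => //=; rewrite -opprD normrN.
Qed.

Let llP v0 : 0 < v0 -> U (0, v0) -> {for v0, continuous ll} /\
  exists d M : R, [/\ 0 < d, 0 < M & forall u v, 0 < u -> u < d -> `|v - v0| < d ->
    [/\ U (- u, v), m (- u, v) <= ll v & ll v - M * u <= m (- u, v)]].
Proof.
move=> v0_gt0 U0.
have offN (q : R * R) : U (- q.1, q.2) -> 0 < q.1 -> off (- q.1, q.2).
  by move=> Uq q0; apply: off_neq => //=; rewrite oppr_eq0 gt_eqF.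
have [||q Uq q0|q Uq q0|q Uq q0|u u' v Uu Uu' u0||c [d [M [d0 M0 dP]]]] :=
  @right_limitP _ [set q : R * R | U (- q.1, q.2)] (fun q => - m (- q.1, q.2))
    (fun q => gam (- q.1, q.2)) v0 1.
- rewrite openE => q Uq; have /nbhs2P[d d0 dP] : nbhs (- q.1, q.2) U by exact: open_nbhs_nbhs.
  by apply/nbhs2P; exists d => // z z1 z2; apply: dP => //=; rewrite -opprD normrN.
- by rewrite /= oppr0.
- have D := mD (offN q Uq q0).
  eapply der_eq.
    apply derN; apply: (@der_comp _ (fun t => m (t, q.2)) (fun t => - t)); first exact: D.
    by apply derN; exact: derI.
  by rewrite mulrN1 opprK.
- apply: cvgN; apply: refl_continuous; apply: cm; exact: offN.
- by have := mK (offN q Uq q0); rewrite ler_norml lerN2 => /andP[].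
- rewrite le_eqVlt => /orP[/eqP->//|uu'].
  have u'0 := lt_trans u0 uu'.
  have := mono (offN (u', v) Uu' u'0) (offN (u, v) Uu u0) erefl.
  have h : - u' - - u < 0 by lra.
  by rewrite /= nmulr_lge0// subr_le0 lerN2.
- apply: refl_continuous; apply: cgam; rewrite /= oppr0 //.
  by case; lra.
split; first by apply: cvgN; exact: c.
exists d, M; split => // u v u0 ud vd.
have [Uu h1 h2] := dP u v u0 ud vd; split => //.
  by rewrite lerNr.
by rewrite /ll -opprD lerNl.
Qed.

Let near_ray v0 (e : R) : 0 < v0 -> U (0, v0) -> 0 < e ->
  exists u, [/\ 0 < u, off (u, v0), off (- u, v0),
    rl v0 <= m (u, v0) < rl v0 + e & ll v0 - e < m (- u, v0) <= ll v0].
Proof.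
move=> v0_gt0 U0 e0.
have [_ [d [M [d0 M0 dP]]]] := rlP v0_gt0 U0.
have [_ [d' [M' [d'0 M'0 d'P]]]] := llP v0_gt0 U0.
pose u := Num.min (Num.min d d' / 2) (Num.min (e / (2 * M)) (e / (2 * M'))).
have u0 : 0 < u by rewrite !lt_min !divr_gt0// ?mulr_gt0// lt_min d0.
have : u < Num.min d d'.
  by rewrite gt_min ltr_pdivrMr ?ltr_pMr ?ltr1n// lt_min d0.
rewrite lt_min => /andP[ud ud'].
have uM : M * u < e.
  have : u <= e / (2 * M) by rewrite !ge_min lexx !orbT.
  by rewrite invfM mulrA ler_pdivlMr// mulrC => ?; lra.
have uM' : M' * u < e.
  have : u <= e / (2 * M') by rewrite !ge_min lexx !orbT.
  by rewrite invfM mulrA ler_pdivlMr// mulrC => ?; lra.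
have z0 : `|v0 - v0| < d by rewrite subrr normr0.
have z0' : `|v0 - v0| < d' by rewrite subrr normr0.
have [Uu a1 a2] := dP u v0 u0 ud z0; have [Uu' b1 b2] := d'P u v0 u0 ud' z0'.
exists u; split => //.
- by apply: off_neq => //=; rewrite gt_eqF.
- by apply: off_neq => //=; rewrite oppr_eq0 gt_eqF.
- by rewrite a1/=; lra.
- by rewrite b1 andbT; lra.
Qed.

Let ll_le_rl v0 : 0 < v0 -> U (0, v0) -> ll v0 <= rl v0.
Proof.
move=> v0_gt0 U0; apply/ler_addgt0Pl => e e0.
have e20 : 0 < e / 2 by rewrite divr_gt0.
have [u [u0 o1 o2 /andP[a1 a2] /andP[b1 b2]]] := near_ray v0_gt0 U0 e20.
have := mono o1 o2 erefl; rewrite /= pmulr_lge0; last by rewrite opprK addr_gt0.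
lra.
Qed.

Let rl_Theta v0 : 0 < v0 -> U (0, v0) ->
  [/\ 2 * v0 <= `|rl v0|, 2 * `|rl v0| - 1 <= v0, 2 * v0 <= `|ll v0| & 2 * `|ll v0| - 1 <= v0].
Proof.
move=> v0_gt0 U0.
have H e : 0 < e -> [/\ 2 * v0 <= `|rl v0| + e, 2 * `|rl v0| - 1 <= v0 + e,
    2 * v0 <= `|ll v0| + e & 2 * `|ll v0| - 1 <= v0 + e].
  move=> e0; have e20 : 0 < e / 2 by rewrite divr_gt0.
  have [u [u0 o1 o2 /andP[a1 a2] /andP[b1 b2]]] := near_ray v0_gt0 U0 e20.
  have [/= h1 h2] := mTheta o1; have [/= h3 h4] := mTheta o2.
  have n1 : `|m (u, v0) - rl v0| <= e / 2 by rewrite ler_norml; apply/andP; split; lra.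
  have n2 : `|m (- u, v0) - ll v0| <= e / 2 by rewrite ler_norml; apply/andP; split; lra.
  have := ler_distD 0 (m (u, v0)) (rl v0); have := ler_distD 0 (rl v0) (m (u, v0)).
  have k1 : `|m (u, v0)| <= `|rl v0| + e / 2.
    by rewrite -[m (u, v0)](subrK (rl v0)) addrC (le_trans (ler_normD _ _))// lerD2l.
  have k2 : `|rl v0| <= `|m (u, v0)| + e / 2.
    by rewrite -[rl v0](subrK (m (u, v0))) addrC (le_trans (ler_normD _ _))// lerD2l distrC.
  have k3 : `|m (- u, v0)| <= `|ll v0| + e / 2.
    by rewrite -[m (- u, v0)](subrK (ll v0)) addrC (le_trans (ler_normD _ _))// lerD2l.
  have k4 : `|ll v0| <= `|m (- u, v0)| + e / 2.
    by rewrite -[ll v0](subrK (m (- u, v0))) addrC (le_trans (ler_normD _ _))// lerD2l distrC.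
  by split; lra.
by split; apply/ler_addgt0Pr => e e0; have [] := H e e0; lra.
Qed.

(* Gradients strictly between the one-sided limits are subgradients at a point of the ray,
   hence are not taken elsewhere; but they would have to be, by mass balance. *)
Let gap_missed v0 P : 0 < v0 -> U (0, v0) -> ll v0 < P -> P < rl v0 ->
  2 * v0 < `|P| -> 2 * `|P| - 1 < v0 -> False.
Proof.
move=> v0_gt0 U0 lP Pr h1 h2.
have [cr _] := rlP v0_gt0 U0; have [cl _] := llP v0_gt0 U0.
pose e := Num.min (P - ll v0) (rl v0 - P) / 2.
have e0 : 0 < e by rewrite divr_gt0// lt_min !subr_gt0 lP.
have : 2 * e <= Num.min (P - ll v0) (rl v0 - P) by rewrite mulrC divfK.
rewrite le_min => /andP[el er].
move/continuous1P : cr => /(_ e e0)[d d0 dP].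
move/continuous1P : cl => /(_ e e0)[d' d'0 d'P].
have /nbhs2P[d1 d10 d1P] : nbhs (0, v0) U by exact: open_nbhs_nbhs.
pose e' := Num.min (Num.min d d') (Num.min (Num.min d1 v0) e).
have e'0 : 0 < e' by rewrite !lt_min d0 d'0 d10 v0_gt0 e0.
have [q [[Uq nray] mq qv]] := dense e'0 v0_gt0 h1 h2.
move: mq qv; rewrite !lt_min => /andP[_ /andP[_ mq]] /andP[/andP[qd qd'] /andP[/andP[qd1 qv] _]].
have q20 : 0 < q.2 by move: qv; rewrite ltr_norml => /andP[]; lra.
have U0q : U (0, q.2) by apply: d1P => //=; rewrite subrr normr0.
have rq : m q < rl q.2.
  have := dP _ qd; move: mq; rewrite !ltr_norml => /andP[_ ?] /andP[? _]; lra.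
have lq : ll q.2 < m q.
  have := d'P _ qd'; move: mq; rewrite !ltr_norml => /andP[? _] /andP[_ ?]; lra.
(* Monotonicity against the points (u, q.2) and (-u, q.2), where [m] is beyond [m q] on either side,
   traps [q.1] between -u and u. Hence [q] lies on the ray. *)
have H e1 : 0 < e1 -> exists u, [/\ 0 < u, u < e1 & `|q.1| <= u].
  move=> e10.
  have [_ [r [M [r0 M0 rP]]]] := rlP q20 U0q.
  have [_ [r' [M' [r'0 M'0 r'P]]]] := llP q20 U0q.
  pose u := Num.min (Num.min r r') e1 / 2.
  have u0 : 0 < u by rewrite divr_gt0// !lt_min r0 r'0.
  have : u < Num.min (Num.min r r') e1 by rewrite /u ltr_pdivrMr// ltr_pMr ?ltr1n// !lt_min r0 r'0.
  rewrite !lt_min => /andP[/andP[ur ur'] ue].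
  have z0 : `|q.2 - q.2| < r by rewrite subrr normr0.
  have z0' : `|q.2 - q.2| < r' by rewrite subrr normr0.
  have [U1 a1 _] := rP u q.2 u0 ur z0; have [U2 b1 _] := r'P u q.2 u0 ur' z0'.
  have o1 : off (u, q.2) by apply: off_neq => //=; rewrite gt_eqF.
  have o2 : off (- u, q.2) by apply: off_neq => //=; rewrite oppr_eq0 gt_eqF.
  have := mono o1 (conj Uq nray) erefl; have := mono (conj Uq nray) o2 erefl; rewrite /=.
  rewrite !pmulr_rge0 ?subr_gt0; [|exact: lt_le_trans a1|exact: le_lt_trans lq].
  by rewrite !subr_ge0 => A B; exists u; rewrite ler_norml A B.
have q10 : q.1 = 0.
  apply/eqP; rewrite -normr_eq0 eq_le normr_ge0 andbT; apply/ler_addgt0Pr => e1 e10.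
  by have [u [u0 ue qu]] := H e1 e10; rewrite add0r; lra.
by apply: nray; split => //; exact: ltW.
Qed.

(** No gradient interior to [Theta] may lie between distinct limits, so the interval they span stays
    within |P| <= 2 v. The limits themselves satisfy 2 v <= |P|, hence they are its two ends. *)
Let jump_dichotomy v0 : 0 < v0 -> U (0, v0) ->
  rl v0 = ll v0 \/ (rl v0 = 2 * v0 /\ ll v0 = - (2 * v0)).
Proof.
move=> v0_gt0 U0; have lr := ll_le_rl v0_gt0 U0.
have [t1 t2 t3 t4] := rl_Theta v0_gt0 U0.
have [->|ne] := eqVneq (rl v0) (ll v0); [by left|right].
have {ne} lr' : ll v0 < rl v0 by rewrite lt_neqAle eq_sym ne.
(* Otherwise the midpoint of [a] and [rl v0] would be a gradient interior to [Theta] and strictly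
   between the limits. *)
have up a : ll v0 <= a -> 2 * v0 <= a -> a < rl v0 -> False.
  move=> la va ar; have P0 : 0 < (a + rl v0) / 2 by lra.
  have r0 : 0 < rl v0 by lra.
  rewrite (gtr0_norm r0) in t2.
  by apply: (@gap_missed v0 ((a + rl v0) / 2)) => //; try rewrite (gtr0_norm P0); lra.
have down a : a <= rl v0 -> a <= - (2 * v0) -> ll v0 < a -> False.
  move=> la va ar; have P0 : (a + ll v0) / 2 < 0 by lra.
  have r0 : ll v0 < 0 by lra.
  rewrite (ltr0_norm r0) in t4.
  by apply: (@gap_missed v0 ((a + ll v0) / 2)) => //; try rewrite (ltr0_norm P0); lra.
have r_ge : 2 * v0 <= rl v0.
  rewrite leNgt; apply/negP => rv; apply: (down (rl v0)) => //.
  by move: t1; have [r0|r0] := leP 0 (rl v0); [rewrite ger0_norm//; lra|rewrite ltr0_norm//; lra].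
have l_le : ll v0 <= - (2 * v0).
  rewrite leNgt; apply/negP => rv; apply: (up (ll v0)) => //.
  by move: t3; have [r0|r0] := leP 0 (ll v0); [rewrite ger0_norm//; lra|rewrite ltr0_norm//; lra].
split; apply/eqP; rewrite eq_le ?r_ge ?l_le ?andbT leNgt; apply/negP => h.
  by apply: (up (2 * v0)) => //; lra.
by apply: (down (- (2 * v0))) => //; lra.
Qed.

(** The jump is 0 or 4 v, so [J], the jump minus 2 v, is continuous and never 0; it cannot change
    sign on the interval between v1 and v2. *)
Let jump_constant v1 v2 : 0 < v1 -> 0 < v2 -> U (0, v1) -> U (0, v2) ->
  rl v1 = ll v1 -> rl v2 = ll v2.
Proof.
move=> v10 v20 U1 U2 E1; have [//|[r2 l2]] := jump_dichotomy v20 U2.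
pose J v := rl v - ll v - 2 * v.
have cJ v : 0 < v -> U (0, v) -> {for v, continuous J}.
  move=> v0 Uv; have [cr _] := rlP v0 Uv; have [cl _] := llP v0 Uv.
  apply: cvgB; first by apply: cvgB; [exact: cr|exact: cl].
  by apply: cvgM; [exact: cvg_cst|exact: cvg_id].
have J1 : J v1 < 0 by rewrite /J E1 subrr; lra.
have J2 : 0 < J v2 by rewrite /J r2 l2; lra.
have root a b : 0 < a -> a <= b -> U (0, a) -> U (0, b) ->
    Num.min (J a) (J b) <= 0 <= Num.max (J a) (J b) -> False.
  move=> a0 ab Ua Ub mm.
  have [|c] := @IVT R J a b 0 ab _ mm.
    apply/subspace_continuousP => t; rewrite /= in_itv/= => /andP[t1 t2].
    by apply: cvg_within_filter; apply: cJ; [lra|exact: Uitv Ua Ub t1 t2].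
  rewrite in_itv/= => /andP[c1 c2].
  have c0 : 0 < c by lra.
  have Uc := Uitv Ua Ub c1 c2; rewrite /J.
  by have [->|[-> ->]] := jump_dichotomy c0 Uc; lra.
exfalso; have [v12|v21] := leP v1 v2.
  by apply: (root v1 v2) => //; rewrite ge_min le_max (ltW J1) (ltW J2) orbT.
by apply: (root v2 v1) => //; [exact: ltW|rewrite ge_min le_max (ltW J1) (ltW J2) orbT].
Qed.

(** Subtracting 2 k v sgn u makes the one-sided limits equal, and [N] is their common value. The
    rates of [right_limitP] make the approach locally uniform along the ray. *)
Lemma slit_jump : exists k : R, 0 <= k /\ exists N : R -> R, forall v0, 0 < v0 -> U (0, v0) ->
  {for v0, continuous N} /\
  forall e : R, 0 < e -> exists2 d : R, 0 < d & forall q, q.1 != 0 ->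
    `|q.1| < d -> `|q.2 - v0| < d -> `|m q - 2 * k * q.2 * Num.sg q.1 - N v0| < e.
Proof.
have [k [k0 kE]] : exists k : R, 0 <= k /\ forall v, 0 < v -> U (0, v) ->
    rl v - 2 * k * v = ll v + 2 * k * v.
  (* A single point without jump forces k = 0 everywhere; otherwise the jump is 4 v throughout and k
     = 1. *)
  have [[v1 [v10 [U1 E1]]]|nE] := pselect (exists v, 0 < v /\ (U (0, v) /\ rl v = ll v)).
    exists 0; split => // v v0 Uv.
    by rewrite (jump_constant v10 v0 U1 Uv E1) !mulr0 mul0r subr0 addr0.
  exists 1; split => // v v0 Uv; have [E|[-> ->]] := jump_dichotomy v0 Uv.
    by exfalso; apply: nE; exists v.
  by lra.
exists k; split => //; exists (fun v => rl v - 2 * k * v) => v0 v0_gt0 U0.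
have [cr [d [M [d0 M0 dP]]]] := rlP v0_gt0 U0.
have [cl [d' [M' [d'0 M'0 d'P]]]] := llP v0_gt0 U0.
have cN : {for v0, continuous (fun v => rl v - 2 * k * v)}.
  by apply: cvgB; [exact: cr|apply: cvgM; [exact: cvg_cst|exact: cvg_id]].
split => // e e0.
have e20 : 0 < e / 2 by rewrite divr_gt0.
have /nbhs2P[d2 d20 d2P] : nbhs (0, v0) U by exact: open_nbhs_nbhs.
move/continuous1P : cN => /(_ _ e20)[d1 d10 d1P].
pose h := Num.min (Num.min (Num.min d d') (Num.min d1 d2)) (Num.min v0 (Num.min (e / (2 * M)) (e / (2 * M')))).
have h0 : 0 < h by rewrite !lt_min d0 d'0 d10 d20 v0_gt0 !divr_gt0// mulr_gt0.
exists h => // -[u v] /= u0.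
rewrite !lt_min => /andP[/andP[/andP[ud ud'] _] /andP[_ /andP[uM uM']]].
move=> /andP[/andP[/andP[vd vd'] /andP[vd1 vd2]] /andP[vv0 _]].
have v_gt0 : 0 < v by move: vv0; rewrite ltr_norml => /andP[]; lra.
have U0v : U (0, v) by apply: d2P => //=; rewrite subrr normr0.
have uMe : M * `|u| < e / 2.
  by move: uM; rewrite invfM mulrA ltr_pdivlMr// mulrC.
have uMe' : M' * `|u| < e / 2.
  by move: uM'; rewrite invfM mulrA ltr_pdivlMr// mulrC.
have Nv := d1P v vd1.
suff S : `|m (u, v) - 2 * k * v * Num.sg u - (rl v - 2 * k * v)| < e / 2.
  rewrite [ltRHS](splitr e) (_ : _ - _ = (m (u, v) - 2 * k * v * Num.sg u - (rl v - 2 * k * v)) +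
    (rl v - 2 * k * v - (rl v0 - 2 * k * v0))); last by ring.
  by apply: (le_lt_trans (ler_normD _ _)); apply: ltrD.
have [u_neg|u_pos|ue] := ltgtP u 0; last by rewrite ue eqxx in u0.
- rewrite (ltr0_sg u_neg) kE//; rewrite (ltr0_norm u_neg) in ud' uMe'.
  have nu0 : 0 < - u by rewrite oppr_gt0.
  have [_ a1 a2] := d'P _ _ nu0 ud' vd'; rewrite opprK in a1 a2.
  have -> : m (u, v) - 2 * k * v * -1 - (ll v + 2 * k * v) = m (u, v) - ll v by ring.
  by rewrite distrC ger0_norm ?subr_ge0// (le_lt_trans _ uMe')// lerBlDl -lerBlDr.
- rewrite (gtr0_sg u_pos); rewrite (gtr0_norm u_pos) in ud uMe.
  have [_ a1 a2] := dP _ _ u_pos ud vd.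
  have -> : m (u, v) - 2 * k * v * 1 - (rl v - 2 * k * v) = m (u, v) - rl v by ring.
  by rewrite ger0_norm ?subr_ge0// (le_lt_trans _ uMe)// lerBlDl.
Qed.

End SlitJump.

(** * Harmonic functions with a jump on a ray *)

Local Opaque dx dy.

(** * Linear combinations of smooth functions *)

Section SmoothLinear.
Variable R : realType.
Implicit Types (f g : R * R -> R) (U : set (R * R)).

Lemma smooth_lin U f g (a b : R) : open U -> smooth_on U f -> smooth_on U g ->
  smooth_on U (fun z => a * f z + b * g z).
Proof.
move=> oU sf sg.
apply: (@smooth_class _ U (fun F => exists f g : R * R -> R,
  [/\ smooth_on U f, smooth_on U g & F = fun z => a * f z + b * g z])) => //.
- move=> _ [f1 [g1 [s1 s2 ->]]] p Up.
  by apply: cvgD; apply: cvgM; [exact: cvg_cst|exact: (@smooth_continuous _ f1 U [::])|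
    exact: cvg_cst|exact: (@smooth_continuous _ g1 U [::])].
- move=> _ [f1 [g1 [s1 s2 ->]]].
  exists (fun z => a * dx f1 z + b * dx g1 z), (fun z => a * dy f1 z + b * dy g1 z); split.
  + by exists (dx f1), (dx g1); split; [exact: smooth_dx|exact: smooth_dx|].
  + by exists (dy f1), (dy g1); split; [exact: smooth_dy|exact: smooth_dy|].
  + move=> p Up; split.
      have D1 := @smooth_is_dx _ f1 U [::] p s1 Up; have D2 := @smooth_is_dx _ g1 U [::] p s2 Up.
      eapply der_eq; first by apply derD; apply derM; [exact: derC|exact: D1|exact: derC|exact: D2].
      by rewrite /= !mul0r !add0r.
    have D1 := @smooth_is_dy _ f1 U [::] p s1 Up; have D2 := @smooth_is_dy _ g1 U [::] p s2 Up.
    eapply der_eq; first by apply derD; apply derM; [exact: derC|exact: D1|exact: derC|exact: D2].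
    by rewrite /= !mul0r !add0r.
- by exists f, g.
Qed.

Lemma smooth_cst U (c : R) : open U -> smooth_on U (fun=> c).
Proof.
move=> oU; apply: (@smooth_class _ U (fun F => exists c : R, F = fun=> c)) => //.
- by move=> _ [c' ->] p _; exact: cvg_cst.
- move=> _ [c' ->]; exists (fun=> 0), (fun=> 0); split; [by exists 0|by exists 0|].
  by move=> p _; split; exact: derC.
- by exists c.
Qed.

Lemma laplace_cst (c : R) (p : R * R) :
  dx (dx (fun _ : R * R => c)) p + dy (dy (fun _ : R * R => c)) p = 0.
Proof.
have cx (c' : R) q : dx (fun _ : R * R => c') q = 0.
  exact: (@is_dx_dx _ (fun=> c') q 0 (derC c' q.1)).
have cy (c' : R) q : dy (fun _ : R * R => c') q = 0.
  exact: (@is_dy_dy _ (fun=> c') q 0 (derC c' q.2)).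
have -> : dx (fun _ : R * R => c) = fun=> 0 by apply/funext.
have -> : dy (fun _ : R * R => c) = fun=> 0 by apply/funext.
by rewrite cx cy addr0.
Qed.

Lemma laplace_lin U f g (a b : R) p : open U -> smooth_on U f -> smooth_on U g -> U p ->
  dx (dx (fun z => a * f z + b * g z)) p + dy (dy (fun z => a * f z + b * g z)) p =
  a * (dx (dx f) p + dy (dy f) p) + b * (dx (dx g) p + dy (dy g) p).
Proof.
move=> oU sf sg Up.
have nU := open_nbhs_nbhs (conj oU Up).
have linx f1 g1 q : smooth_on U f1 -> smooth_on U g1 -> U q ->
    dx (fun z => a * f1 z + b * g1 z) q = a * dx f1 q + b * dx g1 q.
  move=> s1 s2 Uq; apply: is_dx_dx.
  have D1 := @smooth_is_dx _ f1 U [::] q s1 Uq; have D2 := @smooth_is_dx _ g1 U [::] q s2 Uq.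
  eapply der_eq; first by apply derD; apply derM; [exact: derC|exact: D1|exact: derC|exact: D2].
  by rewrite /= !mul0r !add0r.
have liny f1 g1 q : smooth_on U f1 -> smooth_on U g1 -> U q ->
    dy (fun z => a * f1 z + b * g1 z) q = a * dy f1 q + b * dy g1 q.
  move=> s1 s2 Uq; apply: is_dy_dy.
  have D1 := @smooth_is_dy _ f1 U [::] q s1 Uq; have D2 := @smooth_is_dy _ g1 U [::] q s2 Uq.
  eapply der_eq; first by apply derD; apply derM; [exact: derC|exact: D1|exact: derC|exact: D2].
  by rewrite /= !mul0r !add0r.
rewrite (@dx_near _ _ (fun z => a * dx f z + b * dx g z)); last first.
  by apply: filterS nU => q; exact: linx.
rewrite (@dy_near _ _ (fun z => a * dy f z + b * dy g z)); last first.
  by apply: filterS nU => q; exact: liny.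
rewrite (linx _ _ _ (smooth_dx sf) (smooth_dx sg) Up).
rewrite (liny _ _ _ (smooth_dy sf) (smooth_dy sg) Up).
by move: (dx (dx f) p) (dx (dx g) p) (dy (dy f) p) (dy (dy g) p) => x1 x2 x3 x4; ring.
Qed.

Lemma smooth_on_sub U (V : set (R * R)) f : V `<=` U -> smooth_on U f -> smooth_on V f.
Proof.
move=> VU sf k w wk; have [H1 H2] := sf k w wk; split=> [p /VU|wk' p /VU]; first exact: H1.
exact: H2.
Qed.

End SmoothLinear.

(** * The logarithmic potential *)

Section LogPotential.
Variable R : realType.
Implicit Types (z q : R * R).

Let s z : R := z.1 ^+ 2 + z.2 ^+ 2.

Lemma sqnorm_gt0 z : z <> (0, 0) -> 0 < z.1 ^+ 2 + z.2 ^+ 2.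
Proof.
move=> z0; rewrite lt_neqAle addr_ge0 ?sqr_ge0// andbT eq_sym.
rewrite paddr_eq0 ?sqr_ge0// !sqrf_eq0; apply/negP => /andP[/eqP a /eqP b].
by apply: z0; rewrite [z]surjective_pairing a b.
Qed.

(** log |z| without a square root, so that its derivatives are rational functions. *)
Definition lognorm z : R := ln (z.1 ^+ 2 + z.2 ^+ 2) / 2.

Lemma lognormE z : lognorm z = ln (Num.sqrt (z.1 ^+ 2 + z.2 ^+ 2)).
Proof.
rewrite /lognorm; set x := _ + _.
have x0 : 0 <= x by rewrite addr_ge0 ?sqr_ge0.
have := x0; rewrite le_eqVlt => /orP[/eqP<-|xp].
  (* At the origin both sides are 0 because [ln 0 = 0]. *)
  by rewrite sqrtr0 ln0// mul0r.
rewrite -[in LHS](sqr_sqrtr x0) lnXn ?sqrtr_gt0// -[_ *+ 2]mulr_natr.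
by rewrite mulfK.
Qed.

Let open_punctured : open [set z : R * R | z <> (0, 0)].
Proof.
rewrite (_ : [set z | _] = (fun z : R * R => (z.1 - 0) ^+ 2 + (z.2 - 0) ^+ 2) @^-1` [set x | 0 < x]).
  by apply: open_comp; [move=> z _; exact: (@continuous_sqdist _ (0, 0))|exact: open_gt].
apply/seteqP; split=> z /=; rewrite !subr0; first exact: sqnorm_gt0.
by move=> + z0; rewrite z0 /= expr0n /= addr0 ltxx.
Qed.

Lemma lognorm_derive z : z <> (0, 0) ->
  is_dx lognorm z (z.1 / (z.1 ^+ 2 + z.2 ^+ 2)) /\ is_dy lognorm z (z.2 / (z.1 ^+ 2 + z.2 ^+ 2)).
Proof.
move=> /sqnorm_gt0; case: z => x y /= s0.
have ld (x0 : R) : 0 < x0 -> der1 (@ln R) x0 x0^-1 by move=> h; exact: is_derive1_ln.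
split.
- eapply der_eq.
    apply derM; last exact: derC.
    apply: (@der_comp _ (@ln R) (fun t => t ^+ 2 + y ^+ 2)); first exact: ld.
    by der.
  by rewrite /=; field; rewrite gt_eqF.
- eapply der_eq.
    apply derM; last exact: derC.
    apply: (@der_comp _ (@ln R) (fun t => x ^+ 2 + t ^+ 2)); first exact: ld.
    by der.
  by rewrite /=; field; rewrite gt_eqF.
Qed.

Lemma lognorm_continuous z : z <> (0, 0) -> {for z, continuous lognorm}.
Proof.
move=> /sqnorm_gt0 s0; apply: cvgM; last exact: cvg_cst.
have c1 : {for z, continuous (fun z : R * R => z.1 ^+ 2 + z.2 ^+ 2)}.
  rewrite (_ : (fun z => _) = fun z : R * R => (z.1 - 0) ^+ 2 + (z.2 - 0) ^+ 2).
    exact: (@continuous_sqdist R (0, 0)).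
  by apply/funext => q /=; rewrite !subr0.
exact: (continuous_comp c1 (continuous_ln s0)).
Qed.

Let inv_derive n (a b : R) z : z <> (0, 0) ->
  is_dx (fun z => a * (invpow n z.1 z.2).1 + b * (invpow n z.1 z.2).2) z
    ((- n%:R * a) * (invpow n.+1 z.1 z.2).1 + (- n%:R * b) * (invpow n.+1 z.1 z.2).2) /\
  is_dy (fun z => a * (invpow n z.1 z.2).1 + b * (invpow n z.1 z.2).2) z
    ((- n%:R * b) * (invpow n.+1 z.1 z.2).1 + (n%:R * a) * (invpow n.+1 z.1 z.2).2).
Proof.
move=> /sqnorm_gt0; case: z => x y /= s0; have s1 : x ^+ 2 + y ^+ 2 != 0 by rewrite gt_eqF.
have [D1 D2] := @invpow_derive R n (fun t => t) (fun=> y) x 1 0 s1 (derI x) (derC y x).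
have [D3 D4] := @invpow_derive R n (fun=> x) (fun t => t) y 0 1 s1 (derC x y) (derI y).
split.
  eapply der_eq; first by apply derD; apply derM; [exact: derC|exact: D1|exact: derC|exact: D2].
  by rewrite /=; ring.
eapply der_eq; first by apply derD; apply derM; [exact: derC|exact: D3|exact: derC|exact: D4].
by rewrite /=; ring.
Qed.

Let partials_continuous f (fx fy : R * R -> R) : 
  (forall z, z <> (0, 0) -> is_dx f z (fx z) /\ is_dy f z (fy z)) ->
  (forall z, z <> (0, 0) -> exists M : R, \forall q \near z, `|fx q| <= M /\ `|fy q| <= M) ->
  forall z, z <> (0, 0) -> {for z, continuous f}.
Proof.
move=> fD fM z z0; have [M nM] := fM z z0.
apply: (@bounded_partials_continuous _ f fx fy z M).
have nz := open_nbhs_nbhs (conj open_punctured z0).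
by apply: filterS2 nz nM => q q0 [? ?]; have [? ?] := fD q q0.
Qed.

(** The gradient of log |z| is (Re (1/z), - Im (1/z)), and the combinations of Re z^-n and Im z^-n
    are closed under differentiation, so [smooth_class] applies. *)
Lemma lognorm_smooth : smooth_on [set z : R * R | z <> (0, 0)] lognorm.
Proof.
have lE z : z <> (0, 0) -> is_dx lognorm z (1 * (invpow 1 z.1 z.2).1 + 0 * (invpow 1 z.1 z.2).2) /\
   is_dy lognorm z (0 * (invpow 1 z.1 z.2).1 + (- 1) * (invpow 1 z.1 z.2).2).
  move=> z0; have [D1 D2] := lognorm_derive z0.
  by split; [apply: (der_eq D1)|apply: (der_eq D2)]; rewrite /=; ring.
apply: (@smooth_class _ _ (fun f => f = lognorm \/ exists n (a b : R),
  f = fun z => a * (invpow n z.1 z.2).1 + b * (invpow n z.1 z.2).2)).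
- exact: open_punctured.
- move=> f [->|[n [a [b ->]]]] z z0; first exact: lognorm_continuous.
  apply: (partials_continuous (@inv_derive n a b)) z0 => {}z z0.
  have s0 := sqnorm_gt0 z0.
  pose d := (z.1 ^+ 2 + z.2 ^+ 2) / 2.
  have d0 : 0 < d by rewrite divr_gt0.
  pose T := 1 + d^-1 ^+ n.+1.
  have T0 : 0 <= T by rewrite addr_ge0// exprn_ge0// invr_ge0 ltW.
  exists ((n%:R * `|a| + n%:R * `|b|) * T).
  have nd : \forall q \near z, d < q.1 ^+ 2 + q.2 ^+ 2.
    have := @continuous_sqdist R (0, 0) z [set x | d < x]; rewrite /= !subr0 => H.
    have : nbhs z [set q : R * R | d < (q.1 - 0) ^+ 2 + (q.2 - 0) ^+ 2].
      apply: H; apply: open_nbhs_nbhs; split; first exact: open_gt.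
      by rewrite /= /d ltr_pdivrMr// ltr_pMr// ltr1n.
    by apply: filterS => q /=; rewrite !subr0.
  apply: filterS nd => q /ltW dq; have [b1 b2] := invpow_le n.+1 d0 dq.
  split; apply: (le_trans (ler_normD _ _)); rewrite !normrM ?normrN normr_nat.
    by rewrite mulrDl lerD// ler_wpM2l// mulr_ge0.
  by rewrite addrC mulrDl lerD// ler_wpM2l// mulr_ge0.
- move=> f [->|[n [a [b ->]]]].
    exists (fun z => 1 * (invpow 1 z.1 z.2).1 + 0 * (invpow 1 z.1 z.2).2),
      (fun z => 0 * (invpow 1 z.1 z.2).1 + (- 1) * (invpow 1 z.1 z.2).2).
    by split; [right; exists 1, 1, 0|right; exists 1, 0, (- 1)|exact: lE].
  exists (fun z => (- n%:R * a) * (invpow n.+1 z.1 z.2).1 + (- n%:R * b) * (invpow n.+1 z.1 z.2).2),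
    (fun z => (- n%:R * b) * (invpow n.+1 z.1 z.2).1 + (n%:R * a) * (invpow n.+1 z.1 z.2).2).
  by split; [right; exists n.+1, (- n%:R * a), (- n%:R * b)|
    right; exists n.+1, (- n%:R * b), (n%:R * a)|exact: inv_derive].
- by left.
Qed.

Lemma lognorm_laplace z : z <> (0, 0) -> dx (dx lognorm) z + dy (dy lognorm) z = 0.
Proof.
move=> z0; have nz := open_nbhs_nbhs (conj open_punctured z0).
have E1 : dx (dx lognorm) z = dx (fun z => 1 * (invpow 1 z.1 z.2).1 + 0 * (invpow 1 z.1 z.2).2) z.
  apply: dx_near; apply: filterS nz => q /lognorm_derive[/is_dx_dx-> _] /=; ring.
have E2 : dy (dy lognorm) z = dy (fun z => 0 * (invpow 1 z.1 z.2).1 + (- 1) * (invpow 1 z.1 z.2).2) z.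
  apply: dy_near; apply: filterS nz => q /lognorm_derive[_ /is_dy_dy->] /=; ring.
rewrite E1 E2 (is_dx_dx (@inv_derive 1 1 0 z z0).1) (is_dy_dy (@inv_derive 1 0 (- 1) z z0).2).
by rewrite /=; ring.
Qed.

End LogPotential.

(** * A model function with a linear jump *)

Section SlitLog.
Variable R : realType.
Implicit Types (z q : R * R).

Let rad z : R := Num.sqrt (z.1 ^+ 2 + z.2 ^+ 2).

(* The angle in ]-pi, pi[ from the negative imaginary axis, by the half-angle formula. *)
Definition slit_angle z : R := 2 * atan (z.1 / (rad z - z.2)).

(* Up to a harmonic term, [Re (z log z)] with the cut along the positive imaginary axis. *)
Definition slit_log z : R := 2 / pi * (z.2 * slit_angle z - z.1 * lognorm z).

Let rad2 z : rad z ^+ 2 = z.1 ^+ 2 + z.2 ^+ 2.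
Proof. by rewrite sqr_sqrtr// addr_ge0 ?sqr_ge0. Qed.

Let rad_ge0 z : 0 <= rad z. Proof. exact: sqrtr_ge0. Qed.

Let slit_gap z : ~ (z.1 = 0 /\ 0 <= z.2) -> 0 < rad z - z.2.
Proof.
move=> nz; have r2 := rad2 z; have r0 := rad_ge0 z.
rewrite subr_gt0 ltNge; apply/negP => h; apply: nz.
have z20 : 0 <= z.2 by exact: le_trans h.
split => //; apply/eqP; rewrite -sqrf_eq0 eq_le sqr_ge0 andbT.
have : rad z ^+ 2 <= z.2 ^+ 2 by rewrite lerXn2r// nnegrE.
by lra.
Qed.

Let slit_neq0 z : ~ (z.1 = 0 /\ 0 <= z.2) -> z <> (0, 0).
Proof. by move=> nz z0; apply: nz; rewrite z0. Qed.

Let slit_near z : ~ (z.1 = 0 /\ 0 <= z.2) -> \forall q \near z, ~ (q.1 = 0 /\ 0 <= q.2).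
Proof.
move=> nz; have [z1|z1] := eqVneq z.1 0.
  have z2 : z.2 < 0 by rewrite ltNge; apply/negP => h; apply: nz.
  apply/nbhs2P; exists (- z.2); first by rewrite oppr_gt0.
  by move=> q _; rewrite ltr_norml => /andP[_ h] [_ h']; lra.
apply/nbhs2P; exists `|z.1|; first by rewrite normr_gt0.
by move=> q + _ [q1 _]; rewrite q1 sub0r normrN ltxx.
Qed.

Lemma slit_angle_derive z : ~ (z.1 = 0 /\ 0 <= z.2) ->
  is_dx slit_angle z (- z.2 / (z.1 ^+ 2 + z.2 ^+ 2)) /\
  is_dy slit_angle z (z.1 / (z.1 ^+ 2 + z.2 ^+ 2)).
Proof.
move=> nz; have g0 := slit_gap nz; have s0 := sqnorm_gt0 (slit_neq0 nz).
have r2 := rad2 z.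
have r0 : 0 < rad z by rewrite sqrtr_gt0.
case: z => x y in nz g0 s0 r2 r0 *; rewrite /= in s0 g0.
have rd (f : R -> R) (t l : R) : 0 < f t -> der1 f t l ->
    der1 (fun t => Num.sqrt (f t)) t (l / (2 * Num.sqrt (f t))).
  move=> f0 fl; rewrite mulrC; apply: (@der_comp _ (@Num.sqrt R) f) => //.
  exact: is_derive1_sqrt.
have ad (t : R) : der1 (@atan R) t (1 + t ^+ 2)^-1 by exact: is_derive1_atan.
have g0' : rad (x, y) - y != 0 by rewrite gt_eqF.
have r0' : rad (x, y) != 0 by rewrite gt_eqF.
have s0' : x ^+ 2 + y ^+ 2 != 0 by rewrite gt_eqF.
(* With r = |z| one has x^2 = (r - y) (r + y), so the derivative of [atan] at x / (r - y) becomes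
   linear in y over r. *)
have key : (1 + (x / (rad (x, y) - y)) ^+ 2)^-1 = (rad (x, y) - y) / (2 * rad (x, y)).
  have x2 : x ^+ 2 = (rad (x, y) - y) * (rad (x, y) + y) by rewrite -subr_sqr r2 /=; ring.
  have -> : 1 + (x / (rad (x, y) - y)) ^+ 2 = 2 * rad (x, y) / (rad (x, y) - y).
    by rewrite expr_div_n x2; field.
  by rewrite invf_div.
split.
- have D1 : der1 (fun t => rad (t, y)) x (x / rad (x, y)).
    eapply der_eq.
      by apply: (rd (fun t => t ^+ 2 + y ^+ 2)); [exact: s0|der].
    rewrite /= -[Num.sqrt _]/(rad (x, y)).
    by move: (rad (x, y)) r0' => r r0'; field.
  eapply der_eq.
    apply derM; first exact: derC.
    apply: (@der_comp _ (@atan R) (fun t => t / (rad (t, y) - y))); first exact: ad.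
    apply derM; first exact: derI.
    by apply derV; [exact: g0'|apply derD; [exact: D1|exact: derC]].
  rewrite /= key; rewrite /= in r2; rewrite -r2.
  move: (rad (x, y)) r2 g0' r0' => r r2 g0' r0'.
  have x2 : x * x = (r - y) * (r + y) by rewrite -subr_sqr r2; ring.
  have -> : 0 * atan (x / (r - y)) + 2 * ((r - y) / (2 * r) *
    (1 * (r - y)^-1 + x * (- (x / r + 0) / (r - y) ^+ 2))) =
    (r - y) / r * ((r - y)^-1 - (x * x) / (r * (r - y) ^+ 2)) by field; apply/andP.
  by rewrite x2; field; apply/andP.
- have D1 : der1 (fun t => rad (x, t)) y (y / rad (x, y)).
    eapply der_eq.
      by apply: (rd (fun t => x ^+ 2 + t ^+ 2)); [exact: s0|der].
    rewrite /= -[Num.sqrt _]/(rad (x, y)).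
    by move: (rad (x, y)) r0' => r r0'; field.
  eapply der_eq.
    apply derM; first exact: derC.
    apply: (@der_comp _ (@atan R) (fun t => x / (rad (x, t) - t))); first exact: ad.
    apply derM; first exact: derC.
    by apply derV; [exact: g0'|apply derD; [exact: D1|apply derN; exact: derI]].
  rewrite /= key; rewrite /= in r2; rewrite -r2.
  move: (rad (x, y)) r2 g0' r0' => r r2 g0' r0'.
  by field; apply/andP.
Qed.

Lemma slit_angle_le z : `|slit_angle z| <= pi.
Proof.
rewrite /slit_angle; move: (_ / _) => t; rewrite ler_norml.
by have := atan_gtNpi2 t; have := atan_ltpi2 t; move=> *; apply/andP; split; lra.
Qed.

(** The angle cancels from the u-derivative, which therefore extends continuously across the cut
    away from 0. In the v-derivative it is the logarithm that cancels. *)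
Lemma slit_log_derive z : ~ (z.1 = 0 /\ 0 <= z.2) ->
  is_dx slit_log z (- (2 / pi) * (1 + lognorm z)) /\
  is_dy slit_log z (2 / pi * slit_angle z).
Proof.
move=> nz; have [D1 D2] := slit_angle_derive nz.
have [D3 D4] := lognorm_derive (slit_neq0 nz).
have s0 := sqnorm_gt0 (slit_neq0 nz).
case: z => x y in nz D1 D2 D3 D4 s0 *; rewrite /is_dx /is_dy /= in D1 D2 D3 D4 s0 *.
have s0' : x ^+ 2 + y ^+ 2 != 0 by rewrite gt_eqF.
have pi0 : pi != 0 :> R by rewrite gt_eqF// pi_gt0.
split.
- eapply der_eq.
    apply derM; first exact: derC.
    apply derD; first by apply derM; [exact: derC|exact: D1].
    by apply derN; apply derM; [exact: derI|exact: D3].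
  rewrite /=; move: (lognorm (x, y)) (slit_angle (x, y)) (@pi R) pi0 => l a P pi0.
  by field; apply/andP.
- eapply der_eq.
    apply derM; first exact: derC.
    apply derD; first by apply derM; [exact: derI|exact: D2].
    by apply derN; apply derM; [exact: derC|exact: D4].
  rewrite /=; move: (lognorm (x, y)) (slit_angle (x, y)) (@pi R) pi0 => l a P pi0.
  by field; apply/andP.
Qed.

Lemma slit_log_continuous z : ~ (z.1 = 0 /\ 0 <= z.2) -> {for z, continuous slit_log}.
Proof.
move=> nz; have z0 := slit_neq0 nz.
have cL : {for z, continuous (fun q => - (2 / pi) * (1 + lognorm q))}.
  by apply: cvgM; [exact: cvg_cst|apply: cvgD; [exact: cvg_cst|exact: lognorm_continuous]].
move/continuous2P : cL => /(_ _ ltr01)[d d0 dP].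
pose M := Num.max (`|- (2 / pi) * (1 + lognorm z)| + 1) (2 / pi * pi).
apply: (@bounded_partials_continuous _ slit_log (fun q => - (2 / pi) * (1 + lognorm q))
  (fun q => 2 / pi * slit_angle q) z M).
have nd : \forall q \near z, `|- (2 / pi) * (1 + lognorm q) - (- (2 / pi) * (1 + lognorm z))| < 1.
  by apply/nbhs2P; exists d.
apply: filterS2 nd (slit_near nz) => q qd nq; have [D1 D2] := slit_log_derive nq.
split => //; rewrite /M le_max; apply/orP; [left|right].
  rewrite -[X in `|X| <= _](subrK (- (2 / pi) * (1 + lognorm z))) addrC.
  by apply: (le_trans (ler_normD _ _)); rewrite lerD2l ltW.
rewrite normrM ger0_norm ?divr_ge0 ?pi_ge0// ler_wpM2l ?divr_ge0 ?pi_ge0//.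
exact: slit_angle_le.
Qed.

Lemma atan_inv (x : R) : 0 < x -> atan x^-1 = pi / 2 - atan x.
Proof.
move=> x0; have a0 : 0 < atan x by rewrite -(atan0 R) lt_atan.
have ap := atan_ltpi2 x.
have E : tan (pi / 2 - atan x) = x^-1.
  rewrite /tan sinB cosB sin_pihalf cos_pihalf !mul1r !mul0r subr0 add0r.
  by rewrite -[X in _ = X^-1](atanK x) /tan invf_div.
rewrite -E tanK// in_itv/=; apply/andP; split; lra.
Qed.

(** The argument u / (r - v) blows up at the cut; its reciprocal is u / (r + v), which is regular
    there, and [atan_inv] exchanges the two. *)
Let slit_angle_right z : 0 < z.1 -> slit_angle z = pi - 2 * atan (z.1 / (rad z + z.2)).
Proof.
move=> z1; have nz : ~ (z.1 = 0 /\ 0 <= z.2) by case; lra.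
have g := slit_gap nz.
have e : (z.1 / (rad z + z.2)) = (z.1 / (rad z - z.2))^-1.
  have z12 : z.1 * z.1 = (rad z - z.2) * (rad z + z.2) by rewrite -subr_sqr rad2; ring.
  have h : rad z + z.2 != 0.
    by apply/eqP => h; move: z12; rewrite h mulr0 => /eqP; rewrite mulf_eq0 gt_eqF.
  have z1n : z.1 != 0 by rewrite gt_eqF.
  by apply: (mulIf h); rewrite divfK// invf_div mulrAC -z12 mulfK.
rewrite /slit_angle e atan_inv ?divr_gt0//.
by field.
Qed.

Let slit_angle_left z : z.1 < 0 -> slit_angle z = - pi - 2 * atan (z.1 / (rad z + z.2)).
Proof.
move=> z1; have := @slit_angle_right (- z.1, z.2).
have E : rad (- z.1, z.2) = rad z by rewrite /rad /= sqrrN.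
rewrite /slit_angle /= E oppr_gt0 => /(_ z1); rewrite !mulNr !atanN; lra.
Qed.

(** The angle tends to pi or -pi on the two sides of the cut, so the factor 2 / pi in [slit_log]
    normalizes the one-sided limits to 2 v and -2 v. The remainder [L2] is continuous across the cut
    and vanishes on it. *)
Lemma slit_log_ray (v0 e : R) : 0 < v0 -> 0 < e -> exists2 d : R, 0 < d & forall q, q.1 != 0 ->
  `|q.1| < d -> `|q.2 - v0| < d -> `|slit_log q - 2 * q.2 * Num.sg q.1| < e.
Proof.
move=> v0_gt0 e0.
pose L2 (q : R * R) := - (4 / pi) * q.2 * atan (q.1 / (rad q + q.2)) - 2 / pi * q.1 * lognorm q.
have pi0 : pi != 0 :> R by rewrite gt_eqF// pi_gt0.
have LE q : q.1 != 0 -> slit_log q - 2 * q.2 * Num.sg q.1 = L2 q.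
  move=> q1; rewrite /slit_log /L2; have [qn|qp|qe] := ltgtP q.1 0; last by rewrite qe eqxx in q1.
    rewrite (slit_angle_left qn) (ltr0_sg qn); move: (atan _) (lognorm _) (@pi R) pi0 => a l P pi0; by field.
  rewrite (slit_angle_right qp) (gtr0_sg qp); move: (atan _) (lognorm _) (@pi R) pi0 => a l P pi0; by field.
have c0 : {for (0, v0), continuous L2}.
  have c1 : {for (0, v0), continuous (fun q : R * R => q.1)} by exact: cvg_fst.
  have c2 : {for (0, v0), continuous (fun q : R * R => q.2)} by exact: cvg_snd.
  have z0 : (0, v0) <> (0, 0) :> R * R by case; lra.
  have cl := lognorm_continuous z0.
  have cr : {for (0, v0), continuous rad}.
    have cs : {for (0, v0), continuous (fun z : R * R => z.1 ^+ 2 + z.2 ^+ 2)}.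
      rewrite (_ : (fun z => _) = fun z : R * R => (z.1 - 0) ^+ 2 + (z.2 - 0) ^+ 2).
        exact: (@continuous_sqdist R (0, 0)).
      by apply/funext => q /=; rewrite !subr0.
    exact: (continuous_comp cs (@sqrt_continuous R _)).
  have ca : {for (0, v0), continuous (fun q : R * R => atan (q.1 / (rad q + q.2)))}.
    have cq : {for (0, v0), continuous (fun q : R * R => q.1 / (rad q + q.2))}.
      apply: cvgM; first exact: c1.
      apply: cvgV; last by apply: cvgD; [exact: cr|exact: c2].
      by rewrite gt_eqF// ltr_wpDl.
    exact: (continuous_comp cq (@continuous_atan R _)).
  apply: cvgB.
    by apply: cvgM; [apply: cvgM; [exact: cvg_cst|exact: c2]|exact: ca].
  by apply: cvgM; [apply: cvgM; [exact: cvg_cst|exact: c1]|exact: cl].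
have L20 : L2 (0, v0) = 0 by rewrite /L2 /= mul0r atan0 !mulr0 mul0r subr0.
move/continuous2P : c0 => /(_ e e0)[d d0 dP]; exists d => // q q1 h1 h2.
by rewrite LE//; have := dP q; rewrite L20 /= !subr0; exact.
Qed.

(** The only delicate term is r |log r|: it is bounded by log r <= r when the logarithm is
    nonnegative and by log (1 / r) <= 1 / r otherwise. *)
Lemma slit_log_bounded (S : R) : exists K : R, forall z, z <> (0, 0) ->
  z.1 ^+ 2 + z.2 ^+ 2 <= S -> `|slit_log z| <= K.
Proof.
have pi0 : 0 < pi :> R by exact: pi_gt0.
exists (2 / pi * ((1 + S) * pi + (1 + S))) => z z0 sS.
have s0 := sqnorm_gt0 z0.
have r0 : 0 < rad z by rewrite sqrtr_gt0.
have r2 := rad2 z.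
have le_rad (x : R) : x ^+ 2 <= rad z ^+ 2 -> `|x| <= rad z.
  by move=> h; rewrite -(@ler_pXn2r _ 2)// ?nnegrE// ?(ltW r0)// real_normK ?num_real.
have z1r : `|z.1| <= rad z by apply: le_rad; rewrite r2 lerDl sqr_ge0.
have z2r : `|z.2| <= rad z by apply: le_rad; rewrite r2 lerDr sqr_ge0.
have rS : rad z <= 1 + S.
  have sq1 : 0 <= (rad z - 1) ^+ 2 by exact: sqr_ge0.
  rewrite (_ : _ ^+ 2 = rad z ^+ 2 - 2 * rad z + 1) in sq1; last by ring.
  by rewrite r2 in sq1; lra.
have aB := slit_angle_le z.
have lB : rad z * `|lognorm z| <= 1 + S.
  rewrite lognormE -/(rad z); have [l0|l0] := leP 0 (ln (rad z)).
    rewrite ger0_norm//; apply: (@le_trans _ _ (rad z * rad z)).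
      by rewrite ler_wpM2l ?(ltW r0)// ltW// ln_sublinear.
    by rewrite -expr2 r2; lra.
  rewrite ltr0_norm// -lnV// mulrC; apply: (@le_trans _ _ ((rad z)^-1 * rad z)).
    by rewrite ler_wpM2r ?(ltW r0)// ltW// ln_sublinear// invr_gt0.
  by rewrite mulVf ?gt_eqF//; have := s0; lra.
rewrite normrM ger0_norm ?divr_ge0 ?(ltW pi0)// ler_wpM2l ?divr_ge0 ?(ltW pi0)//.
apply: (le_trans (ler_normB _ _)); rewrite (normrM z.2) (normrM z.1) lerD//.
  by apply: ler_pM => //; exact: (le_trans z2r rS).
by apply: le_trans lB; rewrite ler_wpM2r.
Qed.

End SlitLog.

Lemma continuous_eq0 (R : realType) (V : set (R * R)) (f : R * R -> R) (z : R * R) :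
  open V -> V z -> z.1 = 0 -> {for z, continuous f} ->
  (forall q, V q -> q.1 != 0 -> f q = 0) -> f z = 0.
Proof.
move=> oV Vz z1 /continuous2P cf f0.
apply/eqP; rewrite -normr_le0; apply/ler_addgt0Pl => e e0; rewrite addr0.
have [d d0 dP] := cf e e0.
have /nbhs2P[d' d'0 d'P] : nbhs z V by exact: open_nbhs_nbhs.
pose h := Num.min d d' / 2.
have h0 : 0 < h by rewrite divr_gt0// lt_min d0.
have : h < Num.min d d' by rewrite /h ltr_pdivrMr// ltr_pMr ?ltr1n// lt_min d0.
rewrite lt_min => /andP[hd hd'].
have Vh : V (h, z.2).
  by apply: d'P => /=; rewrite ?subrr ?normr0// z1 subr0 gtr0_norm.
have := dP (h, z.2); rewrite /= z1 subr0 subrr normr0 gtr0_norm// => /(_ hd d0).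
by rewrite f0//= ?gt_eqF// sub0r normrN => /ltW.
Qed.

(** * Removal of the jump and extension across the slit *)

Section SlitHarmonic.
Variable R : realType.
Variables (U : set (R * R)) (m mv gam : R * R -> R).
Let ray (q : R * R) := q.1 = 0 /\ 0 <= q.2.
Hypothesis oU : open U.
Hypothesis U0 : U (0, 0).
Hypothesis mD : forall q, U q -> ~ ray q ->
  exists l1 l2 : R, [/\ is_dx m q (gam q) /\ is_dy m q (mv q), is_dx gam q l1, is_dy mv q l2
    & l1 + l2 = 0].
Hypothesis cm : forall q, U q -> ~ ray q -> {for q, continuous m}.
Hypothesis cgam : forall q, U q -> q <> (0, 0) -> {for q, continuous gam}.
Hypothesis mK : forall q, U q -> ~ ray q -> `|m q| <= 1.
Variables (k : R) (N : R -> R).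
Hypothesis jump : forall v0, 0 < v0 -> U (0, v0) ->
  {for v0, continuous N} /\
  forall e : R, 0 < e -> exists2 d : R, 0 < d & forall q, q.1 != 0 ->
    `|q.1| < d -> `|q.2 - v0| < d -> `|m q - 2 * k * q.2 * Num.sg q.1 - N v0| < e.

(** The part of [m] without jump, completed on the ray by the common one-sided limit. *)
Let P (q : R * R) : R := if (q.1 == 0) && (0 <= q.2) then N q.2 else m q - k * slit_log q.

Let PE q : ~ ray q -> P q = m q - k * slit_log q.
Proof.
by move=> nq; rewrite /P; case: ifP => // /andP[/eqP q1 q2]; exfalso; apply: nq.
Qed.

Let not_ray_near q : ~ ray q -> \forall z \near q, ~ ray z.
Proof.
move=> nz; have [z1|z1] := eqVneq q.1 0.
  have z2 : q.2 < 0 by rewrite ltNge; apply/negP => h; apply: nz.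
  apply/nbhs2P; exists (- q.2); first by rewrite oppr_gt0.
  by move=> z _; rewrite ltr_norml => /andP[_ h] [_ h']; lra.
apply/nbhs2P; exists `|q.1|; first by rewrite normr_gt0.
by move=> z + _ [z10 _]; rewrite z10 sub0r normrN ltxx.
Qed.

Let neq0_ray q : ray q -> q <> (0, 0) -> 0 < q.2.
Proof.
move=> [q1 q2] q0; rewrite lt_neqAle q2 andbT; apply/eqP => e.
by apply: q0; rewrite [q]surjective_pairing q1 -e.
Qed.

(** On either side of the ray [m] and [k * slit_log] have the same jump term 2 k v sgn u, which
    cancels and leaves [N]. *)
Let P_continuous q : U q -> q <> (0, 0) -> {for q, continuous P}.
Proof.
move=> Uq q0; have [[q1 q2]|nq] := pselect (ray q); last first.
  apply: (@near_continuous2 _ (fun z => m z - k * slit_log z)).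
    by apply: filterS (not_ray_near nq) => z nz; rewrite PE.
  apply: cvgB; first exact: cm.
  apply: cvgM; first exact: cvg_cst.
  exact: slit_log_continuous.
have v0 := neq0_ray (conj q1 q2) q0.
have Uv : U (0, q.2) by rewrite -q1 -surjective_pairing.
have [cN jN] := jump v0 Uv.
apply/continuous2P => e e0.
have Pq : P q = N q.2 by rewrite /P q1 eqxx q2.
have e30 : 0 < e / 2 by rewrite divr_gt0.
have [d d0 dP] := jN _ e30.
pose e' := e / 2 / (`|k| + 1).
have k1 : 0 < `|k| + 1 by rewrite ltr_wpDl.
have e'0 : 0 < e' by rewrite divr_gt0.
have [d1 d10 d1P] := slit_log_ray v0 e'0.
move/continuous1P : cN => /(_ _ e0)[d2 d20 d2P].
exists (Num.min (Num.min d d1) (Num.min d2 q.2)); first by rewrite !lt_min d0 d10 d20.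
move=> z; rewrite q1 subr0 !lt_min => /andP[/andP[a1 a2] _] /andP[/andP[b1 b2] /andP[b3 b4]].
have z2 : 0 < z.2 by move: b4; rewrite ltr_norml => /andP[]; lra.
rewrite Pq /P; case: eqVneq => [z1|z1] /=; first by rewrite (ltW z2); exact: d2P.
have -> : m z - k * slit_log z - N q.2 = (m z - 2 * k * z.2 * Num.sg z.1 - N q.2) +
  - (k * (slit_log z - 2 * z.2 * Num.sg z.1)) by ring.
rewrite [ltRHS](splitr e); apply: (le_lt_trans (ler_normD _ _)); apply: ltr_leD; first exact: dP.
rewrite normrN normrM; have := ltW (d1P z z1 a2 b2).
move/(ler_wpM2l (normr_ge0 k))/le_trans; apply.
rewrite /e' mulrCA ler_piMr ?(ltW e30)// ler_pdivrMr// mul1r; lra.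
Qed.

(** Off the ray |m| <= 1 and [slit_log] is bounded. A point of the ray is compared with one just to
    its right; hence the enlarged radius [S + 1] and the last [+ 1] of the bound. *)
Let P_bounded (S : R) : exists M : R, forall q, U q -> q <> (0, 0) ->
  q.1 ^+ 2 + q.2 ^+ 2 <= S -> `|P q| <= M.
Proof.
have [K KP] := @slit_log_bounded R (S + 1).
have off q : U q -> q <> (0, 0) -> ~ ray q -> q.1 ^+ 2 + q.2 ^+ 2 <= S + 1 ->
    `|P q| <= 1 + `|k| * K.
  move=> Uq q0 nq qS; rewrite PE//.
  apply: (le_trans (ler_normB _ _)); rewrite lerD ?mK// normrM ler_wpM2l//.
  exact: KP.
exists (1 + `|k| * K + 1) => q Uq q0 qS.
have [rq|nq] := pselect (ray q); last first.
  by apply: (@le_trans _ _ (1 + `|k| * K)); [apply: off => //|]; rewrite ?lerDl//; lra.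
have /continuous2P/(_ _ (@ltr01 R))[d1 d10 d1P] := P_continuous Uq q0.
have /continuous2P/(_ _ (@ltr01 R))[d2 d20 d2P] := @continuous_sqnorm R q.
have /nbhs2P[d3 d30 d3P] : nbhs q U by exact: open_nbhs_nbhs.
pose h := Num.min d1 (Num.min d2 d3) / 2.
have h0 : 0 < h by rewrite divr_gt0// !lt_min d10 d20.
have : h < Num.min d1 (Num.min d2 d3).
  by rewrite /h ltr_pdivrMr// ltr_pMr ?ltr1n// !lt_min d10 d20.
rewrite !lt_min => /and3P[h1 h2 h3].
have n1 : `|(q.1 + h, q.2).1 - q.1| = h by rewrite /= addrAC subrr add0r gtr0_norm.
have n2 (d : R) : 0 < d -> `|(q.1 + h, q.2).2 - q.2| < d by rewrite /= subrr normr0.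
have Pz := d1P _ (eq_ind_r (fun x => x < d1) h1 n1) (n2 _ d10).
have sz := d2P _ (eq_ind_r (fun x => x < d2) h2 n1) (n2 _ d20).
have Uz := d3P _ (eq_ind_r (fun x => x < d3) h3 n1) (n2 _ d30).
case: rq => q1 _.
have z0 : (q.1 + h, q.2) <> (0, 0) by move=> /(congr1 fst)/= /eqP; rewrite q1 add0r gt_eqF.
have zr : ~ ray (q.1 + h, q.2) by rewrite /ray /= q1 add0r => -[/eqP]; rewrite gt_eqF.
have zS : (q.1 + h, q.2).1 ^+ 2 + (q.1 + h, q.2).2 ^+ 2 <= S + 1.
  by move: sz; rewrite ltr_norml => /andP[_]; lra.
have bz := off _ Uz z0 zr zS.
have -> : P q = P (q.1 + h, q.2) + (P q - P (q.1 + h, q.2)) by ring.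
apply: (le_trans (ler_normD _ _)); apply: lerD; first exact: bz.
by rewrite distrC; exact: ltW Pz.
Qed.

(** The u-derivative of [P] off the line u = 0, in a form that is also continuous at the points of
    the ray other than 0. *)
Let Px (q : R * R) := gam q + k * (2 / pi) * (1 + lognorm q).

Let P_derive q : U q -> q.1 != 0 -> exists l1 l2 : R,
  [/\ is_dx P q (Px q), is_dy P q (mv q - k * (2 / pi * slit_angle q)),
      is_dx Px q l1, is_dy (fun z => mv z - k * (2 / pi * slit_angle z)) q l2 & l1 + l2 = 0].
Proof.
move=> Uq q1; have nq : ~ ray q by case; move/eqP: q1.
have q0 : q <> (0, 0) by move=> e; rewrite e eqxx in q1.
have nE : \forall z \near q, m z - k * slit_log z = P z.
  by apply: filterS (not_ray_near nq) => z nz; rewrite PE.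
have [l1 [l2 [[D1 D2] D3 D4 l12]]] := mD Uq nq.
have [D5 D6] := slit_log_derive nq; have [D7 D8] := lognorm_derive q0.
have [D9 D10] := slit_angle_derive nq.
exists (l1 + k * (2 / pi) * (q.1 / (q.1 ^+ 2 + q.2 ^+ 2))),
  (l2 - k * (2 / pi * (q.1 / (q.1 ^+ 2 + q.2 ^+ 2)))); split.
- apply: near_is_dx nE _.
  eapply der_eq.
    by apply derD; [exact: D1|apply derN; apply derM; [exact: derC|exact: D5]].
  by rewrite /Px; move: (gam q) (lognorm q) (slit_log _) (2 / pi) => g l s p; ring.
- apply: near_is_dy nE _.
  eapply der_eq.
    by apply derD; [exact: D2|apply derN; apply derM; [exact: derC|exact: D6]].
  by move: (mv q) (slit_angle q) (slit_log _) (2 / pi) => g l s p; ring.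
- eapply der_eq.
    by apply derD; [exact: D3|apply derM; [exact: derC|apply derD; [exact: derC|exact: D7]]].
  by rewrite /=; move: (lognorm _) (2 / pi) => l p; ring.
- eapply der_eq.
    apply derD; [exact: D4|apply derN; apply derM; [exact: derC|]].
    by apply derM; [exact: derC|exact: D10].
  by rewrite /=; move: (slit_angle _) (2 / pi) => l p; ring.
- by move: (2 / pi) => p; lra.
Qed.

(** The maximum principle for [P - H] and [H - P], chosen by the sign [sg]. Set to 0 on the circle,
    the difference is continuous up to the boundary because [H] takes the boundary values [P]. *)
Let P_discE (c : R * R) (r : R) (H : R * R -> R) : 0 < r ->
  (forall z, (z.1 - c.1) ^+ 2 + (z.2 - c.2) ^+ 2 <= r ^+ 2 -> U z) ->
  c.1 ^+ 2 + c.2 ^+ 2 != r ^+ 2 ->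
  smooth_on (disc c r) H ->
  (forall z, disc c r z -> dx (dx H) z + dy (dy H) z = 0) ->
  (exists M : R, forall z, disc c r z -> `|H z| <= M) ->
  (forall z0 (e : R), (z0.1 - c.1) ^+ 2 + (z0.2 - c.2) ^+ 2 = r ^+ 2 -> 0 < e ->
    \forall z \near z0, disc c r z -> `|H z - P z0| < e) ->
  forall (sg : R), `|sg| = 1 -> forall z, disc c r z -> z <> (0, 0) -> sg * (P z - H z) <= 0.
Proof.
move=> r0 cU c0 sH hH [MH HM] bH sg sg1 z' zd' z0'.
pose D z := (z.1 - c.1) ^+ 2 + (z.2 - c.2) ^+ 2.
pose E z := if D z < r ^+ 2 then sg * (P z - H z) else 0.
have ED z : disc c r z -> E z = sg * (P z - H z) by rewrite /E /D /disc /= => ->.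
have EC z : D z = r ^+ 2 -> E z = 0 by rewrite /E => ->; rewrite ltxx.
have oD := @open_disc R c r.
have nD z : disc c r z -> \forall q \near z, disc c r q.
  by move=> zd; exact: open_nbhs_nbhs (conj oD zd).
have cH z : disc c r z -> {for z, continuous H}.
  by move=> zd; exact: (@smooth_continuous _ H _ [::] z sH zd).
have [MP PM] := P_bounded (2 * (c.1 ^+ 2 + c.2 ^+ 2) + 2 * r ^+ 2).
have sS z : D z <= r ^+ 2 -> z.1 ^+ 2 + z.2 ^+ 2 <= 2 * (c.1 ^+ 2 + c.2 ^+ 2) + 2 * r ^+ 2.
  move=> zc; rewrite -subr_ge0.
  have -> : 2 * (c.1 ^+ 2 + c.2 ^+ 2) + 2 * r ^+ 2 - (z.1 ^+ 2 + z.2 ^+ 2) =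
     (2 * c.1 - z.1) ^+ 2 + (2 * c.2 - z.2) ^+ 2 + 2 * (r ^+ 2 - D z) by rewrite /D; ring.
  by rewrite !addr_ge0 ?sqr_ge0// mulr_ge0// subr_ge0.
pose Q z := mv z - k * (2 / pi * slit_angle z).
rewrite -ED//.
move: z' zd' z0'; apply: (@punctured_max_principle R c r (MP + MH) E (fun z => sg * (Px z - dx H z))
  (fun z => sg * (Q z - dy H z)) (fun z => sg * (dx Px z - dx (dx H) z))
  (fun z => sg * (dy Q z - dy (dy H) z)) r0) => [z zc z0|z zc z0|z zc z0 e e0|z zd z1|z zd z1 z2].
- have MP0 : 0 <= MP by apply: le_trans (PM z (cU z zc) z0 (sS z zc)).
  have MH0 : 0 <= MH.
    have cd : disc c r c by rewrite /disc /= !subrr expr0n addr0 exprn_gt0.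
    exact: le_trans (HM c cd).
  have [zd|nd] := ltP (D z) (r ^+ 2); last by rewrite /E ltNge nd/= addr_ge0.
  rewrite ED//; apply: (le_trans (ler_norm _)); rewrite normrM sg1 mul1r.
  apply: (le_trans (ler_normB _ _)); apply: lerD; last exact: HM.
  exact: (PM z (cU z zc) z0 (sS z zc)).
- by rewrite EC.
- have cP := P_continuous (cU z zc) z0.
  have [zd|nd] := ltP (D z) (r ^+ 2).
    have cE : {for z, continuous E}.
      apply: (@near_continuous2 _ (fun z => sg * (P z - H z))).
        by apply: filterS (nD z zd) => q qd; rewrite ED.
      by apply: cvgM; [exact: cvg_cst|apply: cvgB; [exact: cP|exact: cH]].
    by move/continuous2P : cE => /(_ e e0)[d d0 dP]; exists d => // q _; exact: dP.
  have zr : D z = r ^+ 2 by apply/eqP; rewrite eq_le nd andbT.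
  have e20 : 0 < e / 2 by rewrite divr_gt0.
  move/continuous2P : cP => /(_ _ e20)[d d0 dP].
  have /nbhs2P[d' d'0 d'P] := bH z _ zr e20.
  exists (Num.min d d'); first by rewrite lt_min d0.
  move=> q qc; rewrite !lt_min => /andP[a1 a2] /andP[b1 b2].
  rewrite (EC z zr) subr0; have [qd|nq] := ltP (D q) (r ^+ 2); last first.
    by rewrite (_ : E q = 0) ?normr0// /E ltNge nq.
  rewrite ED// normrM sg1 mul1r.
  have -> : P q - H q = (P q - P z) - (H q - P z) by ring.
  rewrite [ltRHS](splitr e); apply: (le_lt_trans (ler_normB _ _)).
  by apply: ltrD; [exact: dP|exact: d'P].
- have Uz := cU z (ltW zd).
  have [l1 [l2 [D1 D2 D3 D4 l12]]] := P_derive Uz z1.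
  have nE : \forall q \near z, sg * (P q - H q) = E q.
    by apply: filterS (nD z zd) => q qd; rewrite ED.
  have H1 := @smooth_is_dx _ H _ [::] z sH zd; have H2 := @smooth_is_dy _ H _ [::] z sH zd.
  have H3 := @smooth_is_dx _ H _ [:: false] z sH zd; have H4 := @smooth_is_dy _ H _ [:: true] z sH zd.
  split.
  + apply: near_is_dx nE _; eapply der_eq.
      by apply derM; [exact: derC|apply derD; [exact: D1|apply derN; exact: H1]].
    by rewrite mul0r add0r.
  + apply: near_is_dy nE _; eapply der_eq.
      by apply derM; [exact: derC|apply derD; [exact: D2|apply derN; exact: H2]].
    by rewrite mul0r add0r.
  + eapply der_eq.
      by apply derM; [exact: derC|apply derD; [exact: D3|apply derN; exact: H3]].
    by rewrite mul0r add0r (is_dx_dx D3).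
  + eapply der_eq.
      by apply derM; [exact: derC|apply derD; [exact: D4|apply derN; exact: H4]].
    by rewrite mul0r add0r (is_dy_dy D4).
  + rewrite (is_dx_dx D3) (is_dy_dy D4) -mulrDr.
    have := hH z zd; move: (dx (dx H) z) (dy (dy H) z) => a b ab.
    by rewrite addrACA l12 -opprD ab subrr mulr0.
- have Uz := cU z (ltW zd).
  have z0 : z <> (0, 0) by move=> e; rewrite e eqxx in z2.
  apply: cvgM; first exact: cvg_cst.
  apply: cvgB; last exact: (@smooth_continuous _ H _ [:: false] z sH zd).
  apply: cvgD; first exact: cgam.
  apply: cvgM; first exact: cvg_cst.
  by apply: cvgD; [exact: cvg_cst|exact: lognorm_continuous].
Qed.

(** On a disc whose circle avoids the origin, [P] is its Poisson integral H. Differentiating in u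
    gives [gam + k (2 / pi) (1 + log |z|) = H_u], off the line u = 0 and then on it by continuity,
    so K is H_u - 2 k / pi. *)
Let local_rep (c : R * R) (r : R) : 0 < r ->
  (forall z, (z.1 - c.1) ^+ 2 + (z.2 - c.2) ^+ 2 <= r ^+ 2 -> U z) ->
  c.1 ^+ 2 + c.2 ^+ 2 != r ^+ 2 ->
  exists K : R * R -> R, [/\ smooth_on (disc c r) K,
    forall z, disc c r z -> dx (dx K) z + dy (dy K) z = 0 &
    forall z, disc c r z -> z <> (0, 0) -> gam z = - (2 * k / pi) * lognorm z + K z].
Proof.
move=> r0 cU c0.
have circle0 z : (z.1 - c.1) ^+ 2 + (z.2 - c.2) ^+ 2 = r ^+ 2 -> z <> (0, 0).
  by move=> + z0; rewrite z0 /= !sub0r !sqrrN => e; rewrite e eqxx in c0.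
have cP t : {for (c.1 + r * cos t, c.2 + r * sin t), continuous P}.
  have e : ((c.1 + r * cos t, c.2 + r * sin t).1 - c.1) ^+ 2 +
      ((c.1 + r * cos t, c.2 + r * sin t).2 - c.2) ^+ 2 = r ^+ 2.
    have -> : r ^+ 2 = r ^+ 2 * (cos t ^+ 2 + sin t ^+ 2) by rewrite cos2Dsin2 mulr1.
    by rewrite /=; ring.
  by apply: P_continuous; [apply: cU; rewrite e|exact: circle0].
pose H := poisson c r P.
have [sH hH] := poisson_smooth_harmonic r0 cP.
have bH : exists M : R, forall z, disc c r z -> `|H z| <= M by exact: poisson_bounded.
have boH z0 (e : R) : (z0.1 - c.1) ^+ 2 + (z0.2 - c.2) ^+ 2 = r ^+ 2 -> 0 < e ->
    \forall z \near z0, disc c r z -> `|H z - P z0| < e.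
  move=> zr e0; apply: poisson_boundary => //.
  by apply: P_continuous; [apply: cU; rewrite zr|exact: circle0].
have PH z : disc c r z -> z <> (0, 0) -> P z = H z.
  move=> zd z0; apply/eqP; rewrite -subr_eq0 eq_le; apply/andP; split.
    by have := @P_discE c r H r0 cU c0 sH hH bH boH 1 (normr1 _) z zd z0; rewrite mul1r.
  have := @P_discE c r H r0 cU c0 sH hH bH boH (- 1) _ z zd z0.
  by rewrite mulN1r oppr_le0 normrN normr1; exact.
have oD := @open_disc R c r.
pose b : R := - (k * (2 / pi)).
exists (fun z => 1 * dx H z + b * (fun=> 1 : R) z); split.
- exact: (smooth_lin _ _ oD (smooth_dx sH) (smooth_cst 1 oD)).
- move=> z zd; have e1 := smooth_harmonic_dx oD sH hH zd.
  apply: etrans (laplace_lin 1 b oD (smooth_dx sH) (smooth_cst 1 oD) zd) _.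
  apply: etrans (f_equal2 (fun x y => 1 * x + b * y) e1 (laplace_cst 1 z)) _.
  by rewrite !mulr0 addr0.
move=> z zd z0.
have main q : disc c r q -> q.1 != 0 -> Px q = dx H q.
  move=> qd q1; have [l1 [l2 [D1 _ _ _ _]]] := P_derive (cU q (ltW qd)) q1.
  apply/esym/is_dx_dx; apply: near_is_dx D1.
  have nq1 : \forall p \near q, p.1 != 0.
    apply/nbhs2P; exists `|q.1|; first by rewrite normr_gt0.
    by move=> p p1 _; apply/eqP => p10; rewrite p10 sub0r normrN ltxx in p1.
  apply: filterS2 nq1 (open_nbhs_nbhs (conj oD qd)) => p p1 pd.
  by apply: PH => // p0; rewrite p0 eqxx in p1.
have PxE : Px z = dx H z.
  have [z1|z1] := eqVneq z.1 0; last exact: main.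
  have cD : {for z, continuous (fun q => Px q - dx H q)}.
    apply: cvgB; last exact: (@smooth_continuous _ H _ [:: false] z sH zd).
    apply: cvgD; first exact: cgam (cU z (ltW zd)) z0.
    apply: cvgM; first exact: cvg_cst.
    by apply: cvgD; [exact: cvg_cst|exact: lognorm_continuous].
  apply/eqP; rewrite -subr_eq0; apply/eqP.
  apply: (continuous_eq0 oD zd z1 cD) => q qd q1.
  by apply/eqP; rewrite subr_eq0; apply/eqP; exact: main.
rewrite mul1r mulr1 -PxE /Px /b; move: (lognorm z) (gam z) => l g.
by move: (@pi R) (gt_eqF (@pi_gt0 R)) => p p0; field; rewrite p0.
Qed.

(** Around the origin any small radius does; around another centre the radius is at most half the
    distance to the origin. In both cases the circle misses the origin. *)
Let small_disc (c : R * R) : U c -> exists r : R, [/\ 0 < r,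
  forall z, (z.1 - c.1) ^+ 2 + (z.2 - c.2) ^+ 2 <= r ^+ 2 -> U z,
  c.1 ^+ 2 + c.2 ^+ 2 != r ^+ 2 & c <> (0, 0) -> ~ disc c r (0, 0)].
Proof.
move=> Uc; have /nbhs2P[e e0 eU] : nbhs c U by exact: open_nbhs_nbhs.
pose s := Num.sqrt (c.1 ^+ 2 + c.2 ^+ 2).
have s2 : s ^+ 2 = c.1 ^+ 2 + c.2 ^+ 2 by rewrite sqr_sqrtr// addr_ge0 ?sqr_ge0.
pose r := if s == 0 then e / 2 else Num.min (e / 2) (s / 2).
have s0 : 0 <= s by exact: sqrtr_ge0.
have e20 : 0 < e / 2 by rewrite divr_gt0.
have r0 : 0 < r.
  by rewrite /r; case: eqVneq => // sn; rewrite lt_min e20 divr_gt0// lt_neqAle eq_sym sn.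
have re : r < e.
  have h : e / 2 < e by rewrite ltr_pdivrMr// ltr_pMr ?ltr1n.
  by rewrite /r; case: eqVneq => // sn; rewrite gt_min h.
have rs : s != 0 -> r < s.
  rewrite /r => /[dup] sn /negbTE->; have sp : 0 < s by rewrite lt_neqAle eq_sym sn.
  by rewrite gt_min [s / 2 < s]ltr_pdivrMr// ltr_pMr// ltr1n orbT.
exists r; split => //.
- move=> z zc; have bd (x y : R) : 0 <= y -> x ^+ 2 + y <= r ^+ 2 -> `|x| < e.
    move=> y0 h; apply: le_lt_trans re; rewrite -(@ler_pXn2r _ 2)// ?nnegrE ?(ltW r0)//.
    by rewrite real_normK ?num_real//; lra.
  apply: eU; first exact: bd (sqr_ge0 _) zc.
  by rewrite addrC in zc; exact: bd (sqr_ge0 _) zc.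
- rewrite -s2; have [->|sn] := eqVneq s 0; first by rewrite expr0n /= eq_sym expf_neq0// gt_eqF.
  by rewrite gt_eqF// ltr_pXn2r// ?nnegrE ?(ltW r0)//; exact: rs.
- move=> cn; rewrite /disc /= !sub0r !sqrrN -s2; apply/negP; rewrite -leNgt.
  have sn : s != 0.
    apply/eqP => s00; have := sqnorm_gt0 cn; rewrite -s2 s00 expr0n /= ltxx //.
  by rewrite lerXn2r ?nnegrE ?(ltW r0)// ltW// rs.
Qed.

Lemma slit_harmonic : exists h : R * R -> R, [/\ smooth_on U h,
    forall p, U p -> dx (dx h) p + dy (dy h) p = 0 &
    forall q, U q -> q <> (0, 0) -> gam q = - (2 * k / pi) * lognorm q + h q].
Proof.
have [r0 [r00 r0U r0n _]] := small_disc U0.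
have [K0 [sK0 hK0 gK0]] := local_rep r00 r0U r0n.
(* Away from 0 the formula determines [h], so the local representations agree there; at 0 the value
   comes from the disc centred at the origin. *)
pose h z := if z == (0, 0) then K0 (0, 0) else gam z + (2 * k / pi) * lognorm z.
have d0 : disc (0, 0) r0 (0, 0) by rewrite /disc /= !subrr expr0n addr0 exprn_gt0.
have loc p : U p -> exists K (V : set (R * R)), [/\ open V, V p, smooth_on V K,
    forall z, V z -> dx (dx K) z + dy (dy K) z = 0 & forall z, V z -> h z = K z].
  move=> Up; have [->|pn] := eqVneq p (0, 0).
    exists K0, (disc (0, 0) r0); split => //; first exact: open_disc.
    move=> z zd; rewrite /h; case: eqVneq => [->//|/eqP zn].
    by rewrite (gK0 z zd zn); ring.
  have [r [rp rU rn rd]] := small_disc Up.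
  have [K [sK hK gK]] := local_rep rp rU rn.
  exists K, (disc p r); split => //; first exact: open_disc.
    by rewrite /disc /= !subrr expr0n addr0 exprn_gt0.
  move=> z zd; have zn : z <> (0, 0) by move=> e; rewrite e in zd; exact: rd (elimN eqP pn) zd.
  by rewrite /h (introF eqP zn) (gK z zd zn); ring.
exists h; split.
- apply: near_smooth_on => p /loc[K [V [oV Vp sK hK E]]]; exists K, V.
  have nV := open_nbhs_nbhs (conj oV Vp).
  by split; [exact: sK|exact: Vp|apply: filterS nV => z; exact: E].
- move=> p /loc[K [V [oV Vp sK hK E]]].
  have nE : \forall q \near p, \forall z \near q, h z = K z.
    apply: filterS (open_nbhs_nbhs (conj oV Vp)) => q Vq.
    by apply: filterS (open_nbhs_nbhs (conj oV Vq)) => z; exact: E.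
  rewrite (@dx_near _ (dx h) (dx K)); last by apply: filterS nE => q; exact: dx_near.
  rewrite (@dy_near _ (dy h) (dy K)); last by apply: filterS nE => q; exact: dy_near.
  exact: hK.
- by move=> q Uq qn; rewrite /h (introF eqP qn); move: (gam q) (lognorm q) (2 * k / pi) => a b d; ring.
Qed.

End SlitHarmonic.

(** * The quadrilaterals *)

Section Geometry.
Variable R : realType.
Implicit Types (p q : R * R).

(** [Omega] is a kite symmetric about the diagonal. In the coordinates u = x - y and w = x + y its
    lower edges are w = |u| - 1 and its upper edges w = 1 - 5 |u|. *)
Lemma OmegaE p : Omega p <-> `|p.1 - p.2| - 1 <= p.1 + p.2 <= 1 - 5 * `|p.1 - p.2|.
Proof.
split=> [[t1 [t2 [t3 [t4 [[t1_ge0 t2_ge0 t3_ge0 t4_ge0] [ts [-> ->]]]]]]]|] /=.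
  by have [h|h] := ger0P (t1 * - (1 / 2) + t2 * - (1 / 6) + t3 * (1 / 2) + t4 * - (1 / 2) -
    (t1 * - (1 / 2) + t2 * - (1 / 2) + t3 * (1 / 2) + t4 * - (1 / 6)));
    apply/andP; split; lra.
case: p => x y /=; have [h|h] := ger0P (x - y) => /andP[h1 h2].
(* The diagonal cuts the kite into two triangles; these are barycentric coordinates in the one with
   u >= 0, the fourth vertex having weight 0. *)
- exists ((1 - 5 * (x - y) - (x + y)) / 2), (3 * (x - y)), ((1 - (x - y) + (x + y)) / 2), 0.
  by split; [split; lra|split; [lra|split => /=; lra]].
- exists ((1 + 5 * (x - y) - (x + y)) / 2), 0, ((1 + (x - y) + (x + y)) / 2), (- 3 * (x - y)).
  by split; [split; lra|split; [lra|split => /=; lra]].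
Qed.

(** The two lobes are mirror images in the diagonal and meet along an edge on it, so |X - Y|
    describes both at once. *)
Lemma ThetaE q : Theta q <->
  [/\ 4 * (q.1 + q.2) <= `|q.1 - q.2|, `|q.1 - q.2| - 1 <= q.1 + q.2
    & `|q.1 - q.2| - 1 <= 3 * (q.1 + q.2)].
Proof.
split=> [[|] [t1 [t2 [t3 [t4 [[t1_ge0 t2_ge0 t3_ge0 t4_ge0] [ts [-> ->]]]]]]]|] /=.
- rewrite ger0_norm; last lra.
  by split; lra.
- rewrite ler0_norm; last lra.
  by split; lra.
case: q => X Y /= [h1 h2 h3].
have [h|h] := ger0P (X - Y); [left|right].
- rewrite ger0_norm// in h1 h2 h3.
  (* The line X + Y = 0 cuts the lobe into two triangles, in which the weights are barycentric. *)
  have [v0|v0] := leP 0 (X + Y).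
  + exists 0, (X - Y - 4 * (X + Y)), (3 * (X + Y)), (1 + (X + Y) - (X - Y)) => /=.
    by split; [split; lra|split; [lra|split => /=; lra]].
  + exists (- 3 * (X + Y)), (X - Y), 0, (1 + 3 * (X + Y) - (X - Y)) => /=.
    by split; [split; lra|split; [lra|split => /=; lra]].
- rewrite ltr0_norm// in h1 h2 h3.
  have [v0|v0] := leP 0 (X + Y).
  + exists 0, (Y - X - 4 * (X + Y)), (3 * (X + Y)), (1 + (X + Y) - (Y - X)) => /=.
    by split; [split; lra|split; [lra|split => /=; lra]].
  + exists (- 3 * (X + Y)), (Y - X), 0, (1 + 3 * (X + Y) - (Y - X)) => /=.
    by split; [split; lra|split; [lra|split => /=; lra]].
Qed.

Lemma interior_OmegaE p : interior (@Omega R) p <->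
  `|p.1 - p.2| - 1 < p.1 + p.2 < 1 - 5 * `|p.1 - p.2|.
Proof.
split=> [/nbhs2P[e e0 eP]|/andP[h1 h2]].
  have e20 : 0 < e / 2 by lra.
  have e2e : `|e / 2| < e by rewrite gtr0_norm//; lra.
  have /OmegaE /= : Omega (p.1 + e / 2, p.2 + e / 2).
    by apply: eP => /=; rewrite addrAC subrr add0r.
  have /OmegaE /= : Omega (p.1 - e / 2, p.2 - e / 2).
    by apply: eP => /=; rewrite addrAC subrr add0r normrN.
  have -> : p.1 - e / 2 - (p.2 - e / 2) = p.1 - p.2 by ring.
  have -> : p.1 + e / 2 - (p.2 + e / 2) = p.1 - p.2 by ring.
  by move=> /andP[? ?] /andP[? ?]; apply/andP; split; lra.
(* 12 = 5 * 2 + 2: within [e] of [p], both |u| and w change by at most 2 e, and |u| enters with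
   factor 5. *)
pose e := Num.min (p.1 + p.2 - (`|p.1 - p.2| - 1)) (1 - 5 * `|p.1 - p.2| - (p.1 + p.2)) / 12.
have e0 : 0 < e by rewrite divr_gt0// lt_min; apply/andP; split; lra.
have : 12 * e <= Num.min (p.1 + p.2 - (`|p.1 - p.2| - 1)) (1 - 5 * `|p.1 - p.2| - (p.1 + p.2)).
  by rewrite mulrC divfK.
rewrite le_min => /andP[e1 e2].
apply/nbhs2P; exists e => // q; rewrite !ltr_norml => /andP[a1 a2] /andP[b1 b2].
apply/OmegaE.
have : `|q.1 - q.2| <= `|p.1 - p.2| + 2 * e.
  have -> : q.1 - q.2 = (p.1 - p.2) + ((q.1 - p.1) - (q.2 - p.2)) by ring.
  apply: (le_trans (ler_normD _ _)); rewrite lerD2l ler_norml; apply/andP; split; lra.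
by move=> H; apply/andP; split; lra.
Qed.

Lemma smooth_regionE p : smooth_region p <->
  `|p.1 - p.2| - 1 < p.1 + p.2 < 1 - 5 * `|p.1 - p.2| /\ ~ (p.2 = p.1 /\ 0 <= p.1).
Proof.
by split=> [[/interior_OmegaE ? ?]|[/interior_OmegaE ? ?]]; split.
Qed.

Lemma open_smooth_region : open (@smooth_region R).
Proof.
rewrite /smooth_region setDE; apply: openI; first exact: open_interior.
apply: closed_openC.
rewrite (_ : @diag_ray R = (fun p : R * R => p.2 - p.1) @^-1` [set x | x <= 0] `&`
   ((fun p : R * R => p.2 - p.1) @^-1` [set x | 0 <= x] `&` (fun p : R * R => p.1) @^-1` [set x | 0 <= x])).
  have c : continuous (fun p : R * R => p.2 - p.1).
    by move=> q; apply: cvgB; [exact: cvg_snd|exact: cvg_fst].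
  apply: closedI; [|apply: closedI].
  - by apply: preimage_closed; [move=> q _; exact: c|exact: closed_le].
  - by apply: preimage_closed; [move=> q _; exact: c|exact: closed_ge].
  - by apply: preimage_closed; [move=> q _; exact: cvg_fst|exact: closed_ge].
apply/seteqP; split=> [q [/= e q0]|q [/= a [/= b q0]]].
  by split; [|split] => //=; rewrite e subrr.
by split => //; apply/eqP; rewrite eq_le; apply/andP; split; lra.
Qed.

Definition obox (a b c d : R) : set (R * R) := `]a, b[%classic `*` `]c, d[%classic.

Lemma obox_measurable a b c d :
  measurable (obox a b c d : set (measurableTypeR R * measurableTypeR R)).
Proof. by apply: measurableX; exact: measurable_itv. Qed.

Lemma leb2_obox_gt0 a b c d : a < b -> c < d -> (0 < leb2 (obox a b c d))%E.
Proof.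
move=> ab cd.
have L (x y : R) : x < y -> @lebesgue_measure R `]x, y[%classic = (y - x)%:E.
  by move=> xy; rewrite lebesgue_measure_itv/= lte_fin xy EFinB.
have -> : leb2 (obox a b c d) =
    (@lebesgue_measure R `]a, b[%classic * @lebesgue_measure R `]c, d[%classic)%E.
  by apply: product_measure1E; exact: measurable_itv.
rewrite !L// -EFinM lte_fin.
by rewrite mulr_gt0// subr_gt0.
Qed.

Lemma leb2_set0 : leb2 (set0 : set (R * R)) = 0%E.
Proof. exact: measure0. Qed.

Lemma near_obox p (A : set (R * R)) : nbhs p A -> exists a b c d : rat,
  obox (ratr a) (ratr b) (ratr c) (ratr d) p /\ obox (ratr a) (ratr b) (ratr c) (ratr d) `<=` A.
Proof.
move=> /nbhs2P[e e0 eP].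
have rl (x : R) : exists2 a : rat, x - e < ratr a & ratr a < x.
  have [|a] := @rat_in_itvoo R (x - e) x; first lra.
  by rewrite in_itv/= => /andP[a1 a2]; exists a.
have rr (x : R) : exists2 a : rat, ratr a < x + e & x < ratr a.
  have [|a] := @rat_in_itvoo R x (x + e); first lra.
  by rewrite in_itv/= => /andP[a1 a2]; exists a.
have [a a1 a2] := rl p.1; have [b b1 b2] := rr p.1.
have [c c1 c2] := rl p.2; have [d d1 d2] := rr p.2.
exists a, b, c, d; split; first by split; rewrite /= in_itv/=; apply/andP.
move=> q [/=]; rewrite !in_itv/= => /andP[x1 x2] /andP[y1 y2].
by apply: eP; rewrite ltr_norml; apply/andP; split; lra.
Qed.

(** The product sigma-algebra comes from rectangles; an open set is the countable union of the
    rational boxes that it contains. *)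
Lemma open_measurable2 (S : set (R * R)) : open S ->
  measurable (S : set (measurableTypeR R * measurableTypeR R)).
Proof.
move=> oS; pose B (i : rat * rat * rat * rat) : set (measurableTypeR R * measurableTypeR R) :=
  obox (ratr i.1.1.1) (ratr i.1.1.2) (ratr i.1.2) (ratr i.2).
rewrite (_ : S = \bigcup_i (if `[< B i `<=` S >] then B i else set0)).
  apply: countable_bigcupT_measurable; first exact: countableP.
  by move=> i; case: ifP => _; [exact: obox_measurable|exact: measurable0].
apply/seteqP; split=> [p Sp|p [i _]]; last by case: asboolP => // H /H.
have [a [b [c [d [pB BS]]]]] := near_obox (open_nbhs_nbhs (conj oS Sp)).
by exists (a, b, c, d) => //; case: asboolP => // /(_ BS).
Qed.

Lemma leb2_open_gt0 (S : set (R * R)) p : open S -> S p -> (0 < leb2 S)%E.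
Proof.
move=> oS Sp; have [a [b [c [d [[/=]]]]]] := near_obox (open_nbhs_nbhs (conj oS Sp)).
rewrite !in_itv/= => /andP[a1 a2] /andP[b1 b2] BS.
apply: lt_le_trans (leb2_obox_gt0 (lt_trans a1 a2) (lt_trans b1 b2)) _.
by rewrite /leb2; apply: le_measure => //; rewrite inE; [exact: obox_measurable|exact: open_measurable2].
Qed.

Lemma open_grad_preimage phi (B : set (R * R)) : smooth_on (@smooth_region R) phi ->
  open B -> open (@smooth_region R `&` grad phi @^-1` B).
Proof.
move=> sphi oB; rewrite openE => p [pS pB].
have cg : {for p, continuous (grad phi)}.
  by apply: (@cvg_pair _ _ _ (nbhs p) (nbhs (dx phi p)) (nbhs (dy phi p)));
    [exact: (@smooth_continuous _ phi _ [:: false] p sphi)|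
     exact: (@smooth_continuous _ phi _ [:: true] p sphi)].
apply: filterI; first exact: open_nbhs_nbhs (conj open_smooth_region pS).
by apply: cg; exact: open_nbhs_nbhs.
Qed.

Lemma open_obox a b c d : open (obox a b c d).
Proof.
rewrite (_ : obox a b c d = (@fst R R) @^-1` `]a, b[%classic `&` (@snd R R) @^-1` `]c, d[%classic).
  by apply: openI; apply: open_comp; [move=> q _; exact: cvg_fst|exact: interval_open|
    move=> q _; exact: cvg_snd|exact: interval_open].
by apply/seteqP; split.
Qed.

(** * Consequences of mass balance *)

Section Pushforward.
Variable phi : R * R -> R.
Hypothesis sphi : smooth_on (@smooth_region R) phi.
Hypothesis push : brenier_pushforward phi.

(** [Theta] is closed, so a gradient outside it has a box around it that misses [Theta]; the
    preimage of the box is open and nonempty, hence of positive measure. Continuity of the gradient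
    thus gives the inclusion at every point, not only almost everywhere. *)
Lemma grad_in_Theta p : smooth_region p -> Theta (grad phi p).
Proof.
move=> ps; have [//|nT] := pselect (Theta (grad phi p)).
have nB : nbhs (grad phi p) (~` @Theta R).
  apply: open_nbhs_nbhs; split => //; apply: closed_openC.
  rewrite (_ : @Theta R = [set q : R * R | 4 * (q.1 + q.2) - `|q.1 - q.2| <= 0] `&`
    ([set q : R * R | `|q.1 - q.2| - 1 - (q.1 + q.2) <= 0] `&`
     [set q : R * R | `|q.1 - q.2| - 1 - 3 * (q.1 + q.2) <= 0])); last first.
    apply/seteqP; split => q.
      by move=> /ThetaE[? ? ?]; split => /=; [lra|split => /=; lra].
    by move=> [/= ? [/= ? ?]]; apply/ThetaE; split; lra.
  have cs : continuous (fun q : R * R => q.1 + q.2).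
    by move=> q; apply: cvgD; [exact: cvg_fst|exact: cvg_snd].
  have cn : continuous (fun q : R * R => `|q.1 - q.2|).
    by move=> q; apply: cvg_norm; apply: cvgB; [exact: cvg_fst|exact: cvg_snd].
  have ck (k : R) : continuous (fun q : R * R => k * (q.1 + q.2)).
    by move=> q; apply: cvgM; [exact: cvg_cst|exact: cs].
  have cn1 : continuous (fun q : R * R => `|q.1 - q.2| - 1).
    by move=> q; apply: cvgB; [exact: cn|exact: cvg_cst].
  apply: closedI; [|apply: closedI].
  - apply: (@preimage_closed _ _ (fun q : R * R => 4 * (q.1 + q.2) - `|q.1 - q.2|)
      [set x | x <= 0]); last exact: closed_le.
    by move=> q _; apply: cvgB; [exact: ck|exact: cn].
  - apply: (@preimage_closed _ _ (fun q : R * R => `|q.1 - q.2| - 1 - (q.1 + q.2))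
      [set x | x <= 0]); last exact: closed_le.
    by move=> q _; apply: cvgB; [exact: cn1|exact: cs].
  - apply: (@preimage_closed _ _ (fun q : R * R => `|q.1 - q.2| - 1 - 3 * (q.1 + q.2))
      [set x | x <= 0]); last exact: closed_le.
    by move=> q _; apply: cvgB; [exact: cn1|exact: ck].
have [a [b [c [d [pB BT]]]]] := near_obox nB.
have := push (obox_measurable (ratr a) (ratr b) (ratr c) (ratr d)).
have -> : @Theta R `&` obox (ratr a) (ratr b) (ratr c) (ratr d) = set0.
  by apply/seteqP; split => // q [qT /BT].
rewrite leb2_set0 => E.
have := @leb2_open_gt0 _ p (open_grad_preimage sphi (@open_obox (ratr a) (ratr b) (ratr c) (ratr d))) (conj ps pB).
by rewrite E ltxx.
Qed.

(** Mass balance in the other direction: a box inside [Theta] has positive mass, so its preimage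
    cannot be empty. *)
Lemma grad_hits_box a b c d : a < b -> c < d -> obox a b c d `<=` @Theta R ->
  exists2 p, smooth_region p & obox a b c d (grad phi p).
Proof.
move=> ab cd BT; apply: contrapT => H.
have := push (obox_measurable a b c d).
have -> : @Theta R `&` obox a b c d = obox a b c d by exact/setIidr.
have -> : @smooth_region R `&` grad phi @^-1` obox a b c d = set0.
  by apply/seteqP; split => // q [qs qB]; apply: H; exists q.
by rewrite leb2_set0 => E; have := leb2_obox_gt0 ab cd; rewrite -E ltxx.
Qed.

End Pushforward.

End Geometry.

(** * The change of variables *)

Section CaratheodoryCurves.
Variable R : realType.

Lemma within_dist (A : set (R * R)) (f : R * R -> R) : {within A, continuous f} ->
  forall z, A z -> forall e : R, 0 < e -> exists2 d : R, 0 < d &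
    forall q, A q -> `|q.1 - z.1| < d -> `|q.2 - z.2| < d -> `|f q - f z| < e.
Proof.
move=> /subspace_continuousP cf z Az e e0.
have /cvgrPdist_lt /(_ e e0) := cf z Az.
rewrite near_withinE => /nbhs2P[d d0 dP]; exists d => // q Aq q1 q2.
by rewrite distrC; exact: dP.
Qed.

Lemma within_interior_continuous (A : set (R * R)) (f : R * R -> R) p :
  {within A, continuous f} -> interior A p -> {for p, continuous f}.
Proof.
move=> /within_dist cf iA; apply/continuous2P => e e0.
have Ap : A p by exact: interior_subset.
have [d d0 dP] := cf p Ap e e0.
move/nbhs2P : iA => [d' d'0 d'P].
exists (Num.min d d'); first by rewrite lt_min d0.
move=> q; rewrite !lt_min => /andP[q1 q1'] /andP[q2 q2'].
by apply: dP => //; exact: d'P.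
Qed.

Lemma der1_carath (f : R -> R) (x l : R) : der1 f x l ->
  exists c : R -> R, [/\ {for x, continuous c}, c x = l &
    forall y, f y - f x = c y * (y - x)].
Proof.
move=> fl; exists (fun y => if y == x then l else (f y - f x) / (y - x)); split.
- apply/continuous1P => e e0; move/is_deriveP : fl => /(_ e e0)[d d0 dP].
  exists d => // y yd; rewrite eqxx; case: eqVneq => [_|yx]; first by rewrite subrr normr0.
  exact: dP.
- by rewrite eqxx.
- by move=> y; case: eqVneq => [->|yx]; rewrite ?subrr ?mulr0// divfK// subr_eq0.
Qed.

Lemma near1_pair (p : R * R) (f g : R -> R) (x : R) (A : set (R * R)) :
  {for x, continuous f} -> {for x, continuous g} -> f x = p.1 -> g x = p.2 ->
  nbhs p A -> \forall y \near x, A (f y, g y).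
Proof.
move=> /continuous1P cf /continuous1P cg fx gx /nbhs2P[e e0 eA].
have [d d0 dP] := cf e e0; have [d' d'0 d'P] := cg e e0.
apply/nbhs1P; exists (Num.min d d'); first by rewrite lt_min d0.
move=> y; rewrite lt_min => /andP[y1 y2]; apply: eA => /=.
  by rewrite -fx; exact: dP.
by rewrite -gx; exact: d'P.
Qed.

Lemma comp_pair_continuous (p : R * R) (f g : R -> R) (x : R) (a : R * R -> R) :
  {for x, continuous f} -> {for x, continuous g} -> f x = p.1 -> g x = p.2 ->
  {for p, continuous a} -> {for x, continuous (fun y => a (f y, g y))}.
Proof.
move=> cf cg fx gx ca A /=; rewrite fx gx -surjective_pairing => /ca.
exact: near1_pair.
Qed.

(** The chain rule: the slope functions of the curve multiply those of [a], and no error term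
    occurs. *)
Lemma caratheodory_curve (a al be : R * R -> R) p (f g : R -> R) (x f' g' : R) :
  {for p, continuous al} -> {for p, continuous be} ->
  (\forall q \near p, a q - a p = al q * (q.1 - p.1) + be q * (q.2 - p.2)) ->
  der1 f x f' -> der1 g x g' -> f x = p.1 -> g x = p.2 ->
  der1 (fun t => a (f t, g t)) x (al p * f' + be p * g').
Proof.
move=> ca cb H fD gD fx gx.
have [c1 [cc1 c1x c1E]] := der1_carath fD.
have [c2 [cc2 c2x c2E]] := der1_carath gD.
have cf := is_derive_cont fD; have cg := is_derive_cont gD.
pose k y := al (f y, g y) * c1 y + be (f y, g y) * c2 y.
have -> : al p * f' + be p * g' = k x by rewrite /k fx gx -surjective_pairing c1x c2x.
have ck : {for x, continuous k}.
  by apply: cvgD; apply: cvgM; [exact: (@comp_pair_continuous p)|exact: cc1|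
    exact: (@comp_pair_continuous p)|exact: cc2].
apply: (is_derive_carath ck).
have := near1_pair cf cg fx gx H; apply: filterS => y.
rewrite /= -fx -gx c1E c2E /k => Hy.
rewrite (_ : a (f x, g x) = a p) ?Hy; first by ring.
by rewrite fx gx -surjective_pairing.
Qed.

End CaratheodoryCurves.


(** * The homeomorphism f and its inverse *)

Section InverseMap.
Variable R : realType.
Variables (phi v rho : R * R -> R).
Hypothesis sphi : smooth_on (@smooth_region R) phi.
Hypothesis cv : {within @Omega R, continuous v}.
Hypothesis vE : forall p, smooth_region p -> v p = dx phi p + dy phi p.
Hypothesis rho_gt0 : forall p, Omega p -> p <> (0, 0) -> 0 < rho p.
Hypothesis rhoE : forall p, smooth_region p ->
     rho p = dx (dx phi) p + 2 * dy (dx phi) p + dy (dy phi) p.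
Hypothesis finj : {in @Omega R &, injective (fun p => (p.1 - p.2, v p))}.
Hypothesis v00 : v (0, 0) = 0.

Local Notation SR := (@smooth_region R).

Lemma smooth_near p : SR p -> nbhs p SR.
Proof. by move=> ps; exact: open_nbhs_nbhs (conj (@open_smooth_region R) ps). Qed.

Lemma smooth_Omega p : SR p -> Omega p.
Proof. by move=> [/interior_subset]. Qed.

Lemma smooth_neq0 p : SR p -> p <> (0, 0).
Proof. by move=> /smooth_regionE[_ H] p0; apply: H; rewrite p0. Qed.

Lemma phi_dxy p : SR p -> dx (dy phi) p = dy (dx phi) p.
Proof. by move=> ps; apply: smooth_clairaut sphi ps; exact: open_smooth_region. Qed.

Let V p := dx phi p + dy phi p.

Lemma v_carath p : SR p -> exists al be : R * R -> R,
  [/\ {for p, continuous al}, {for p, continuous be},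
   al p = dx (dx phi) p + dy (dx phi) p, be p = dy (dx phi) p + dy (dy phi) p &
   \forall q \near p, v q - v p = al q * (q.1 - p.1) + be q * (q.2 - p.2)].
Proof.
move=> ps; have nS := smooth_near ps.
have [||||al [be [ca cb alp bep H]]] := @caratheodory2 R V
    (fun q => dx (dx phi) q + dx (dy phi) q) (fun q => dy (dx phi) q + dy (dy phi) q) p.
- apply: filterS nS => q qs; apply: derD.
    exact: (@smooth_is_dx _ phi SR [:: false]).
  exact: (@smooth_is_dx _ phi SR [:: true]).
- apply: filterS nS => q qs; apply: derD.
    exact: (@smooth_is_dy _ phi SR [:: false]).
  exact: (@smooth_is_dy _ phi SR [:: true]).
- by apply: cvgD; [exact: (@smooth_continuous _ phi SR [:: false; false])|
    exact: (@smooth_continuous _ phi SR [:: false; true])].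
- by apply: cvgD; [exact: (@smooth_continuous _ phi SR [:: true; false])|
    exact: (@smooth_continuous _ phi SR [:: true; true])].
exists al, be; split; [exact: ca|exact: cb| |exact: bep|].
  by rewrite alp (phi_dxy ps); reflexivity.
by apply: filterS2 nS H => q qs; rewrite /V !vE.
Qed.

(** Coordinates adapted to [f]: it preserves u, and on a fiber of constant u it is a function of w =
    x + y alone. *)
Definition fiber_pt (u w : R) : R * R := ((w + u) / 2, (w - u) / 2).

Lemma fiber_ptE p : fiber_pt (p.1 - p.2) (p.1 + p.2) = p.
Proof. by case: p => x y; rewrite /fiber_pt /=; congr pair; field. Qed.

Lemma fiber_pt_u u w : (fiber_pt u w).1 - (fiber_pt u w).2 = u.
Proof. by rewrite /fiber_pt /=; field. Qed.

Lemma fiber_pt_w u w : (fiber_pt u w).1 + (fiber_pt u w).2 = w.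
Proof. by rewrite /fiber_pt /=; field. Qed.

Lemma fiber_Omega u w : Omega (fiber_pt u w) <-> `|u| - 1 <= w <= 1 - 5 * `|u|.
Proof.
by split => [/OmegaE|H]; [|apply/OmegaE]; rewrite fiber_pt_u fiber_pt_w.
Qed.

Lemma fiber_interior u w : interior (@Omega R) (fiber_pt u w) <-> `|u| - 1 < w < 1 - 5 * `|u|.
Proof.
by split => [/interior_OmegaE|H]; [|apply/interior_OmegaE]; rewrite fiber_pt_u fiber_pt_w.
Qed.

Lemma fiber_smooth u w : `|u| - 1 < w < 1 - 5 * `|u| -> u != 0 \/ w < 0 ->
  SR (fiber_pt u w).
Proof.
move=> uw H; apply/smooth_regionE; rewrite fiber_pt_u fiber_pt_w; split => //.
rewrite /fiber_pt /= => -[e w0]; case: H => [/eqP u0|wn]; first by apply: u0; lra.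
lra.
Qed.

Lemma fiber_dist u w u' w' (e : R) : `|u - u'| < e -> `|w - w'| < e ->
  `|(fiber_pt u w).1 - (fiber_pt u' w').1| < e /\ `|(fiber_pt u w).2 - (fiber_pt u' w').2| < e.
Proof.
rewrite /fiber_pt /= !ltr_norml => /andP[a b] /andP[c d].
by split; apply/andP; split; lra.
Qed.

(** At fixed u the derivative of v in w is rho / 2. For nonzero u the open fiber stays in the smooth
    region. *)
Lemma v_fiber_incr_off u w1 w2 : u != 0 -> Omega (fiber_pt u w1) -> Omega (fiber_pt u w2) ->
  w1 < w2 -> v (fiber_pt u w1) < v (fiber_pt u w2).
Proof.
move=> u0 /fiber_Omega/andP[a1 b1] /fiber_Omega/andP[a2 b2] w12.
have [||c] := @MVT R (fun s => v (fiber_pt u s)) (fun s => rho (fiber_pt u s) / 2) _ _ w12.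
- move=> s; rewrite in_itv/= => /andP[s1 s2].
  have ps : SR (fiber_pt u s) by apply: fiber_smooth; [apply/andP; split; lra|left].
  have [al [be [ca cb alp bep H]]] := v_carath ps.
  have D1 : der1 (fun s => (s + u) / 2) s (1 / 2) by eapply der_eq; [der|rewrite /=; field].
  have D2 : der1 (fun s => (s - u) / 2) s (1 / 2) by eapply der_eq; [der|rewrite /=; field].
  apply: (der_eq (caratheodory_curve ca cb H D1 D2 erefl erefl)).
  rewrite alp bep (rhoE ps).
  by move: (dx (dx phi) _) (dy (dx phi) _) (dy (dy phi) _) => A B D; field.
- apply/subspace_continuousP => s; rewrite /= in_itv/= => /andP[s1 s2].
  apply/cvgrPdist_lt => e e0.
  have Os : Omega (fiber_pt u s) by apply/fiber_Omega/andP; split; lra.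
  have [d d0 dP] := within_dist cv Os e0.
  rewrite near_withinE; apply/nbhs1P; exists d => // t td; rewrite /= in_itv/= => /andP[t1 t2].
  have [|d1 d2] := @fiber_dist u t u s d _ td; first by rewrite subrr normr0.
  by rewrite distrC; apply: dP => //; apply/fiber_Omega/andP; split; lra.
rewrite in_itv/= => /andP[c1 c2] E.
have ps : SR (fiber_pt u c) by apply: fiber_smooth; [apply/andP; split; lra|left].
rewrite -subr_gt0 E mulr_gt0 ?subr_gt0// divr_gt0//.
by apply: rho_gt0; [exact: smooth_Omega|exact: smooth_neq0].
Qed.

(** The fiber u = 0 contains the slit, where v need not be derivable. Approximation by nearby fibers
    gives weak monotonicity, and injectivity of [f] makes it strict. *)
Lemma v_fiber_incr u w1 w2 : Omega (fiber_pt u w1) -> Omega (fiber_pt u w2) ->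
  w1 < w2 -> v (fiber_pt u w1) < v (fiber_pt u w2).
Proof.
have [->|u0] := eqVneq u 0; last exact: v_fiber_incr_off.
move=> O1 O2 w12; rewrite lt_neqAle; apply/andP; split.
  apply/eqP => E.
  have /(congr1 (fun p => p.1 + p.2)) : fiber_pt 0 w1 = fiber_pt 0 w2.
    by apply: finj; rewrite ?inE// !fiber_pt_u E.
  by rewrite !fiber_pt_w => e; rewrite e ltxx in w12.
rewrite leNgt; apply/negP => lt21.
pose e := (v (fiber_pt 0 w1) - v (fiber_pt 0 w2)) / 2.
have e0 : 0 < e by rewrite divr_gt0// subr_gt0.
have [d d0 dP] := within_dist cv O1 e0.
have [d' d'0 d'P] := within_dist cv O2 e0.
move: (O1) (O2) => /fiber_Omega + /fiber_Omega; rewrite normr0 mulr0 subr0 sub0r.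
move=> /andP[a1 b1] /andP[a2 b2].
pose k := Num.min (1 / 10) (Num.min d d' / 10).
have k0 : 0 < k by rewrite !lt_min divr_gt0//= divr_gt0// lt_min d0.
have k1 : k <= 1 / 10 by rewrite ge_min lexx.
have kd : 10 * k <= Num.min d d'.
  have : k <= Num.min d d' / 10 by rewrite ge_min lexx orbT.
  by rewrite ler_pdivlMr// mulrC.
rewrite le_min in kd; case/andP: kd => kd kd'.
(* Scaling w by 1 - 5 k keeps the order and brings the shifted points into [Omega], whose fiber over
   k ends at 1 - 5 k. *)
have near (w m : R) : -1 <= w -> w <= 1 -> 10 * k <= m ->
    `|(fiber_pt k ((1 - 5 * k) * w)).1 - (fiber_pt 0 w).1| < m /\
    `|(fiber_pt k ((1 - 5 * k) * w)).2 - (fiber_pt 0 w).2| < m /\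
    Omega (fiber_pt k ((1 - 5 * k) * w)).
  move=> w1' w2' km.
  have [||? ?] := @fiber_dist k ((1 - 5 * k) * w) 0 w m.
  - by rewrite subr0 gtr0_norm//; lra.
  - rewrite ltr_norml; apply/andP; split; nra.
  split => //; split => //.
  by apply/fiber_Omega; rewrite gtr0_norm//; apply/andP; split; nra.
have [n1 [n2 O1']] := near w1 d a1 b1 kd.
have [n1' [n2' O2']] := near w2 d' a2 b2 kd'.
have := dP _ O1' n1 n2; have := d'P _ O2' n1' n2'.
have : v (fiber_pt k ((1 - 5 * k) * w1)) < v (fiber_pt k ((1 - 5 * k) * w2)).
  apply: v_fiber_incr_off => //; first by rewrite gt_eqF.
  by rewrite ltr_pM2l//; lra.
rewrite !ltr_norml /e => ? /andP[? ?] /andP[? ?]; lra.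
Qed.

Lemma v_fiber_lt p q : Omega p -> Omega q -> p.1 - p.2 = q.1 - q.2 ->
  v p < v q -> p.1 + p.2 < q.1 + q.2.
Proof.
move=> Op Oq uE vpq; rewrite ltNge; apply/negP; rewrite le_eqVlt => /orP[/eqP wE|w_lt].
  by move: vpq; rewrite -(fiber_ptE p) -(fiber_ptE q) uE wE ltxx.
have := @v_fiber_incr (q.1 - q.2) (q.1 + q.2) (p.1 + p.2).
rewrite fiber_ptE -uE fiber_ptE => /(_ Oq Op w_lt) vqp.
by have := lt_trans vpq vqp; rewrite ltxx.
Qed.

Let F p := (p.1 - p.2, v p).
Let Omt := F @` @Omega R.

Definition uv_inv (q : R * R) : R * R := xget (0, 0) [set p | Omega p /\ (p.1 - p.2, v p) = q].

Lemma uv_invP q : Omt q -> Omega (uv_inv q) /\ F (uv_inv q) = q.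
Proof. by move=> [p Op pq]; apply: (@xgetPex _ (0, 0) [set p | Omega p /\ F p = q]); exists p. Qed.

Lemma uv_invK p : Omega p -> uv_inv (F p) = p.
Proof.
move=> Op; have [|Oq E] := @uv_invP (F p); first by exists p.
by apply: finj; rewrite ?inE.
Qed.

Lemma uv_inv_u q : Omt q -> (uv_inv q).1 - (uv_inv q).2 = q.1.
Proof. by move=> /uv_invP[_ /(congr1 fst)]. Qed.

Lemma uv_inv_v q : Omt q -> v (uv_inv q) = q.2.
Proof. by move=> /uv_invP[_ /(congr1 snd)]. Qed.

Lemma Omega0 : Omega (0 : R, 0 : R).
Proof. by apply/OmegaE; rewrite /= !subr0 normr0; apply/andP; split; lra. Qed.

Lemma v_continuous p : interior (@Omega R) p -> {for p, continuous v}.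
Proof. exact: within_interior_continuous. Qed.

Lemma v_fiber_continuous u w : interior (@Omega R) (fiber_pt u w) ->
  {for w, continuous (fun s => v (fiber_pt u s))}.
Proof.
move=> /v_continuous/continuous2P cvp; apply/continuous1P => e e0.
have [d d0 dP] := cvp e e0; exists d => // s sw.
by have [|? ?] := @fiber_dist u s u w d _ sw; [rewrite subrr normr0|exact: dP].
Qed.

(* On each fiber [v] is increasing, so the intermediate value theorem gives preimages. *)
Lemma f_open_at p (e : R) : interior (@Omega R) p -> 0 < e -> exists2 d : R, 0 < d &
  forall q, `|q.1 - (F p).1| < d -> `|q.2 - (F p).2| < d ->
  exists p', [/\ Omega p', F p' = q, `|p'.1 - p.1| < e & `|p'.2 - p.2| < e].
Proof.
move=> ip e0; pose u := p.1 - p.2; pose w := p.1 + p.2.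
have := ip; rewrite -{1}(fiber_ptE p) => /fiber_interior; rewrite -/u -/w => /andP[w1 w2].
pose h := Num.min e (Num.min (w - (`|u| - 1)) (1 - 5 * `|u| - w)) / 2.
have h0 : 0 < h by rewrite divr_gt0// !lt_min e0 /= !subr_gt0 w1 w2.
have h2 : 2 * h <= Num.min e (Num.min (w - (`|u| - 1)) (1 - 5 * `|u| - w)) by rewrite mulrC divfK.
move: h2; rewrite !le_min => /and3P[he hl hr].
have {}he : h < e by apply: lt_le_trans he; rewrite ltr_pMl ?ltr1n.
have il : interior (@Omega R) (fiber_pt u (w - h)) by apply/fiber_interior/andP; split; lra.
have ir : interior (@Omega R) (fiber_pt u (w + h)) by apply/fiber_interior/andP; split; lra.
have Op : Omega (fiber_pt u w) by rewrite fiber_ptE; exact: interior_subset.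
have vl : v (fiber_pt u (w - h)) < v p.
  by rewrite -[in v p](fiber_ptE p); apply: v_fiber_incr => //; [exact: interior_subset|rewrite -/w; lra].
have vr : v p < v (fiber_pt u (w + h)).
  by rewrite -[in v p](fiber_ptE p); apply: v_fiber_incr => //; [exact: interior_subset|rewrite -/w; lra].
pose g := Num.min (v p - v (fiber_pt u (w - h))) (v (fiber_pt u (w + h)) - v p) / 2.
have g0 : 0 < g by rewrite divr_gt0// lt_min !subr_gt0 vl.
have : 2 * g <= Num.min (v p - v (fiber_pt u (w - h))) (v (fiber_pt u (w + h)) - v p) by rewrite mulrC divfK.
rewrite le_min => /andP[gl gr].
(* On nearby fibers the end points w - h and w + h stay inside [Omega], and v moves there by less
   than half of its distance to [v p], so its values still enclose [q.2]. *)
have near (x : R) : interior (@Omega R) (fiber_pt u x) -> exists2 d : R, 0 < d &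
    forall u', `|u' - u| < d -> interior (@Omega R) (fiber_pt u' x) /\
      `|v (fiber_pt u' x) - v (fiber_pt u x)| < g.
  move=> ix; have /continuous2P/(_ _ g0)[d d0 dP] := v_continuous ix.
  have /nbhs2P[d' d'0 d'P] : nbhs (fiber_pt u x) (interior (@Omega R)).
    exact: open_nbhs_nbhs (conj (@open_interior _ _) ix).
  exists (Num.min d d'); first by rewrite lt_min d0.
  move=> u'; rewrite lt_min => /andP[ud ud'].
  have [|? ?] := @fiber_dist u' x u x d ud; first by rewrite subrr normr0.
  have [|? ?] := @fiber_dist u' x u x d' ud'; first by rewrite subrr normr0.
  by split; [exact: d'P|exact: dP].
have [d1 d10 d1P] := near _ il; have [d2 d20 d2P] := near _ ir.
exists (Num.min (Num.min d1 d2) (Num.min g h)).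
  by rewrite !lt_min d10 d20 g0 h0.
move=> q; rewrite !lt_min /F /= -/u => /andP[/andP[q1 q2] /andP[_ q1h]] /andP[_ /andP[qg _]].
have [ql vql] := d1P _ q1; have [qr vqr] := d2P _ q2.
move: vql vqr qg; rewrite !ltr_norml => /andP[_ vql] /andP[vqr _] /andP[qgl qgr].
have lr : w - h <= w + h by lra.
have vlq : v (fiber_pt q.1 (w - h)) <= q.2 by lra.
have vrq : q.2 <= v (fiber_pt q.1 (w + h)) by lra.
have [||s] := @IVT R (fun s => v (fiber_pt q.1 s)) (w - h) (w + h) q.2 lr.
- apply/subspace_continuousP => s; rewrite /= in_itv/= => /andP[s1 s2].
  apply: cvg_within_filter; apply: v_fiber_continuous.
  move/fiber_interior/andP : ql => [a1 a2]; move/fiber_interior/andP : qr => [b1 b2].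
  by apply/fiber_interior/andP; clear -s1 s2 a1 a2 b1 b2; split; lra.
- by rewrite ge_min vlq le_max vrq orbT.
rewrite in_itv/= => /andP[s1 s2] vs.
have [||n1 n2] := @fiber_dist q.1 s u w e.
- by apply: lt_trans q1h _.
- apply: (@le_lt_trans _ _ h); last exact: he.
  by rewrite ler_norml lerBrDl s1 lerBlDl.
rewrite /u /w fiber_ptE in n1 n2.
exists (fiber_pt q.1 s); split => //.
- apply/fiber_Omega.
  move/fiber_interior/andP : ql => [a1 a2]; move/fiber_interior/andP : qr => [b1 b2].
  by apply/andP; clear vql vqr qgl qgr vlq vrq vs vl vr gl gr n1 n2; split; lra.
- by rewrite fiber_pt_u vs -surjective_pairing.
Qed.

Lemma interior_Omt_F p : interior (@Omega R) p -> interior Omt (F p).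
Proof.
move=> ip; have [d d0 dP] := f_open_at ip (@ltr01 R).
by apply/nbhs2P; exists d => // q q1 q2; have [p' [Op' <- _ _]] := dP q q1 q2; exists p'.
Qed.

(** The points just above and below [q] also lie in the image; their preimages are on the same
    fiber, strictly above and below that of [q], which keeps the latter off the boundary of the
    kite. *)
Lemma uv_inv_interior q : interior Omt q -> interior (@Omega R) (uv_inv q).
Proof.
move=> iq; have Oq : Omt q by exact: interior_subset.
have [Op Fp] := uv_invP Oq.
move/nbhs2P : iq => [e e0 eP].
have e2e : `|e / 2| < e by rewrite gtr0_norm; lra.
have Ol : Omt (q.1, q.2 - e / 2).
  by apply: eP; rewrite /= ?subrr ?normr0// addrAC subrr add0r normrN.
have Or : Omt (q.1, q.2 + e / 2).
  by apply: eP; rewrite /= ?subrr ?normr0// addrAC subrr add0r.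
have [Opl _] := uv_invP Ol; have [Opr _] := uv_invP Or.
have ul := uv_inv_u Ol; have ur := uv_inv_u Or; have u := uv_inv_u Oq.
have vl := uv_inv_v Ol; have vr := uv_inv_v Or; have vq := uv_inv_v Oq.
rewrite /= in ul ur vl vr.
have wl : (uv_inv (q.1, q.2 - e / 2)).1 + (uv_inv (q.1, q.2 - e / 2)).2 < (uv_inv q).1 + (uv_inv q).2.
  by apply: v_fiber_lt => //; [rewrite ul u|rewrite vl vq; lra].
have wr : (uv_inv q).1 + (uv_inv q).2 < (uv_inv (q.1, q.2 + e / 2)).1 + (uv_inv (q.1, q.2 + e / 2)).2.
  by apply: v_fiber_lt => //; [rewrite ur u|rewrite vr vq; lra].
move/OmegaE : Opl => /andP[a _]; move/OmegaE : Opr => /andP[_ b].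
rewrite ul in a; rewrite ur in b.
by apply/interior_OmegaE; rewrite u; apply/andP; split; lra.
Qed.

Lemma uv_inv_continuous q : interior Omt q -> {for q, continuous uv_inv}.
Proof.
move=> iq; have ip := uv_inv_interior iq.
have [_ Fq] := uv_invP (interior_subset iq).
move=> A /nbhs2P[e e0 eA].
have [d d0 dP] := f_open_at ip e0.
apply/nbhs2P; exists d => // q' q1 q2.
rewrite Fq in dP; have [p' [Op' Fp' p1 p2]] := dP q' q1 q2.
by rewrite /= -Fp' uv_invK//; exact: eA.
Qed.

(** As v vanishes at the origin and increases along the fiber u = 0, the slit corresponds to the ray
    u = 0, v >= 0. *)
Lemma uv_inv_smooth q : interior Omt q -> ~ (q.1 = 0 /\ 0 <= q.2) -> SR (uv_inv q).
Proof.
move=> iq nray; have Oq : Omt q by exact: interior_subset.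
have /interior_OmegaE ip := uv_inv_interior iq.
apply/smooth_regionE; split => // -[e p0]; apply: nray.
have [Op _] := uv_invP Oq.
have u := uv_inv_u Oq; rewrite e subrr in u; split => //.
rewrite -(uv_inv_v Oq) -v00.
rewrite leNgt; apply/negP => /(v_fiber_lt Op Omega0).
by rewrite /= e !subrr => /(_ erefl); lra.
Qed.

Lemma smooth_not_ray p : SR p -> ~ ((F p).1 = 0 /\ 0 <= (F p).2).
Proof.
move=> ps [/= u0 vp]; have /smooth_regionE[_ H] := ps; apply: H.
have e : p.2 = p.1 by lra.
split => //; rewrite leNgt; apply/negP => p0.
have Op := smooth_Omega ps.
have := @v_fiber_incr 0 (p.1 + p.2) 0.
have -> : fiber_pt 0 (p.1 + p.2) = p by rewrite -u0 fiber_ptE.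
have -> : fiber_pt 0 0 = (0, 0) by rewrite /fiber_pt subr0 addr0 mul0r.
move=> /(_ Op Omega0); rewrite v00 => K.
have vn : v p < 0 by apply: K; lra.
by have := le_lt_trans vp vn; rewrite ltxx.
Qed.

Lemma uv_inv_neq0 q : Omt q -> q <> (0, 0) -> uv_inv q <> (0, 0).
Proof. by move=> /uv_invP[_ Fq] q0 e; apply: q0; rewrite -Fq e /F/= subr0 v00. Qed.

(** * Derivatives in the coordinates (u, v) *)

Section Transport.
Variables (a ax ay : R * R -> R) (q : R * R).
Hypothesis iq : interior Omt q.
Hypothesis sq : SR (uv_inv q).
Hypothesis aD : \forall p \near uv_inv q, is_dx a p (ax p) /\ is_dy a p (ay p).
Hypothesis cax : {for uv_inv q, continuous ax}.
Hypothesis cay : {for uv_inv q, continuous ay}.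

Let p := uv_inv q.
Let A := dx (dx phi).
Let B := dy (dx phi).
Let D := dy (dy phi).

(* Implicit differentiation: along [v = const] one has [v_x dx + v_y dy = 0] and [dx - dy = du]. *)
Lemma transport :
  is_dx (fun z => a (uv_inv z)) q ((ax p * (B p + D p) - ay p * (A p + B p)) / rho p) /\
  is_dy (fun z => a (uv_inv z)) q ((ax p + ay p) / rho p).
Proof.
have [al [be [ca cb alp bep vH]]] := v_carath sq.
have [||||al1 [be1 [ca1 cb1 al1p be1p aH]]] := @caratheodory2 R a ax ay p.
- by apply: filterS aD => z [].
- by apply: filterS aD => z [].
- exact: cax.
- exact: cay.
have rp : 0 < rho p by apply: rho_gt0; [exact: smooth_Omega|exact: smooth_neq0].
have abE : al p + be p = rho p.
  rewrite alp bep (rhoE sq); rewrite -/p.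
  by move: (dx (dx phi) _) (dy (dx phi) _) (dy (dy phi) _) => x y z; ring.
have cG := uv_inv_continuous iq.
have csum : {for p, continuous (fun z => al z + be z)} by apply: cvgD; [exact: ca|exact: cb].
have nz : \forall z \near p, 0 < al z + be z.
  apply: (csum [set x | 0 < x]); apply: open_nbhs_nbhs; split; first exact: open_gt.
  by rewrite /= abE.
have cdiv (k l m : R * R -> R) : {for p, continuous k} -> {for p, continuous l} ->
    {for p, continuous m} -> m p != 0 -> {for p, continuous (fun z => (k z + l z) / m z)}.
  move=> ck cl cm m0; apply: cvgM; first by apply: cvgD; [exact: ck|exact: cl].
  by apply: cvgV => //; exact: cm.
have NE : \forall z \near q, [/\ Omt z, 0 < al (uv_inv z) + be (uv_inv z),
    v (uv_inv z) - v p = al (uv_inv z) * ((uv_inv z).1 - p.1) + be (uv_inv z) * ((uv_inv z).2 - p.2) &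
    a (uv_inv z) - a p = al1 (uv_inv z) * ((uv_inv z).1 - p.1) + be1 (uv_inv z) * ((uv_inv z).2 - p.2)].
  have n1 := cG _ nz; have n2 := cG _ vH; have n3 := cG _ aH.
  near=> z; split.
  - by apply: interior_subset; near: z; exact: open_nbhs_nbhs (conj (@open_interior _ _) iq).
  - by near: z; exact: n1.
  - by near: z; exact: n2.
  - by near: z; exact: n3.
have /nbhs2P[d d0 dP] := NE.
have Oq : Omt q := interior_subset iq.
have uq := uv_inv_u Oq; have vq := uv_inv_v Oq.
have line (l : R -> R * R) (x : R) (m : R * R -> R) : l x = q -> {for x, continuous l} ->
    {for p, continuous m} -> {for x, continuous (fun t => m (uv_inv (l t)))}.
  move=> lx cl cm; apply: (@continuous_comp _ _ _ l (fun z => m (uv_inv z))); first exact: cl.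
  by rewrite lx; apply: (@continuous_comp _ _ _ uv_inv m); [exact: cG|exact: cm].
split.
(* Cramer's rule for the exact increments of v and u along the line; the quotient is a slope
   function, as [is_derive_carath] requires. *)
- pose k z := (al1 z * be z + - (be1 z * al z)) / (al z + be z).
  have ck : {for p, continuous k}.
    apply: cdiv => //; last by rewrite abE gt_eqF.
    + by apply: cvgM; [exact: ca1|exact: cb].
    + by apply: cvgN; apply: cvgM; [exact: cb1|exact: ca].
  have -> : (ax p * (B p + D p) - ay p * (A p + B p)) / rho p = k (uv_inv (q.1, q.2)).
    by rewrite -surjective_pairing -/p /k abE al1p be1p alp bep.
  apply: (@is_derive_carath _ _ _ (fun t => k (uv_inv (t, q.2)))).
    apply: (@line (fun t => (t, q.2))) => //; first by rewrite -surjective_pairing.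
    have c1 : {for q.1, continuous (fun t : R => t)} by exact: cvg_id.
    have c2 : {for q.1, continuous (fun _ : R => q.2)} by exact: cvg_cst.
    exact: (cvg_pair c1 c2).
  apply/nbhs1P; exists d => // t td.
  have [|Oz pos vz az] := dP (t, q.2) td; first by rewrite subrr normr0.
  rewrite -surjective_pairing -/p az.
  have uz := uv_inv_u Oz; have vvz := uv_inv_v Oz; rewrite /= in uz vvz.
  move: vz; rewrite vvz vq subrr /k => vz.
  set z := uv_inv (t, q.2) in uz pos vz *.
  have -> : z.2 - p.2 = (z.1 - p.1) - (t - q.1) by rewrite -uz -uq; ring.
  have E : (al z + be z) * (z.1 - p.1) = be z * (t - q.1).
    have e2 : z.2 - p.2 = (z.1 - p.1) - (t - q.1) by rewrite -uz -uq; ring.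
    rewrite e2 in vz; apply/eqP; rewrite -subr_eq0; apply/eqP; rewrite [RHS]vz; ring.
  have -> : z.1 - p.1 = be z * (t - q.1) / (al z + be z) by rewrite -E mulrC mulKf// gt_eqF.
  by field; rewrite gt_eqF.
- pose k z := (al1 z + be1 z) / (al z + be z).
  have ck : {for p, continuous k} by apply: cdiv => //; rewrite abE gt_eqF.
  have -> : (ax p + ay p) / rho p = k (uv_inv (q.1, q.2)).
    by rewrite -surjective_pairing -/p /k abE al1p be1p.
  apply: (@is_derive_carath _ _ _ (fun t => k (uv_inv (q.1, t)))).
    apply: (@line (fun t => (q.1, t))) => //; first by rewrite -surjective_pairing.
    have c1 : {for q.2, continuous (fun t : R => t)} by exact: cvg_id.
    have c2 : {for q.2, continuous (fun _ : R => q.1)} by exact: cvg_cst.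
    exact: (cvg_pair c2 c1).
  apply/nbhs1P; exists d => // t td.
  have n0 : `|(q.1, t).1 - q.1| < d by rewrite subrr normr0.
  have [Oz pos vz az] := dP (q.1, t) n0 td.
  rewrite -surjective_pairing -/p az.
  have uz := uv_inv_u Oz; have vvz := uv_inv_v Oz; rewrite /= in uz vvz.
  move: vz; rewrite vvz vq /k => vz.
  set z := uv_inv (q.1, t) in uz pos vz *.
  have e2 : z.2 - p.2 = z.1 - p.1.
    have e3 : z.1 - z.2 = p.1 - p.2 by rewrite uz uq.
    have -> : z.2 - p.2 = (z.1 - p.1) - ((z.1 - z.2) - (p.1 - p.2)) by ring.
    by rewrite e3 subrr subr0.
  by rewrite vz e2; field; rewrite gt_eqF.
Unshelve. all: end_near. Qed.

End Transport.

Section TransportPair.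
Variables (A B D Ax Bx By Dy : R * R -> R) (q : R * R).
Hypothesis iq : interior Omt q.
Hypothesis sq : SR (uv_inv q).
Hypothesis rE : \forall p \near uv_inv q, 0 < rho p /\ rho p = A p + 2 * B p + D p.
Hypothesis nD : \forall p \near uv_inv q,
  [/\ is_dx A p (Ax p), is_dy A p (Bx p), is_dx B p (Bx p) & is_dy B p (By p)] /\
  is_dx D p (By p) /\ is_dy D p (Dy p).
Hypotheses (cA : {for uv_inv q, continuous A}) (cB : {for uv_inv q, continuous B})
  (cD : {for uv_inv q, continuous D}) (cAx : {for uv_inv q, continuous Ax})
  (cBx : {for uv_inv q, continuous Bx}) (cBy : {for uv_inv q, continuous By})
  (cDy : {for uv_inv q, continuous Dy}).
Hypothesis phiA : dx (dx phi) (uv_inv q) = A (uv_inv q).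
Hypothesis phiB : dy (dx phi) (uv_inv q) = B (uv_inv q).
Hypothesis phiD : dy (dy phi) (uv_inv q) = D (uv_inv q).

Let sx z := Ax z + 2 * Bx z + By z.
Let sy z := Bx z + 2 * By z + Dy z.

Let rho_derive : \forall p \near uv_inv q, is_dx rho p (sx p) /\ is_dy rho p (sy p).
Proof.
have rE' : \forall p \near uv_inv q, \forall z \near p, A z + 2 * B z + D z = rho z.
  by apply: filterS (near_join rE) => p; apply: filterS => z [_ ->].
apply: filterS2 rE' nD => p rp [[D1 D2 D3 D4] [D5 D6]].
rewrite /is_dx /is_dy in D1 D2 D3 D4 D5 D6; split.
  by apply: near_is_dx rp _; eapply der_eq; [der|rewrite /sx /=; ring].
by apply: near_is_dy rp _; eapply der_eq; [der|rewrite /sy /=; ring].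
Qed.

Let crho : {for uv_inv q, continuous rho}.
Proof.
apply: (@near_continuous2 _ (fun z => A z + 2 * B z + D z)).
  by apply: filterS rE => z [_ ->].
apply: cvgD; last exact: cD.
by apply: cvgD; [exact: cA|apply: cvgM; [exact: cvg_cst|exact: cB]].
Qed.

Let csx : {for uv_inv q, continuous sx}.
Proof.
apply: cvgD; last exact: cBy.
by apply: cvgD; [exact: cAx|apply: cvgM; [exact: cvg_cst|exact: cBx]].
Qed.

Let csy : {for uv_inv q, continuous sy}.
Proof.
apply: cvgD; last exact: cDy.
by apply: cvgD; [exact: cBx|apply: cvgM; [exact: cvg_cst|exact: cBy]].
Qed.

Let rpos : 0 < rho (uv_inv q). Proof. by have [] := nbhs_singleton rE. Qed.

Let cquot (f : R * R -> R) (k : R) : {for uv_inv q, continuous f} -> k != 0 ->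
  {for uv_inv q, continuous (fun z => f z / (k * rho z ^+ 2))}.
Proof.
move=> cf k0; apply: cvgM; first exact: cf.
apply: cvgV; first by rewrite mulf_neq0// expf_neq0// gt_eqF.
apply: cvgM; first exact: cvg_cst.
rewrite (_ : (fun z => _) = fun z => rho z * rho z); last by apply/funext => z; rewrite expr2.
by rewrite expr2; apply: cvgM; exact: crho.
Qed.

(** For w = x + y one has w_v = 2 / rho and w_u = - (A - D) / rho, so the sum is half of w_vu -
    w_uv. It vanishes by the symmetry of the third derivatives of [phi], built into the names [Bx]
    and [By]. *)
Lemma transport_pair :
  exists Puu Pvv : R, [/\ is_dx (fun z => (rho (uv_inv z))^-1) q Puu,
    is_dy (fun z => (A (uv_inv z) - D (uv_inv z)) / (2 * rho (uv_inv z))) q Pvv & Puu + Pvv = 0].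
Proof.
have n1 : 1 != 0 :> R by exact: oner_neq0.
have n2 : 2 != 0 :> R by [].
have [|||D1 _] := @transport (fun z => (rho z)^-1) (fun z => - sx z / (1 * rho z ^+ 2))
    (fun z => - sy z / (1 * rho z ^+ 2)) q iq sq.
- apply: filterS2 rho_derive rE => -[x y] [D1 D2] [r0 _]; rewrite !mul1r.
  have r0' : rho (x, y) != 0 by rewrite gt_eqF.
  by split; [exact: (@derV _ (fun t => rho (t, y)) x _ r0' D1)|
    exact: (@derV _ (fun t => rho (x, t)) y _ r0' D2)].
- by apply: cquot => //; apply: cvgN; exact: csx.
- by apply: cquot => //; apply: cvgN; exact: csy.
have [|||_ D2] := @transport (fun z => (A z - D z) / (2 * rho z))
    (fun z => ((Ax z - By z) * rho z - (A z - D z) * sx z) / (2 * rho z ^+ 2))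
    (fun z => ((Bx z - Dy z) * rho z - (A z - D z) * sy z) / (2 * rho z ^+ 2)) q iq sq.
- apply: filterS3 nD rho_derive rE => p [[E1 E2 E3 E4] [E5 E6]] [E7 E8] [r0 _].
  have r0' : 2 * rho p != 0 by rewrite mulf_neq0// gt_eqF.
  have r0'' : rho p != 0 by rewrite gt_eqF.
  rewrite /is_dx /is_dy in E1 E2 E3 E4 E5 E6 E7 E8.
  case: p => x y in E1 E2 E3 E4 E5 E6 E7 E8 r0 r0' r0'' *.
  split.
    eapply der_eq; first by apply derM; [der|apply derV; [exact: r0'|der]].
    by rewrite /=; field.
  eapply der_eq; first by apply derM; [der|apply derV; [exact: r0'|der]].
  by rewrite /=; field.
- apply: cquot => //; apply: cvgB; apply: cvgM.
  + by apply: cvgB; [exact: cAx|exact: cBy].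
  + exact: crho.
  + by apply: cvgB; [exact: cA|exact: cD].
  + exact: csx.
- apply: cquot => //; apply: cvgB; apply: cvgM.
  + by apply: cvgB; [exact: cBx|exact: cDy].
  + exact: crho.
  + by apply: cvgB; [exact: cA|exact: cD].
  + exact: csy.
do 2 eexists; split; [exact: D1|exact: D2|].
rewrite phiA phiB phiD.
have [r0 r1] := nbhs_singleton rE; move: r0 r1; rewrite /sx /sy.
move: (rho (uv_inv q)) (A (uv_inv q)) (B (uv_inv q)) (D (uv_inv q)) (Ax (uv_inv q)) (Bx (uv_inv q))
  (By (uv_inv q)) (Dy (uv_inv q)) => r a b d a1 b1 b2 d2 r0 r1.
rewrite r1 in r0 *; field; exact: lt0r_neq0.
Qed.

End TransportPair.


(** * The harmonic primitive of 1 / rho *)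

Let A := dx (dx phi).
Let B := dy (dx phi).
Let D := dy (dy phi).
Let Ax := dx (dx (dx phi)).
Let Bx := dx (dy (dx phi)).
Let By := dy (dy (dx phi)).
Let Dy := dy (dy (dy phi)).

Hypothesis MA : forall p, SR p -> A p * D p - B p ^+ 2 = 1.

Lemma third_derivs p : SR p ->
  [/\ is_dx A p (Ax p), is_dy A p (Bx p), is_dx B p (Bx p) & is_dy B p (By p)] /\
  is_dx D p (By p) /\ is_dy D p (Dy p).
Proof.
move=> ps; have nS := smooth_near ps.
have oS := @open_smooth_region R.
have sx := smooth_dx sphi; have sy := smooth_dy sphi.
have e1 : dy (dx (dx phi)) p = Bx p by rewrite -(smooth_clairaut oS sx ps); reflexivity.
have e2 : dx (dy (dy phi)) p = By p.
  rewrite (smooth_clairaut oS sy ps); apply: dy_near.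
  by apply: filterS nS => q; exact: phi_dxy.
split; first split.
- exact: (@smooth_is_dx _ phi SR [:: false; false]).
- by rewrite -e1; exact: (@smooth_is_dy _ phi SR [:: false; false]).
- exact: (@smooth_is_dx _ phi SR [:: true; false]).
- exact: (@smooth_is_dy _ phi SR [:: true; false]).
split; last exact: (@smooth_is_dy _ phi SR [:: true; true]).
by rewrite -e2; exact: (@smooth_is_dx _ phi SR [:: true; true]).
Qed.

(** The derivative of [phi] in u at fixed x + y, carried over to the coordinates (u, v). *)
Definition momentum (q : R * R) : R := (dx phi (uv_inv q) - dy phi (uv_inv q)) / 2.

(** In the u-derivative the cofactors combine to (A D - B^2) / rho, which is 1 / rho by the
    Monge-Ampere equation. *)
Lemma momentum_derive q : interior Omt q -> SR (uv_inv q) ->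
  is_dx momentum q (rho (uv_inv q))^-1 /\
  is_dy momentum q ((A (uv_inv q) - D (uv_inv q)) / (2 * rho (uv_inv q))).
Proof.
move=> iq sq; have nS := smooth_near sq.
have [|||] := @transport (fun p => (dx phi p - dy phi p) / 2)
    (fun p => (A p - B p) / 2) (fun p => (B p - D p) / 2) q iq sq.
- apply: filterS nS => p ps; split.
    have D1 := @smooth_is_dx _ phi SR [:: false] p sphi ps.
    have D2 := @smooth_is_dx _ phi SR [:: true] p sphi ps.
    rewrite /= in D1 D2; rewrite (phi_dxy ps) in D2.
    eapply der_eq; first by apply derM; [apply derD; [exact: D1|apply derN; exact: D2]|exact: derC].
    by rewrite mulr0 addr0.
  have D1 := @smooth_is_dy _ phi SR [:: false] p sphi ps.
  have D2 := @smooth_is_dy _ phi SR [:: true] p sphi ps.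
  rewrite /= in D1 D2.
  eapply der_eq; first by apply derM; [apply derD; [exact: D1|apply derN; exact: D2]|exact: derC].
  by rewrite mulr0 addr0.
- apply: cvgM; last exact: cvg_cst.
  by apply: cvgB; [exact: (@smooth_continuous _ phi SR [:: false; false])|
    exact: (@smooth_continuous _ phi SR [:: true; false])].
- apply: cvgM; last exact: cvg_cst.
  by apply: cvgB; [exact: (@smooth_continuous _ phi SR [:: true; false])|
    exact: (@smooth_continuous _ phi SR [:: true; true])].
have ma := MA sq.
have r0 : rho (uv_inv q) != 0.
  by rewrite gt_eqF// rho_gt0//; [exact: smooth_Omega|exact: smooth_neq0].
move: ma r0; rewrite -/A -/B -/D.
move: (A (uv_inv q)) (B (uv_inv q)) (D (uv_inv q)) (rho (uv_inv q)) => a b d r ma r0 D1 D2.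
split; [apply: (der_eq D1)|apply: (der_eq D2)]; last by field.
have -> : (a - b) / 2 * (b + d) - (b - d) / 2 * (a + b) = a * d - b ^+ 2 by field.
by rewrite ma mul1r.
Qed.

Lemma momentum_second_derive q : interior Omt q -> SR (uv_inv q) ->
  exists Puu Pvv : R, [/\ is_dx (fun z => (rho (uv_inv z))^-1) q Puu,
    is_dy (fun z => (A (uv_inv z) - D (uv_inv z)) / (2 * rho (uv_inv z))) q Pvv & Puu + Pvv = 0].
Proof.
move=> iq sq; have nS := smooth_near sq.
have c w : {for uv_inv q, continuous (pdiff w phi)} by exact: smooth_continuous sphi sq.
have cA := c [:: false; false]; have cB := c [:: true; false]; have cD := c [:: true; true].
have cAx := c [:: false; false; false]; have cBx := c [:: false; true; false].
have cBy := c [:: true; true; false]; have cDy := c [:: true; true; true].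
have rE : \forall p \near uv_inv q, 0 < rho p /\ rho p = A p + 2 * B p + D p.
  apply: filterS nS => p ps; split; last exact: rhoE.
  by apply: rho_gt0; [exact: smooth_Omega|exact: smooth_neq0].
have nD : \forall p \near uv_inv q,
  [/\ is_dx A p (Ax p), is_dy A p (Bx p), is_dx B p (Bx p) & is_dy B p (By p)] /\
  is_dx D p (By p) /\ is_dy D p (Dy p).
  by apply: filterS nS => p; exact: third_derivs.
have := @transport_pair A B D Ax Bx By Dy q iq sq rE nD cA cB cD cAx cBx cBy cDy
  erefl erefl erefl.
exact.
Qed.


(** * Convexity, mass balance and the behaviour at the slit *)

Hypothesis cvx : convex_fun_on (@Omega R) phi.
Hypothesis push : brenier_pushforward phi.
Hypothesis crho : {within @Omega R `\ (0, 0), continuous rho}.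

(** On the segment from [p] to [p'], convexity bounds every difference quotient at [p], hence the
    derivative there, by the slope of the whole chord. *)
Lemma convex_tangent p p' : SR p -> Omega p' ->
  phi p + dx phi p * (p'.1 - p.1) + dy phi p * (p'.2 - p.2) <= phi p'.
Proof.
move=> ps Op'; have nS := smooth_near ps.
have [||||al [be [ca cb alp bep H]]] := @caratheodory2 R phi (dx phi) (dy phi) p.
- by apply: filterS nS => q; exact: (@smooth_is_dx _ phi SR [::]).
- by apply: filterS nS => q; exact: (@smooth_is_dy _ phi SR [::]).
- exact: (@smooth_continuous _ phi SR [:: false]).
- exact: (@smooth_continuous _ phi SR [:: true]).
have D1 : der1 (fun t => t * p'.1 + (1 - t) * p.1) 0 (p'.1 - p.1).
  by eapply der_eq; [der|rewrite /=; ring].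
have D2 : der1 (fun t => t * p'.2 + (1 - t) * p.2) 0 (p'.2 - p.2).
  by eapply der_eq; [der|rewrite /=; ring].
have E1 : 0 * p'.1 + (1 - 0) * p.1 = p.1 by ring.
have E2 : 0 * p'.2 + (1 - 0) * p.2 = p.2 by ring.
have := caratheodory_curve ca cb H D1 D2 E1 E2.
rewrite alp bep -addrA; move: (dx phi p * _ + _) => l dl.
rewrite -lerBrDl leNgt; apply/negP => lt.
move/is_deriveP : dl => /(_ (l - (phi p' - phi p))); rewrite subr_gt0 => /(_ lt)[d d0 dP].
pose t := Num.min (d / 2) 1.
have t0 : 0 < t by rewrite lt_min divr_gt0//=.
have td : t < d by rewrite gt_min ltr_pdivrMr// ltr_pMr// ltr1n.
have t1 : t <= 1 by rewrite ge_min lexx orbT.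
have := dP t; rewrite subr0 gt_eqF// gtr0_norm// => /(_ isT td).
rewrite E1 E2 -surjective_pairing ltr_norml => /andP[+ _].
have tI : 0 <= t <= 1 by rewrite (ltW t0).
have := @cvx p' p t Op' (smooth_Omega ps) tI.
set y := phi (_, _) => h.
have : (y - phi p) / t <= phi p' - phi p by rewrite ler_pdivrMr//; lra.
lra.
Qed.

Lemma grad_monotone p p' : SR p -> SR p' ->
  0 <= (dx phi p - dx phi p') * (p.1 - p'.1) + (dy phi p - dy phi p') * (p.2 - p'.2).
Proof.
move=> ps ps'.
have := convex_tangent ps (smooth_Omega ps'); have := convex_tangent ps' (smooth_Omega ps).
move: (dx phi p) (dx phi p') (dy phi p) (dy phi p') => a b c d; lra.
Qed.

Let U := interior Omt.
Let gam q := (rho (uv_inv q))^-1.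

Let momentum_eq q : SR (uv_inv q) -> Omt q ->
  [/\ (grad phi (uv_inv q)).1 - (grad phi (uv_inv q)).2 = 2 * momentum q &
      (grad phi (uv_inv q)).1 + (grad phi (uv_inv q)).2 = q.2].
Proof.
move=> sq Oq; split; last by rewrite /= -(vE sq) (uv_inv_v Oq).
by rewrite /momentum /=; field.
Qed.

Let momentum_Theta q : U q -> ~ (q.1 = 0 /\ 0 <= q.2) ->
  2 * q.2 <= `|momentum q| /\ 2 * `|momentum q| - 1 <= q.2.
Proof.
move=> Uq nq; have sq := uv_inv_smooth Uq nq.
have [e1 e2] := momentum_eq sq (interior_subset Uq).
have /ThetaE := grad_in_Theta sphi push sq.
rewrite e1 e2 normrM ger0_norm// => -[h1 h2 _]; split; lra.
Qed.

Let momentum_le1 q : U q -> ~ (q.1 = 0 /\ 0 <= q.2) -> `|momentum q| <= 1.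
Proof. by move=> Uq nq; have [] := momentum_Theta Uq nq; lra. Qed.

(** At equal v the gradients have equal component sums, so they differ by a multiple of (1, -1) and
    monotonicity of the gradient only sees u. *)
Let momentum_mono q q' : U q /\ ~ (q.1 = 0 /\ 0 <= q.2) -> U q' /\ ~ (q'.1 = 0 /\ 0 <= q'.2) ->
  q.2 = q'.2 -> 0 <= (momentum q - momentum q') * (q.1 - q'.1).
Proof.
move=> [Uq nq] [Uq' nq'] e.
have sq := uv_inv_smooth Uq nq; have sq' := uv_inv_smooth Uq' nq'.
have [m1 s1] := momentum_eq sq (interior_subset Uq).
have [m2 s2] := momentum_eq sq' (interior_subset Uq').
have := grad_monotone sq sq'.
rewrite -(uv_inv_u (interior_subset Uq)) -(uv_inv_u (interior_subset Uq')).
move: m1 s1 m2 s2; rewrite /grad /= e.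
move: (dx phi (uv_inv q)) (dy phi (uv_inv q)) (dx phi (uv_inv q')) (dy phi (uv_inv q')).
move: (momentum q) (momentum q') => x y a b c d.
move: (uv_inv q) (uv_inv q') => -[z1 z2] [w1 w2] /= m1 s1 m2 s2.
have -> : x - y = a - c by lra.
have -> : b - d = - (a - c) by lra.
have -> : (a - c) * (z1 - w1) + - (a - c) * (z2 - w2) = (a - c) * (z1 - z2 - (w1 - w2)) by ring.
by [].
Qed.

Let momentum_dense (P v0 e : R) : 0 < e -> 0 < v0 -> 2 * v0 < `|P| -> 2 * `|P| - 1 < v0 ->
  exists q, [/\ U q /\ ~ (q.1 = 0 /\ 0 <= q.2), `|momentum q - P| < e & `|q.2 - v0| < e].
Proof.
move=> e0 v0_gt0 h1 h2.
(* A box of half-width [h] fits into [Theta]: over it the component sum varies by 2 h and |X - Y| by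
   2 h. The edge 4 v <= |X - Y| thus costs 10 h, the edge |X - Y| - 1 <= v costs 4 h, and h <= v0 /
   2 keeps v nonnegative. *)
pose h := Num.min (Num.min (e / 2) (v0 / 2))
  (Num.min ((2 * `|P| - 4 * v0) / 10) ((v0 + 1 - 2 * `|P|) / 4)).
have h0 : 0 < h by rewrite !lt_min; apply/andP; split; apply/andP; split; lra.
have : h <= Num.min (Num.min (e / 2) (v0 / 2))
  (Num.min ((2 * `|P| - 4 * v0) / 10) ((v0 + 1 - 2 * `|P|) / 4)) by [].
rewrite !le_min => /andP[/andP[k1 k2] /andP[k3 k4]].
pose X := v0 / 2 + P; pose Y := v0 / 2 - P.
have [||q|p ps] := @grad_hits_box _ phi push (X - h) (X + h) (Y - h) (Y + h).
- lra.
- lra.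
- move=> [/=]; rewrite !in_itv/= => /andP[a1 a2] /andP[b1 b2]; apply/ThetaE.
  have n1 : `|q.1 - q.2| <= 2 * `|P| + 2 * h.
    have -> : q.1 - q.2 = 2 * P + (q.1 - q.2 - (X - Y)) by rewrite /X /Y; field.
    apply: (le_trans (ler_normD _ _)); rewrite normrM ger0_norm// lerD2l.
    by rewrite ler_norml; apply/andP; split; lra.
  have n2 : 2 * `|P| - 2 * h <= `|q.1 - q.2|.
    have : `|2 * P| <= `|q.1 - q.2| + 2 * h.
      have -> : 2 * P = q.1 - q.2 + ((X - Y) - (q.1 - q.2)) by rewrite /X /Y; field.
      apply: (le_trans (ler_normD _ _)); rewrite lerD2l.
      by rewrite ler_norml; apply/andP; split; lra.
    by rewrite normrM ger0_norm//; lra.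
  have s1 : v0 - 2 * h <= q.1 + q.2 by rewrite /X /Y in a1 b1; lra.
  have s2 : q.1 + q.2 <= v0 + 2 * h by rewrite /X /Y in a2 b2; lra.
  by split; lra.
- move=> [/=]; rewrite !in_itv/= => /andP[a1 a2] /andP[b1 b2].
  have ip : interior (@Omega R) p by have [] := ps.
  have fp : uv_inv (F p) = p by apply: uv_invK; exact: smooth_Omega.
  exists (F p); split.
  + by split; [exact: interior_Omt_F|exact: smooth_not_ray].
  + rewrite /momentum fp ltr_norml; move: (dx phi p) (dy phi p) a1 a2 b1 b2 => a b.
    by rewrite /X /Y => *; apply/andP; split; lra.
  + rewrite /= (vE ps) ltr_norml; move: (dx phi p) (dy phi p) a1 a2 b1 b2 => a b.
    by rewrite /X /Y => *; apply/andP; split; lra.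
Qed.

(** The preimages of both points lie inside the fiber u = 0, where v is continuous; the intermediate
    value theorem on the segment between them reaches v'. *)
Let axis_interval v1 v2 v' : U (0, v1) -> U (0, v2) -> v1 <= v' -> v' <= v2 -> U (0, v').
Proof.
move=> U1 U2 v1v; rewrite le_eqVlt => /orP[/eqP->//|vv2].
have O1 := interior_subset U1; have O2 := interior_subset U2.
have i1 := uv_inv_interior U1; have i2 := uv_inv_interior U2.
have [Op1 _] := uv_invP O1; have [Op2 _] := uv_invP O2.
have u1 := uv_inv_u O1; have u2 := uv_inv_u O2; have w1 := uv_inv_v O1; have w2 := uv_inv_v O2.
rewrite /= in u1 u2 w1 w2.
set p1 := uv_inv (0, v1) in i1 Op1 u1 w1; set p2 := uv_inv (0, v2) in i2 Op2 u2 w2.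
have e1 : fiber_pt 0 (p1.1 + p1.2) = p1 by rewrite -u1 fiber_ptE.
have e2 : fiber_pt 0 (p2.1 + p2.2) = p2 by rewrite -u2 fiber_ptE.
have lt : p1.1 + p1.2 < p2.1 + p2.2.
  by apply: v_fiber_lt => //; [rewrite u1 u2|rewrite w1 w2; exact: le_lt_trans vv2].
rewrite -e1 in i1; rewrite -e2 in i2.
have ii s : p1.1 + p1.2 <= s -> s <= p2.1 + p2.2 -> interior (@Omega R) (fiber_pt 0 s).
  move=> s1 s2; move/fiber_interior/andP : i1 => [a _]; move/fiber_interior/andP : i2 => [_ b].
  by apply/fiber_interior/andP; split; [exact: lt_le_trans s1|exact: le_lt_trans b].
have [||s] := @IVT R (fun s => v (fiber_pt 0 s)) (p1.1 + p1.2) (p2.1 + p2.2) v' (ltW lt).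
- apply/subspace_continuousP => s; rewrite /= in_itv/= => /andP[s1 s2].
  by apply: cvg_within_filter; apply: v_fiber_continuous; exact: ii.
- by rewrite e1 e2 w1 w2 ge_min v1v le_max (ltW vv2) orbT.
rewrite in_itv/= => /andP[s1 s2] vs.
by have := interior_Omt_F (ii s s1 s2); rewrite /F fiber_pt_u vs.
Qed.

Let momentum_continuous q : U q -> ~ (q.1 = 0 /\ 0 <= q.2) -> {for q, continuous momentum}.
Proof.
move=> Uq nq; have sq := uv_inv_smooth Uq nq.
have c1 : {for uv_inv q, continuous (fun p => (dx phi p - dy phi p) / 2)}.
  apply: cvgM; last exact: cvg_cst.
  by apply: cvgB; [exact: (@smooth_continuous _ phi SR [:: false])|
    exact: (@smooth_continuous _ phi SR [:: true])].
exact: (continuous_comp (uv_inv_continuous Uq) c1).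
Qed.

(** [rho] is continuous and positive also at slit points other than the origin, so [gam] is
    continuous across the ray. *)
Let gam_continuous q : U q -> q <> (0, 0) -> {for q, continuous gam}.
Proof.
move=> Uq q0; have Oq := interior_subset Uq.
have p0 := uv_inv_neq0 Oq q0; have ip := uv_inv_interior Uq.
have cr : {for uv_inv q, continuous rho}.
  apply: (within_interior_continuous crho).
  have [d d0 dP] : exists2 d : R, 0 < d & forall z, `|z.1 - (uv_inv q).1| < d ->
      `|z.2 - (uv_inv q).2| < d -> z <> (0, 0).
    have [e1|e1] := eqVneq (uv_inv q).1 0.
      have e2 : (uv_inv q).2 != 0.
        by apply/eqP => e2; apply: p0; rewrite [uv_inv q]surjective_pairing e1 e2.
      exists `|(uv_inv q).2|; first by rewrite normr_gt0.
      by move=> z _ + z0; rewrite z0 /= sub0r normrN ltxx.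
    exists `|(uv_inv q).1|; first by rewrite normr_gt0.
    by move=> z + _ z0; rewrite z0 /= sub0r normrN ltxx.
  move/nbhs2P : ip => [e e0 eP].
  apply/nbhs2P; exists (Num.min d e); first by rewrite lt_min d0.
  move=> z; rewrite !lt_min => /andP[a1 a2] /andP[b1 b2].
  by split; [exact: eP|exact: dP].
have c1 : {for uv_inv q, continuous (fun p => (rho p)^-1)}.
  apply: cvgV; last exact: cr.
  by rewrite gt_eqF// rho_gt0//; have [] := uv_invP Oq.
exact: (continuous_comp (uv_inv_continuous Uq) c1).
Qed.

Lemma conformal_factor : exists (k : R) (h : R * R -> R), 0 <= k /\
  [/\ smooth_on U h, forall p, U p -> dx (dx h) p + dy (dy h) p = 0 &
     forall q, U q -> q <> (0, 0) -> gam q = - (2 * k / pi) * lognorm q + h q].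
Proof.
have oU : open U by exact: open_interior.
have U0 : U (0, 0).
  have -> : (0, 0) = F (0, 0) by rewrite /F /= subr0 v00.
  apply: interior_Omt_F; apply/interior_OmegaE; rewrite /= subrr normr0.
  by apply/andP; split; lra.
have mD q : U q -> ~ (q.1 = 0 /\ 0 <= q.2) -> is_dx momentum q (gam q) /\
    is_dy momentum q ((A (uv_inv q) - D (uv_inv q)) / (2 * rho (uv_inv q))).
  by move=> Uq nq; apply: momentum_derive => //; exact: uv_inv_smooth.
have [k [k0 [N kN]]] := @slit_jump R U momentum gam oU axis_interval
  (fun q oq => proj1 (mD q (proj1 oq) (proj2 oq)))
  (fun q oq => momentum_continuous (proj1 oq) (proj2 oq)) gam_continuous
  (fun q oq => momentum_Theta (proj1 oq) (proj2 oq))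
  (fun q oq => momentum_le1 (proj1 oq) (proj2 oq)) momentum_mono momentum_dense.
have mD2 q : U q -> ~ (q.1 = 0 /\ 0 <= q.2) -> exists l1 l2 : R,
    [/\ is_dx momentum q (gam q) /\
         is_dy momentum q ((A (uv_inv q) - D (uv_inv q)) / (2 * rho (uv_inv q))),
      is_dx gam q l1,
      is_dy (fun q => (A (uv_inv q) - D (uv_inv q)) / (2 * rho (uv_inv q))) q l2 & l1 + l2 = 0].
  move=> Uq nq; have sq := uv_inv_smooth Uq nq.
  have [l1 [l2 [E1 E2 E3]]] := momentum_second_derive Uq sq.
  by exists l1, l2; split; [exact: mD|exact: E1|exact: E2|exact: E3].
have [h [sh hh hE]] := @slit_harmonic R U momentum _ gam oU U0 mD2 momentum_continuous
  gam_continuous momentum_le1 k N kN.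
by exists k, h; split; [exact: k0|split; [exact: sh|exact: hh|exact: hE]].
Qed.

End InverseMap.

(** * The logarithmic form of the conformal factor *)

Unset Implicit Arguments.
Set Strict Implicit.
Set Printing Implicit Defensive.

Theorem theorem4p5 (R : realType) (phi v rho g : R * R -> R) :
  (* phi is the Brenier potential *)
  convex_fun_on (@Omega R) phi ->
  brenier_pushforward phi ->
  (* standing facts from the context *)
  smooth_on (@smooth_region R) phi ->
  (forall p, smooth_region p ->
     dx (dx phi) p * dy (dy phi) p - dy (dx phi) p ^+ 2 = 1) ->
  (* v = phi_x + phi_y, extended continuously to Omega *)
  {within @Omega R, continuous v} ->
  (forall p, smooth_region p -> v p = dx phi p + dy phi p) ->
  (* rho = phi_xx + 2 phi_xy + phi_yy, extended continuously and positively to Omega \ 0 *)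
  {within @Omega R `\ (0, 0), continuous rho} ->
  (forall p, Omega p -> p <> (0, 0) -> 0 < rho p) ->
  (forall p, smooth_region p ->
     rho p = dx (dx phi) p + 2 * dy (dx phi) p + dy (dy phi) p) ->
  (* f = (u, v) is a homeomorphism of Omega onto its image fixing the origin *)
  {in @Omega R &, injective (fun p => (p.1 - p.2, v p))} ->
  v (0, 0) = 0 ->
  (* g is rho^-1 viewed as a function of (u, v) on tilde Omega^* *)
  (forall p, Omega p -> p <> (0, 0) -> g (p.1 - p.2, v p) = (rho p)^-1) ->
  let Omt := (fun p => (p.1 - p.2, v p)) @` @Omega R in
  harmonic_on (interior (Omt `\ (0, 0))) g /\
  exists (C : R) (h : R * R -> R),
    0 <= C /\ smooth_on (interior Omt) h /\ harmonic_on (interior Omt) h /\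
    forall q, interior Omt q -> q <> (0, 0) ->
      g q = - C * ln (Num.sqrt (q.1 ^+ 2 + q.2 ^+ 2)) + h q.
Proof.
move=> cvx push sphi MA cv vE crho rho_gt0 rhoE finj v00 gE Omt.
have [k [h [k0 [sh hh hE]]]] :=
  conformal_factor sphi cv vE rho_gt0 rhoE finj v00 MA cvx push crho.
have {}gE q : interior Omt q -> q <> (0, 0) -> g q = - (2 * k / pi) * lognorm q + h q.
  move=> Oq q0; rewrite -hE//; have [p Op pq] := interior_subset Oq.
  have p0 : p <> (0, 0) by move=> p0; apply: q0; rewrite -pq p0 /= subrr v00.
  by rewrite -{1}pq (gE _ Op p0) -pq (uv_invK finj Op).
pose W := interior (Omt `\ (0, 0)).
have oW : open W by exact: open_interior.
have W0 q : W q -> q <> (0, 0) by move=> /interior_subset[_ /= /eqP/eqP].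
have WU q : W q -> interior Omt q.
  by move=> Wq; apply: filterS Wq => z [].
have slog : smooth_on W (@lognorm R) by exact: smooth_on_sub W0 (@lognorm_smooth R).
have shW : smooth_on W h by exact: smooth_on_sub WU sh.
have sK := smooth_lin (- (2 * k / pi)) 1 oW slog shW.
(* The factor 1 matches the shape of [smooth_lin] and [laplace_lin]. *)
have gK q : W q -> g q = - (2 * k / pi) * lognorm q + 1 * h q.
  by move=> Wq; rewrite mul1r gE; [|exact: WU|exact: W0].
have nW q : W q -> nbhs q W by move=> Wq; exact: open_nbhs_nbhs.
split; first split.
- have sg : smooth_on W g.
    apply: near_smooth_on => p Wp; exists (fun q => - (2 * k / pi) * lognorm q + 1 * h q), W.
    by split; [exact: sK|exact: Wp|apply: filterS (nW p Wp) => q; exact: gK].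
  exact: sg.
- move=> p Wp.
  have nE : \forall q \near p, \forall z \near q, g z = - (2 * k / pi) * lognorm z + 1 * h z.
    by apply: filterS (nW p Wp) => q Wq; apply: filterS (nW q Wq) => z; exact: gK.
  have e1 : dx (dx g) p = dx (dx (fun z => - (2 * k / pi) * lognorm z + 1 * h z)) p.
    by apply: dx_near; apply: filterS nE => q; exact: dx_near.
  have e2 : dy (dy g) p = dy (dy (fun z => - (2 * k / pi) * lognorm z + 1 * h z)) p.
    by apply: dy_near; apply: filterS nE => q; exact: dy_near.
  rewrite e1 e2; apply: etrans (laplace_lin _ _ oW slog shW Wp) _.
  apply: etrans (f_equal2 (fun x y => - (2 * k / pi) * x + 1 * y)
    (lognorm_laplace (W0 p Wp)) (hh p (WU p Wp))) _.
  by rewrite !mulr0 addr0.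
exists (2 * k / pi), h; split; first by rewrite divr_ge0 ?mulr_ge0 ?pi_ge0.
split; first exact: sh.
split; first by split; [exact: sh|exact: hh].
by move=> q Uq q0; rewrite gE// lognormE.
Qed.
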